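(* Let $n\ge 1$, let ${\bf A}$ be an $n\times n$ positive definite matrix, and let $d_1,\ldots,d_n$ be the eigenvalues of ${\bf A}$, assumed pairwise distinct. Let $f:\mathbb{R}^{+}\to\mathbb{R}$ be a continuous function such that $\int_0^\infty e^{-\alpha t}|f(t)|^2\,dt<\infty$ for every $\alpha>0$. Then $$\int_{M_n}\mathrm{Tr}\big(f({\bf H}^{*}{\bf A}{\bf H})\big)\,d\nu({\bf H})=\frac{1}{\det(\Delta({\bf D}))}\sum_{k=0}^{n-1}\det({\bf T}_k),$$ where $\Delta({\bf D})$ is the $n\times n$ Vandermonde matrix whose $j$-th row ($j=1,\ldots,n$) is $(d_1^{n-j},d_2^{n-j},\ldots,d_n^{n-j})$, and ${\bf T}_k$ is the matrix obtained from $\Delta({\bf D})$ by replacing its $(k+1)$-th row $(d_i^{n-(k+1)})_{i=1}^n$ by the row $$\Big(\frac{1}{(n-(k+1))!}f_k(d_i)\Big)_{i=1}^n,\qquad f_k(x):=\int_0^\infty e^{-t}(tx)^{n-(k+1)}f(tx)\,dt.$$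
   Context: $M_n$ denotes the set of $n\times n$ complex matrices, $d{\bf H}$ Lebesgue measure on $M_n\cong\mathbb{R}^{2n^2}$, and $d\nu({\bf H})=\pi^{-n^2}\exp(-\mathrm{Tr}({\bf H}^*{\bf H}))\,d{\bf H}$ the Gaussian probability measure (the law of a matrix with i.i.d. complex entries of zero mean and unit variance). For a Hermitian matrix ${\bf B}={\bf U}\,\mathrm{diag}(b_1,\ldots,b_n){\bf U}^*$ with ${\bf U}$ unitary, $f({\bf B}):={\bf U}\,\mathrm{diag}(f(b_1),\ldots,f(b_n)){\bf U}^*$. ${\bf D}=\mathrm{diag}(d_1,\ldots,d_n)$. *)

(* Defs.v *)
From HB Require Import structures.
From mathcomp Require Import all_boot all_order all_algebra.
From mathcomp Require Import sesquilinear spectral.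
From mathcomp Require Import all_classical all_reals all_analysis.
From mathcomp.real_closed Require Import complex.

Set Implicit Arguments.
Unset Strict Implicit.
Unset Printing Implicit Defensive.

Import Order.TTheory GRing.Theory Num.Theory.
Import numFieldNormedType.Exports.
Local Open Scope classical_set_scope.
Local Open Scope ring_scope.

Section Defs.
Variable R : realType.
Local Notation C := (R[i]).

(* Iterated Lebesgue integral over the real coordinates 0 .. m-1 of a point
   x : nat -> R (coordinates >= m are left as in x).  The outermost integral
   is over coordinate m-1.  By Fubini this is the Lebesgue integral over R^m
   for Lebesgue-integrable integrands. *)
Fixpoint iter_Rint (m : nat) (F : (nat -> R) -> R) (x : nat -> R) : R :=
  match m with
  | 0 => F x
  | m'.+1 => Rintegral lebesgue_measure [set: R]
      (fun t => iter_Rint m' F (fun k => if k == m' then t else x k))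
  end.

Definition mx_of_coords (n : nat) (x : nat -> R) : 'M[C]_n :=
  \matrix_(i < n, j < n)
    Complex (x (2 * (i * n + j))%N) (x (2 * (i * n + j) + 1)%N).

Definition adjmx (n : nat) (H : 'M[C]_n) : 'M[C]_n := map_mx Num.conj (H ^T).

Definition gauss_mx_integral (n : nat) (G : 'M[C]_n -> R) : R :=
  iter_Rint (2 * (n * n))
    (fun x => let H := mx_of_coords n x in
       (pi ^- (n * n)) * expR (- complex.Re (\tr (adjmx H *m H))) * G H)
    (fun _ => 0).

(* functional calculus: if B = U diag(b) U^* (U unitary) then
   f(B) = U diag(f(b)) U^*.  spectralmx B is a unitary P with
   B = P^-1 diag(spectral_diag B) P, i.e. U = P^* ; for Hermitian B the b_i
   are real, so f is applied to their real parts. *)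
Definition mxfun (n : nat) (f : R -> R) (B : 'M[C]_n) : 'M[C]_n :=
  let P := spectralmx B in
  adjmx P *m diag_mx (map_mx (fun z : C => ((f (complex.Re z))%:C)%C) (spectral_diag B)) *m P.

Definition posdefmx (n : nat) (A : 'M[C]_n) : Prop :=
  A \is hermsymmx /\
  forall v : 'rV[C]_n, v != 0 -> 0 < (v *m A *m (map_mx Num.conj (v ^T))) 0 0.

Definition vandermonde_D (n : nat) (d : 'I_n -> R) : 'M[R]_n :=
  \matrix_(j < n, i < n) d i ^+ (n - j.+1).

Definition fk (n : nat) (f : R -> R) (k : nat) (x : R) : R :=
  Rintegral lebesgue_measure `[0, +oo[
    (fun t => expR (- t) * (t * x) ^+ (n - k.+1) * f (t * x)).

Definition T_mx (n : nat) (f : R -> R) (d : 'I_n -> R) (k : 'I_n) : 'M[R]_n :=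
  \matrix_(j < n, i < n)
    if j == k then ((n - k.+1)`!%:R)^-1 * fk n f k (d i)
    else d i ^+ (n - j.+1).

End Defs.

Arguments gauss_mx_integral {R} n G.

(* Main.v *)
Require Import Defs.
From HB Require Import structures.
From mathcomp Require Import all_boot all_order all_algebra.
From mathcomp Require Import fingroup perm sesquilinear spectral.
From mathcomp Require Import all_classical all_reals all_analysis.
From mathcomp Require Import finmap measurable_realfun.
From mathcomp.real_closed Require Import complex.
From mathcomp Require Import ring lra zify.

Set Implicit Arguments.
Unset Strict Implicit.
Unset Printing Implicit Defensive.

Import Order.TTheory GRing.Theory Num.Theory.
Import numFieldNormedType.Exports.
Local Open Scope classical_set_scope.
Local Open Scope ring_scope.

(** For a nonnegative [f] both sides are limits along the cutoffs of [f], and on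
bounded continuous [f] both are bounded linear functionals; by the Weierstrass
theorem in the variable u = 1/(1+x) it suffices to compare them on the powers of
u, and hence on f(x) = 1/(1+yx).  With W = H^*AH and an auxiliary Gaussian
vector v, Tr (1+yW)^-1 = det(1+yW) E_v[|v|^2 exp(-y v^*Wv)].  Integrating over H
first, unitary invariance replaces A by D and v by |v|e_0, and
det(1+yH^*DH) = det D det(D^-1 + yHH^* ) is averaged column by column: adding
y h h^* to M turns the polynomial chi(X) = det(X+M) into chi + y chi'.  There
remains an integral over r = |v|^2, which integration by parts against e^-r
turns into a sum of integrals that Lagrange interpolation, i.e. Cramer's rule
for the Vandermonde matrix, identifies with the right-hand side. *)

(** * Iterated integrals over coordinates *)

(** The determinant is what makes the resolvent trace tractable. Since E_v exp(-y v^*Wv) = 1/det(1 +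
    yW), the extra factor |v|^2 under this expectation produces Tr (1 + yW)^-1 divided by that
    determinant, and the determinant put in front cancels it. What remains to be averaged over H is
    a polynomial times a Gaussian exponential, so neither the eigenvalue density of W nor an
    integral over the unitary group is needed. Once v is rotated, the exponential involves a single
    column of H; the other n - 1 columns meet only the determinant.

    The integral of the statement is a nested real integral, in a fixed order of coordinates, of a
    function of arbitrary sign. Computations are therefore made with nested integrals of nonnegative
    extended-valued functions, where Tonelli allows any order and any grouping of the coordinates. A
    probability measure is built from them, and integrability against it gives the way back to the
    nested real integral. *)

Section Coordinates.
Variable R : realType.

(* [iter_Rint] integrates functions of all the coordinates of a point of
   [nat -> R], so this whole space is made measurable. *)
Definition cylinders : set (set (nat -> R)) :=
  [set S | exists k, exists2 B, measurable B & S = (fun x => x k) @^-1` B].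

Definition points := g_sigma_algebraType cylinders.

HB.instance Definition _ := Measurable.on points.

Local Notation mu := (@lebesgue_measure R).
Local Notation flat := (@cst R R 1%R).

Lemma measurable_coord k : measurable_fun [set: points] (fun x => x k : R).
Proof.
move=> _ B mB; rewrite setTI; apply: sub_sigma_algebra.
by exists k; exists B.
Qed.

Lemma measurable_points d (T : measurableType d) (f : T -> points) :
  (forall k, measurable_fun setT (fun t => f t k : R)) -> measurable_fun setT f.
Proof.
move=> mf; apply: (@measurability _ _ T points setT f cylinders) => //.
move=> _ [_ [k [B mB ->]] <-].
by rewrite setTI -comp_preimage -[X in measurable X]setTI; exact: mf.
Qed.

Definition upd (x : nat -> R) (k : nat) (t : R) : nat -> R :=
  fun l => if l == k then t else x l.

Lemma upd_same x k t : upd x k t k = t.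
Proof. by rewrite /upd eqxx. Qed.

Lemma upd_other x k l t : l != k -> upd x k t l = x l.
Proof. by rewrite /upd => /negbTE ->. Qed.

Lemma updC x k l s t : k != l -> upd (upd x k s) l t = upd (upd x l t) k s.
Proof.
move=> kl; apply/funext => m; rewrite /upd.
by case: eqVneq => // ->; case: eqVneq kl => // ->; rewrite eqxx.
Qed.

Lemma measurable_upd k :
  measurable_fun setT (fun p : R * points => upd p.2 k p.1 : points).
Proof.
apply: measurable_points => l; rewrite /upd.
case: eqP => _; first exact: measurable_fst.
exact: (measurableT_comp (measurable_coord l) measurable_snd).
Qed.

(** Functions to which Tonelli and monotone convergence apply without any integrability
    condition. *)
Definition posm (F : points -> \bar R) :=
  measurable_fun setT F /\ forall x, (0 <= F x)%E.

Definition weight (w : R -> R) := measurable_fun setT w /\ forall x, 0 <= w x.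

Definition int_coord (w : R -> R) (k : nat) (F : points -> \bar R) : points -> \bar R :=
  fun x => (\int[mu]_t ((w t)%:E * F (upd x k t)))%E.

Lemma measurable_sect F k x : posm F ->
  measurable_fun setT (fun t : R => F (upd x k t)).
Proof.
case=> mF _; apply: (measurableT_comp mF).
apply: measurable_points => l; rewrite /upd.
by case: eqP => _; [exact: measurable_id | exact: measurable_cst].
Qed.

Lemma measurable_wsect w F k x : weight w -> posm F ->
  measurable_fun setT (fun t : R => ((w t)%:E * F (upd x k t))%E).
Proof.
move=> [mw _] pF; apply: emeasurable_funM; last exact: measurable_sect.
exact/measurable_EFinP.
Qed.

Lemma posm_int_coord w k F : weight w -> posm F -> posm (int_coord w k F).
Proof.
move=> [mw w0] [mF F0]; split; last first.
  by move=> x; apply: integral_ge0 => t _; rewrite mule_ge0// lee_fin.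
apply: (@measurable_fun_fubini_tonelli_G _ _ _ _ _ mu
  (fun p : R * points => ((w p.1)%:E * F (upd p.2 k p.1))%E)) => /=.
- apply: emeasurable_funM.
    by apply/measurable_EFinP; apply: measurableT_comp => //.
  by apply: (measurableT_comp mF); exact: measurable_upd.
- by move=> p; rewrite mule_ge0// lee_fin.
Qed.

Lemma int_coord_comm w k l F : weight w -> posm F -> int_coord w k (int_coord w l F) = int_coord w l (int_coord w k F).
Proof.
move=> ww pF; have [->//|kl] := eqVneq k l.
have [mw w0] := ww; have [mF F0] := pF.
apply/funext => x; rewrite /int_coord.
pose f (p : R * R) :=
  ((w p.1)%:E * ((w p.2)%:E * F (upd (upd x k p.1) l p.2)))%E.
have mf : measurable_fun setT f.
  apply: emeasurable_funM.
    by apply/measurable_EFinP; apply: measurableT_comp.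
  apply: emeasurable_funM.
    by apply/measurable_EFinP; apply: measurableT_comp.
  apply: (measurableT_comp mF); apply: measurable_points => m; rewrite /upd.
  case: (m == l); first exact: measurable_snd.
  by case: (m == k); [exact: measurable_fst|exact: measurable_cst].
have f0 p : (0 <= f p)%E by rewrite !mule_ge0// lee_fin.
transitivity (\int[mu]_s \int[mu]_t f (s, t))%E.
  apply: eq_integral => s _.
  rewrite -ge0_integralZl//; [exact: measurable_wsect| |by rewrite lee_fin].
  by move=> t _; rewrite mule_ge0// lee_fin.
rewrite fubini_tonelli//; apply: eq_integral => t _.
rewrite -ge0_integralZl//; [|exact: measurable_wsect| |by rewrite lee_fin].
  by apply: eq_integral => s _; rewrite /f/= muleCA updC.
by move=> s _; rewrite mule_ge0// lee_fin.
Qed.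

Definition int_coords (w : R -> R) (s : seq nat) (F : points -> \bar R) :=
  foldr (int_coord w) F s.

Definition indep (k : nat) (T : Type) (F : points -> T) :=
  forall x t, F (upd x k t) = F x.

Lemma posm_int_coords w s F : weight w -> posm F -> posm (int_coords w s F).
Proof. by move=> ww pF; elim: s => //= k s IH; exact: posm_int_coord. Qed.

Lemma int_coords_cat w s1 s2 F : int_coords w (s1 ++ s2) F = int_coords w s1 (int_coords w s2 F).
Proof. by rewrite /int_coords foldr_cat. Qed.

Lemma int_coords_perm w s1 s2 F : weight w -> posm F -> perm_eq s1 s2 ->
  int_coords w s1 F = int_coords w s2 F.
Proof.
move=> ww pF; move: s2; elim: s1 => [|k s1 IH] s2.
  by rewrite perm_sym => /perm_nilP ->.
move=> ps; have ks2 : k \in s2 by rewrite -(perm_mem ps) mem_head.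
case/splitPr: ks2 ps => s3 s4; rewrite perm_sym perm_catC /= perm_cons => ps.
rewrite int_coords_cat /= (IH (s3 ++ s4)).
  rewrite int_coords_cat; elim: s3 {ps} => //= l s3 <-.
  by apply: int_coord_comm => //; do 2 apply: posm_int_coords => //.
by rewrite perm_sym (perm_trans _ ps)// perm_catC.
Qed.

Lemma int_coord_le w k F G : weight w -> posm F -> posm G ->
  (forall x, (F x <= G x)%E) -> forall x, (int_coord w k F x <= int_coord w k G x)%E.
Proof.
move=> ww pF pG FG x; apply: ge0_le_integral => //.
- by move=> t _; rewrite mule_ge0 ?lee_fin//; [exact: ww.2|exact: pF.2].
- exact: measurable_wsect.
- exact: measurable_wsect.
- by move=> t _; rewrite lee_wpmul2l// lee_fin; exact: ww.2.
Qed.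

Lemma int_coords_le w s F G : weight w -> posm F -> posm G ->
  (forall x, (F x <= G x)%E) -> forall x, (int_coords w s F x <= int_coords w s G x)%E.
Proof.
by move=> ww pF pG FG; elim: s => //= k s IH; apply: int_coord_le => //; exact: posm_int_coords.
Qed.

Lemma int_coord_pull w k c F : weight w -> posm F -> indep k c ->
  (forall x, (0 <= c x)%E) ->
  int_coord w k (fun x => c x * F x)%E = (fun x => c x * int_coord w k F x)%E.
Proof.
move=> ww pF ic c0; apply/funext => x; rewrite /int_coord -ge0_integralZl//.
- by apply: eq_integral => t _; rewrite ic muleCA.
- exact: measurable_wsect.
- by move=> t _; rewrite mule_ge0 ?lee_fin//; [exact: ww.2|exact: pF.2].
Qed.

Lemma int_coords_pull w s c F : weight w -> posm F -> (forall k, k \in s -> indep k c) ->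
  (forall x, (0 <= c x)%E) ->
  int_coords w s (fun x => c x * F x)%E = (fun x => c x * int_coords w s F x)%E.
Proof.
move=> ww pF + c0; elim: s => //= k s IH ic.
rewrite IH; first by rewrite int_coord_pull//; [exact: posm_int_coords|apply: ic; rewrite mem_head].
by move=> l ls; apply: ic; rewrite inE ls orbT.
Qed.

Lemma posmM F G : posm F -> posm G -> posm (fun x => F x * G x)%E.
Proof.
move=> [mF F0] [mG G0]; split; first exact: emeasurable_funM.
by move=> x; exact: mule_ge0.
Qed.

Lemma posmD F G : posm F -> posm G -> posm (fun x => F x + G x)%E.
Proof.
move=> [mF F0] [mG G0]; split; first exact: emeasurable_funD.
by move=> x; exact: adde_ge0.
Qed.

Lemma posm_cst c : (0 <= c)%E -> posm (cst c).
Proof. by move=> c0; split => //; exact: measurable_cst. Qed.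

Lemma posm_sum (I : Type) (r : seq I) (P : pred I) (F : I -> points -> \bar R) :
  (forall i, posm (F i)) -> posm (fun x => \sum_(i <- r | P i) F i x)%E.
Proof.
move=> pF; elim: r => [|i r IH].
  by under eq_fun do rewrite big_nil; exact: posm_cst.
under eq_fun do rewrite big_cons; case: (P i) => //; exact: posmD.
Qed.

Lemma int_coordD w k F G : weight w -> posm F -> posm G ->
  int_coord w k (fun x => F x + G x)%E = (fun x => int_coord w k F x + int_coord w k G x)%E.
Proof.
move=> ww pF pG; apply/funext => x; rewrite /int_coord -ge0_integralD//.
- by apply: eq_integral => t _; rewrite ge0_muleDr//; [exact: pF.2|exact: pG.2].
- by move=> t _; rewrite mule_ge0 ?lee_fin//; [exact: ww.2|exact: pF.2].
- exact: measurable_wsect.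
- by move=> t _; rewrite mule_ge0 ?lee_fin//; [exact: ww.2|exact: pG.2].
- exact: measurable_wsect.
Qed.

Lemma int_coordsD w s F G : weight w -> posm F -> posm G ->
  int_coords w s (fun x => F x + G x)%E = (fun x => int_coords w s F x + int_coords w s G x)%E.
Proof.
by move=> ww pF pG; elim: s => //= k s ->; rewrite int_coordD//; exact: posm_int_coords.
Qed.

Lemma int_coord0 w k : int_coord w k (cst 0%E) = cst 0%E.
Proof.
by apply/funext => x; rewrite /int_coord/=; under eq_integral do rewrite mule0; rewrite integral0.
Qed.

Lemma int_coords0 w s : int_coords w s (cst 0%E) = cst 0%E.
Proof. by elim: s => //= k s ->; rewrite int_coord0. Qed.

Lemma int_coords_sum w s (I : Type) (r : seq I) (F : I -> points -> \bar R) :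
  weight w -> (forall i, posm (F i)) ->
  int_coords w s (fun x => \sum_(i <- r) F i x)%E = (fun x => \sum_(i <- r) int_coords w s (F i) x)%E.
Proof.
move=> ww pF; elim: r => [|i r IH].
  under eq_fun do rewrite big_nil; rewrite int_coords0.
  by apply/funext => x; rewrite big_nil.
under eq_fun do rewrite big_cons; rewrite int_coordsD//; last exact: posm_sum.
by rewrite IH; apply/funext => x; rewrite big_cons.
Qed.

Lemma int_coords_monotone w s (F : nat -> points -> \bar R) G : weight w ->
  (forall n, posm (F n)) -> (forall x, nondecreasing_seq (F^~ x)) ->
  (forall x, F^~ x @ \oo --> G x) ->
  forall x, (fun n => int_coords w s (F n) x) @ \oo --> int_coords w s G x.
Proof.
move=> ww pF ndF cF; elim: s => //= k s IH x; rewrite /int_coord.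
set g := fun n t => ((w t)%:E * int_coords w s (F n) (upd x k t))%E.
have -> : (\int[mu]_t ((w t)%:E * int_coords w s G (upd x k t)) =
    \int[mu]_t limn (g^~ t))%E.
  by apply: eq_integral => t _; apply/esym/cvg_lim => //; apply: cvgeZl.
apply: cvg_monotone_convergence => //.
- by move=> n; apply: measurable_wsect => //; exact: posm_int_coords.
- move=> n t _; rewrite mule_ge0 ?lee_fin//; first exact: ww.2.
  exact: (posm_int_coords s ww (pF n)).2.
- move=> t _ n m nm; rewrite lee_wpmul2l ?lee_fin//; first exact: ww.2.
  by apply: int_coords_le => // y; exact: ndF.
Qed.

Definition indeps (s : seq nat) (T : Type) (F : points -> T) :=
  forall k, k \in s -> indep k F.

(** The list [s] is finite, so its coordinates can be changed one after another from their value in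
    [x] to their value in [y]. This is how the base point of a nested integral gets replaced. *)
Lemma indeps_eq s (T : Type) (F : points -> T) x y : indeps s F ->
  (forall l, l \notin s -> x l = y l) -> F x = F y.
Proof.
elim: s x => [|k s IH] x iF xy; first by congr F; apply/funext => l; exact: xy.
rewrite -(iF k (mem_head _ _) x (y k)); apply: IH => [l ls|l ls].
  by apply: iF; rewrite inE ls orbT.
rewrite /upd; case: eqVneq => [->//|lk]; apply: xy.
by rewrite inE negb_or lk.
Qed.

Lemma indep_int_coord w k F : indep k (int_coord w k F).
Proof.
move=> x t; rewrite /int_coord; apply: eq_integral => u _; congr (_ * F _)%E.
by apply/funext => l; rewrite /upd; case: (l == k).
Qed.

Lemma indep_int_coord_other w k l F : indep k F -> indep k (int_coord w l F).
Proof.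
move=> iF x t; have [<-|kl] := eqVneq k l; first exact: indep_int_coord.
by rewrite /int_coord; apply: eq_integral => u _; rewrite updC// iF.
Qed.

Lemma indeps_int_coords w s F : indeps s (int_coords w s F).
Proof.
elim: s => //= l s IH k; rewrite inE => /predU1P[->|ks]; first exact: indep_int_coord.
by apply: indep_int_coord_other; exact: IH.
Qed.

Definition wprod (w : R -> R) (s : seq nat) (x : points) : R :=
  \prod_(k <- s) w (x k).

Lemma weight1 : weight flat.
Proof. by split => // x; rewrite ler01. Qed.

Lemma wprod_ge0 w s x : weight w -> 0 <= wprod w s x.
Proof. by move=> ww; apply: prodr_ge0 => k _; exact: ww.2. Qed.

Lemma posm_EFin (f : points -> R) : measurable_fun setT f ->
  (forall x, 0 <= f x) -> posm (EFin \o f).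
Proof. by move=> mf f0; split; [exact/measurable_EFinP|move=> x; rewrite lee_fin]. Qed.

Lemma posm_wprod w s : weight w -> posm (EFin \o wprod w s).
Proof.
move=> ww; apply: posm_EFin => [|x]; last exact: wprod_ge0.
elim: s => [|k s IH].
  rewrite (_ : wprod w [::] = cst 1); first exact: measurable_cst.
  by apply/funext => x; rewrite /wprod big_nil.
rewrite (_ : wprod w (k :: s) = fun x => w (x k) * wprod w s x); last first.
  by apply/funext => x; rewrite /wprod big_cons.
by apply: measurable_funM => //; apply: measurableT_comp ww.1 _; exact: measurable_coord.
Qed.

Lemma int_coords_wprod w s F : uniq s -> weight w -> posm F ->
  int_coords w s F = int_coords flat s (fun x => (wprod w s x)%:E * F x)%E.
Proof.
move=> us ww pF; elim: s us => /= [_|k s IH /andP[ks us]].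
  by apply/funext => x; rewrite /wprod big_nil mul1e.
have pwF : posm (fun x => (wprod w s x)%:E * F x)%E.
  by apply: posmM => //; exact: posm_wprod.
have pwk : posm (fun x => (w (x k))%:E).
  apply: (@posm_EFin (fun x => w (x k))) => [|x]; last exact: ww.2.
  by apply: measurableT_comp ww.1 _; exact: measurable_coord.
rewrite (IH us); apply/funext => x.
transitivity (int_coord flat k (fun y => (w (y k))%:E *
    int_coords flat s (fun x => (wprod w s x)%:E * F x) y)%E x).
  by apply: eq_integral => t _; rewrite upd_same mul1e.
congr (int_coord _ _ _ x); rewrite -int_coords_pull//.
- congr int_coords; apply/funext => y; rewrite muleA; congr (_ * _)%E.
  by rewrite /wprod big_cons EFinM.
- move=> l ls y t; rewrite upd_other//.
  by apply: contraNneq ks => ->.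
- exact: pwk.2.
Qed.

(** * Affine and linear changes of variables *)

Lemma preimage_affine_gt0 (a b x y : R) : 0 < a ->
  (fun t => a * t + b) @^-1` `]x, y] = `](x - b) / a, (y - b) / a]%classic.
Proof.
move=> a0; apply/seteqP; split => t /=; rewrite !in_itv/=;
  by rewrite ltr_pdivrMr// ler_pdivlMr// ltrBlDr lerBrDr mulrC.
Qed.

Lemma preimage_affine_lt0 (a b x y : R) : a < 0 ->
  (fun t => a * t + b) @^-1` `]x, y] = `[(y - b) / a, (x - b) / a[%classic.
Proof.
move=> a0; apply/seteqP; split => t /=; rewrite !in_itv/=;
  by rewrite ltr_ndivlMr// ler_ndivrMr// ltrBlDr lerBrDr andbC mulrC.
Qed.

Lemma measurable_affine (a b : R) : measurable_fun setT (fun t : R => a * t + b).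
Proof. by apply: measurable_funD => //; apply: measurable_funM. Qed.

(** The pushforward of Lebesgue measure under the affine map, scaled by |a|, gives every half-open
    interval its length, hence is Lebesgue measure. For a < 0 the preimage is closed on the other
    side, which leaves its length unchanged. *)
Lemma lebesgue_affine (a b : R) (A : set R) : a != 0 -> measurable A ->
  mu ((fun t => a * t + b) @^-1` A) = (`|a|^-1%:E * mu A)%E.
Proof.
move=> a0 mA.
have na0 : 0 <= `|a| by [].
have ma : measurable_fun setT (fun t => a * t + b : measurableTypeR R).
  exact: measurable_affine.
pose p : {measure set (measurableTypeR R) -> \bar R} :=
  pushforward mu (fun t => a * t + b : measurableTypeR R).
pose m : {measure set (measurableTypeR R) -> \bar R} := mscale (NngNum na0) (p ma).
have mE X : m X = (`|a|%:E * mu ((fun t => a * t + b)%R @^-1` X))%E by [].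
have E : mu A = m A.
  apply: (@lebesgue_measure_unique R m) => // X [[x y] _ <-].
  rewrite mE.
  have [xy|yx] := ltP x y; last first.
    by rewrite set_itv_ge ?preimage_set0 ?measure0 ?mule0// bnd_simp -leNgt.
  rewrite [in mu `]_, _]]/=.
  have [a_lt0|a_gt0|aE] := ltrgtP a 0; last by rewrite aE eqxx in a0.
    rewrite preimage_affine_lt0// !lebesgue_measure_itv/= !lte_fin xy.
    rewrite ltr_nM2r ?invr_lt0// ltrD2r xy -EFinB -EFinM; congr (_%:E).
    by rewrite ltr0_norm//; field.
  rewrite preimage_affine_gt0// !lebesgue_measure_itv/= !lte_fin xy.
  rewrite ltr_pM2r ?invr_gt0// ltrD2r xy -EFinB -EFinM; congr (_%:E).
  by rewrite gtr0_norm//; field.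
by rewrite E mE muleA -EFinM mulVf ?mul1e// normr_eq0.
Qed.

Lemma integral_affine (a b : R) (F : R -> \bar R) : a != 0 ->
  measurable_fun setT F -> (forall t, 0 <= F t)%E ->
  (\int[mu]_t F (a * t + b)%R = `|a|^-1%:E * \int[mu]_t F t)%E.
Proof.
move=> a0 mF F0.
have na0 : 0 <= `|a|^-1 by rewrite invr_ge0.
have ma : measurable_fun setT (fun t => a * t + b : measurableTypeR R).
  exact: measurable_affine.
have := @ge0_integral_pushforward _ _ (measurableTypeR R) (measurableTypeR R) R _ ma mu setT F measurableT mF.
rewrite preimage_setT => <-; last by move=> x _; exact: F0.
transitivity (\int[mscale (NngNum na0) mu]_t F t)%E.
  by apply: eq_measure_integral => A mA _; exact: lebesgue_affine.
by rewrite ge0_integral_mscale.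
Qed.

Lemma posm_comp (T : points -> points) F : posm F ->
  measurable_fun setT T -> posm (F \o T).
Proof. by move=> [mF F0] mT; split; [exact: measurableT_comp|move=> x; exact: F0]. Qed.

(* One coordinate of a triangular change of variables: all the coordinates that
   [T] lets depend on [k], other than [k] itself, are already integrated in [F]. *)
Lemma int_coord_affine (T : points -> points) k (s : seq nat) (a : R) F : a != 0 ->
  posm F -> indeps s F ->
  (forall x t, T (upd x k t) k = a * (t - x k) + T x k) ->
  (forall x t l, l != k -> l \notin s -> T (upd x k t) l = T x l) ->
  int_coord flat k (F \o T) = (fun x => `|a|^-1%:E * int_coord flat k F (T x))%E.
Proof.
move=> a0 pF iF Tk Tl; apply/funext => x; rewrite /int_coord.
pose b := T x k - a * x k.
rewrite -(integral_affine b a0); last 2 first.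
- exact: (measurable_wsect _ _ weight1).
- by move=> t; rewrite mule_ge0 ?lee_fin ?ler01//; exact: pF.2.
apply: eq_integral => t _; congr (_ * _)%E.
apply: (indeps_eq iF) => l ls; rewrite /upd; case: eqVneq => [->|lk].
  by rewrite -/(upd _ _ _) Tk /b; ring.
exact: Tl.
Qed.

(** [foldr] integrates the tail of [s] first: when the turn of [k] comes, every coordinate listed
    after [k] is already integrated out. [T] may let those depend on [x k] in any way, and only its
    slope [a k] in the coordinate [k] itself is felt. *)
Lemma int_coords_triangular (T : points -> points) (s : seq nat) (a : nat -> R) F :
  uniq s -> (forall k, k \in s -> a k != 0) -> measurable_fun setT T -> posm F ->
  (forall x t k, k \in s -> T (upd x k t) k = a k * (t - x k) + T x k) ->
  (forall x t k l, k \in s -> l != k ->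
     l \notin drop (index k s) s -> T (upd x k t) l = T x l) ->
  (forall x l, l \notin s -> T x l = x l) ->
  int_coords flat s (F \o T) = (fun x => (\prod_(k <- s) `|a k|^-1)%:E * int_coords flat s F x)%E.
Proof.
move=> us a0 mT pF Tk Tl Tout.
(* Induction over the suffixes of [s]. The point stays under [T] on the right until the end, when
   all the coordinates that [T] moves have been integrated out. *)
have H s1 s2 : s = s1 ++ s2 -> int_coords flat s2 (F \o T) =
    (fun x => (\prod_(k <- s2) `|a k|^-1)%:E * int_coords flat s2 F (T x))%E.
  elim: s2 s1 => [|k s2 IH] s1 sE.
    by apply/funext => x; rewrite big_nil mul1e.
  have ks : k \in s by rewrite sE mem_cat mem_head orbT.
  have pJ : posm (int_coords flat s2 F) by apply: posm_int_coords => //; exact: weight1.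
  rewrite /= (IH (rcons s1 k)) ?cat_rcons// int_coord_pull//; last 2 first.
  - exact: (posm_comp pJ mT).
  - by move=> x; rewrite lee_fin; apply: prodr_ge0 => l _; rewrite invr_ge0.
  have -> : int_coord flat k (fun x => int_coords flat s2 F (T x)) =
      (fun x => `|a k|^-1%:E * int_coord flat k (int_coords flat s2 F) (T x))%E.
    apply: (@int_coord_affine T k s2 (a k) (int_coords flat s2 F)) => //.
    - exact: a0.
    - exact: indeps_int_coords.
    - by move=> x t; exact: Tk.
    - move=> x t l lk ls; apply: Tl => //.
      have ks1 : k \notin s1.
        by move: us; rewrite sE cat_uniq => /and3P[_ /hasPn/(_ k)]; rewrite mem_head => /(_ isT).
      rewrite sE index_cat (negbTE ks1) /= eqxx addn0 drop_size_cat//.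
      by rewrite inE negb_or lk.
  by apply/funext => x; rewrite big_cons EFinM muleA [(_ * `|a k|^-1%:E)%E]muleC.
rewrite (H [::] s erefl); apply/funext => x; congr (_ * _)%E.
by apply: (indeps_eq (@indeps_int_coords _ _ _)) => l ls; exact: Tout.
Qed.

Definition relabel (g : nat -> nat) (x : points) : points := x \o g.

Lemma int_coord_relabel w (g h : nat -> nat) k F : (forall l, (g l == k) = (l == h k)) ->
  int_coord w k (F \o relabel g) = int_coord w (h k) F \o relabel g.
Proof.
move=> gh; apply/funext => x; rewrite /int_coord/=; apply: eq_integral => t _.
congr (_ * F _)%E; apply/funext => l; rewrite /relabel/= /upd gh.
by case: (l == h k).
Qed.

Lemma int_coords_relabel w (g h : nat -> nat) s F : (forall k l, (g l == k) = (l == h k)) ->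
  int_coords w s (F \o relabel g) = int_coords w (map h s) F \o relabel g.
Proof.
by move=> gh; elim: s => //= k s ->; apply: int_coord_relabel.
Qed.

Section Linear.
Variables (N : nat) (f : 'I_N -> nat).
Hypothesis f_inj : injective f.

Let s := [seq f i | i <- enum 'I_N].

Let us : uniq s.
Proof. by rewrite map_inj_uniq ?enum_uniq. Qed.

Definition tmx (M : 'M[R]_N) (x : points) : points := fun l =>
  if [pick i | f i == l] is Some i then \sum_j M i j * x (f j) else x l.

Lemma tmx_in M x i : tmx M x (f i) = \sum_j M i j * x (f j).
Proof.
rewrite /tmx; case: pickP => [j /eqP/f_inj ->//|/(_ i)].
by rewrite eqxx.
Qed.

Lemma tmx_out M x l : l \notin s -> tmx M x l = x l.
Proof.
rewrite /tmx; case: pickP => [j /eqP <-|//].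
by rewrite map_f// mem_enum.
Qed.

Lemma tmx_eq (M : 'M[R]_N) (x T : points) : (forall i, T (f i) = \sum_j M i j * x (f j)) ->
  (forall l, l \notin s -> T l = x l) -> T = tmx M x.
Proof.
move=> Ti To; apply/funext => l; have [ls|ls] := boolP (l \in s).
  by case/mapP: ls => i _ ->; rewrite tmx_in Ti.
by rewrite tmx_out// To.
Qed.

Lemma tmxM M M' x : tmx (M *m M') x = tmx M (tmx M' x).
Proof.
apply/esym/tmx_eq => [i|l ls]; last by rewrite !tmx_out.
rewrite tmx_in; under eq_bigr do rewrite tmx_in mulr_sumr.
rewrite exchange_big/=; apply: eq_bigr => j _.
by rewrite mxE mulr_suml; apply: eq_bigr => k _; rewrite mulrA.
Qed.

Lemma measurable_tmx M : measurable_fun setT (tmx M).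
Proof.
apply: measurable_points => l; rewrite /tmx.
case: [pick i | f i == l] => [i|]; last exact: measurable_coord.
apply: measurable_sum => j; apply: measurable_funM => //.
exact: measurable_coord.
Qed.

Lemma tmx_upd M x t i j :
  tmx M (upd x (f i) t) (f j) = M j i * (t - x (f i)) + tmx M x (f j).
Proof.
rewrite !tmx_in (bigD1 i)//= [in RHS](bigD1 i)//= upd_same addrA -mulrDr subrK.
congr (_ + _); apply: eq_bigr => k ki; rewrite upd_other//.
by apply: contraNneq ki => /f_inj ->.
Qed.

Lemma index_in i : index (f i) s = i.
Proof. by rewrite index_map// index_enum_ord. Qed.

(** For an invertible matrix the factor is |det M|^-1, but only its existence is used: for an
    isometry the Gaussian normalisation forces the value 1. *)
Definition changes_by (M : 'M[R]_N) (c : R) := forall F, posm F ->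
  int_coords flat s (F \o tmx M) = (fun x => c%:E * int_coords flat s F x)%E.

Lemma changes_byM M M' c c' : changes_by M c -> changes_by M' c' ->
  changes_by (M *m M') (c' * c).
Proof.
move=> H H' F pF; rewrite (_ : F \o tmx (M *m M') = (F \o tmx M) \o tmx M').
  rewrite H'; last by apply: posm_comp => //; exact: measurable_tmx.
  by rewrite H//; apply/funext => x; rewrite EFinM muleA.
by apply/funext => x; rewrite /= tmxM.
Qed.

(** The coordinates are integrated from the last index to the first, so a lower triangular matrix is
    triangular in the sense of [int_coords_triangular]. *)
Lemma changes_by_lower (M : 'M[R]_N) : (forall i j : 'I_N, (i < j)%N -> M i j = 0) ->
  (forall i, M i i != 0) -> exists c, changes_by M c.
Proof.
move=> Ml Md; pose a l := if [pick i | f i == l] is Some i then M i i else 1.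
have aE i : a (f i) = M i i.
  rewrite /a; case: pickP => [j /eqP/f_inj ->//|/(_ i)]; by rewrite eqxx.
exists (\prod_(k <- s) `|a k|^-1) => F pF.
apply: int_coords_triangular => //.
- by move=> k /mapP[i _ ->]; rewrite aE.
- exact: measurable_tmx.
- by move=> x t k /mapP[i _ ->]; rewrite tmx_upd aE.
- move=> x t k l /mapP[i _ ->] lk; have [/mapP[j _ lE]|ls] := boolP (l \in s).
    rewrite lE tmx_upd index_in => jd; rewrite Ml ?mul0r ?add0r//.
    rewrite ltnNge; apply: contra jd => ij.
    apply/(nthP 0%N); exists (j - i)%N.
      by rewrite size_drop size_map size_enum_ord ltn_sub2r//.
    by rewrite nth_drop subnKC// (nth_map j) ?size_enum_ord// nth_ord_enum.
  by move=> _; rewrite !tmx_out// upd_other.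
- by move=> x l ls; rewrite tmx_out.
Qed.

Lemma changes_by_perm (p : 'S_N) : changes_by (perm_mx p) 1.
Proof.
move=> F pF; pose g (q : 'S_N) l := if [pick i | f i == l] is Some i then f (q i) else l.
have gE q i : g q (f i) = f (q i).
  rewrite /g; case: pickP => [j /eqP/f_inj ->//|/(_ i)]; by rewrite eqxx.
have gout q l : l \notin s -> g q l = l.
  by rewrite /g; case: pickP => // i /eqP <-; rewrite map_f ?mem_enum.
have gK q : cancel (g q) (g (q^-1)%g).
  move=> l; have [/mapP[i _ ->]|ls] := boolP (l \in s); first by rewrite !gE permK.
  by rewrite !gout.
have gh k l : (g p l == k) = (l == g (p^-1)%g k).
  by apply/eqP/eqP => [<-|->]; rewrite ?gK// -{1}(invgK p) gK.
have -> : tmx (perm_mx p) = relabel (g p).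
  apply/funext => x; apply/esym/tmx_eq => [i|l ls]; last by rewrite /relabel/= gout.
  rewrite /relabel/= gE (bigD1 (p i))//= big1 ?addr0.
    by rewrite /perm_mx !mxE eqxx mul1r.
  by move=> j ji; rewrite /perm_mx !mxE eq_sym (negbTE ji) mul0r.
rewrite (int_coords_relabel _ _ _ gh); apply/funext => x; rewrite mul1e /=.
have -> : int_coords flat (map (g (p^-1)%g) s) F = int_coords flat s F.
  apply: int_coords_perm => //.
  apply: uniq_perm => //.
    by rewrite map_inj_uniq//; exact: (can_inj (gK _)).
  move=> l; apply/mapP/idP => [[k /mapP[i _ ->] ->]|/mapP[i _ ->]].
    by rewrite gE map_f ?mem_enum.
  by exists (f (p i)); rewrite ?map_f ?mem_enum// gE permK.
apply: (indeps_eq (@indeps_int_coords _ _ _)) => l ls.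
by rewrite /relabel/= gout.
Qed.

End Linear.

(** Listing the same coordinates in reverse order makes the matrix lower triangular, and Tonelli
    makes the order irrelevant. *)
Lemma changes_by_upper N (f : 'I_N -> nat) (M : 'M[R]_N) : injective f ->
  (forall i j : 'I_N, (j < i)%N -> M i j = 0) ->
  (forall i, M i i != 0) -> exists c, changes_by f M c.
Proof.
move=> f_inj Mu Md.
pose f' i := f (rev_ord i).
have f'_inj : injective f' by move=> i j /f_inj/rev_ord_inj.
pose M' : 'M[R]_N := \matrix_(i, j) M (rev_ord i) (rev_ord j).
have ff' : perm_eq [seq f i | i <- enum 'I_N] [seq f' i | i <- enum 'I_N].
  apply: uniq_perm; rewrite ?(map_inj_uniq f_inj) ?(map_inj_uniq f'_inj) ?enum_uniq// => l.
  apply/mapP/mapP => [[i _ ->]|[i _ ->]].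
    by exists (rev_ord i); rewrite ?mem_enum// /f' rev_ordK.
  by exists (rev_ord i); rewrite ?mem_enum.
have [c Hc] : exists c, changes_by f' M' c.
  apply: changes_by_lower => // [i j ij|i]; rewrite mxE; last exact: Md.
  by apply: Mu => /=; have := ltn_ord j; lia.
exists c => F pF.
rewrite !(int_coords_perm weight1 _ ff')//; last first.
  by apply: posm_comp => //; exact: measurable_tmx.
rewrite -Hc//; congr int_coords; apply/funext => x /=; congr F.
apply: tmx_eq => // [i|l ls]; last by rewrite tmx_out// (perm_mem ff').
rewrite /f' tmx_in// (reindex_inj rev_ord_inj)/=.
by apply: eq_bigr => j _; rewrite mxE.
Qed.

(** By the LUP decomposition: a permutation, a unit lower triangular and an upper triangular matrix
    each change variables by a factor. Invertibility keeps zeros off the diagonal of the last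
    one. *)
Lemma changes_by_unit N (f : 'I_N -> nat) (M : 'M[R]_N) : injective f ->
  M \in unitmx -> exists c, changes_by f M c.
Proof.
case: N f M => [|N] f M f_inj uM.
  exists 1 => F pF; rewrite (_ : enum 'I_0 = [::])/=; last first.
    by apply/size0nil; rewrite size_enum_ord.
  apply/funext => x /=; rewrite mul1e; congr F.
  by apply/esym/tmx_eq => // -[].
have /is_perm_mxP[p pE] := cormen_lup_perm M.
have := cormen_lup_correct M; have := @cormen_lup_lower _ _ M.
have := @cormen_lup_upper _ _ M; have := cormen_lup_detL M.
case: (cormen_lup M) pE => [[P L] U] /= pE detL Uu Ll PM.
have ME : M = perm_mx (p^-1)%g *m (L *m U).
  have -> : L *m U = perm_mx p *m M by rewrite -pE.
  by rewrite mulmxA -perm_mxM mulVg perm_mx1 mul1mx.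
have [cL HL] : exists c, changes_by f L c.
  apply: changes_by_lower => // [i j ij|i].
    by rewrite Ll ?(ltnW ij)// -val_eqE/= ltn_eqF.
  by rewrite Ll// eqxx oner_eq0.
have detU : \det U != 0.
  move: uM; rewrite ME unitmxE !det_mulmx detL mul1r unitfE mulf_eq0.
  by rewrite negb_or => /andP[].
have [cU HU] : exists c, changes_by f U c.
  apply: changes_by_upper => // i; apply: contra_neq detU => Ui.
  have /det_trig : is_trig_mx U^T.
    by apply/is_trig_mxP => k j kj; rewrite mxE Uu.
  by rewrite det_tr => ->; rewrite (bigD1 i)//= mxE Ui mul0r.
exists ((cU * cL) * 1); rewrite ME.
by apply: changes_byM => //; [exact: changes_by_perm|exact: changes_byM].
Qed.

(** Variance 1/2, so that two such real coordinates form a complex Gaussian of unit variance. *)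
Definition gauss (t : R) := (Num.sqrt pi)^-1 * expR (- t ^+ 2).

Lemma weight_gauss : weight gauss.
Proof.
split; last by move=> t; rewrite mulr_ge0 ?expR_ge0// invr_ge0 sqrtr_ge0.
by apply: measurable_funM => //; exact: measurable_gauss_fun.
Qed.

Lemma integral_gauss : (\int[mu]_t (gauss t)%:E = 1)%E.
Proof.
under eq_integral do rewrite EFinM.
rewrite ge0_integralZl//.
- by rewrite integralT_gauss -EFinM mulVf// gt_eqF// sqrtr_gt0 pi_gt0.
- by apply/measurable_EFinP; exact: measurable_gauss_fun.
Qed.

Lemma int_coords_gauss_cst s (c : \bar R) : (0 <= c)%E -> int_coords gauss s (cst c) = cst c.
Proof.
move=> c0; elim: s => //= k s ->; apply/funext => x; rewrite /int_coord/=.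
rewrite ge0_integralZr//; first by rewrite integral_gauss mul1e.
- by apply/measurable_EFinP; exact: weight_gauss.1.
- by move=> t _; rewrite lee_fin; exact: weight_gauss.2.
Qed.

Lemma wprod_gauss s (x : points) :
  wprod gauss s x = (Num.sqrt pi)^-1 ^+ size s * expR (- \sum_(k <- s) x k ^+ 2).
Proof.
rewrite /wprod; elim: s => [|k s IH]; first by rewrite !big_nil oppr0 expR0 mulr1.
by rewrite !big_cons IH /gauss opprD expRD/= mulrACA -exprS.
Qed.

(** Preserving the sum of squares forces a trivial kernel, so [T] is an invertible linear change of
    variables with some factor [c]. The Gaussian weight is fixed by [T] and has integral 1, whence
    [c] is 1. *)
Lemma int_coords_isometry (I : finType) (f : I -> nat) (T : points -> points) F :
  injective f -> posm F ->
  (exists M : I -> I -> R, forall x i, T x (f i) = \sum_j M i j * x (f j)) ->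
  (forall x l, l \notin [seq f i | i <- enum I] -> T x l = x l) ->
  (forall x, \sum_i T x (f i) ^+ 2 = \sum_i x (f i) ^+ 2) ->
  int_coords gauss [seq f i | i <- enum I] (F \o T) = int_coords gauss [seq f i | i <- enum I] F.
Proof.
move=> f_inj pF [M TM] To Tn.
pose g (a : 'I_#|I|) := f (enum_val a).
have g_inj : injective g by move=> a b /f_inj/enum_val_inj.
set s := [seq f i | i <- enum I].
have us : uniq s by rewrite map_inj_uniq ?enum_uniq.
have ps : perm_eq s [seq g a | a <- enum 'I_#|I|].
  apply: uniq_perm => //; first by rewrite map_inj_uniq ?enum_uniq.
  move=> l; apply/mapP/mapP => [[i _ ->]|[a _ ->]].
    by exists (enum_rank i); rewrite ?mem_enum// /g enum_rankK.
  by exists (enum_val a); rewrite ?mem_enum.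
pose N : 'M[R]_#|I| := \matrix_(a, b) M (enum_val a) (enum_val b).
have TN : T = tmx g N.
  apply/funext => x; apply: tmx_eq => // [a|l ls]; last first.
    by apply: To; rewrite -/s (perm_mem ps).
  rewrite /g TM (reindex _ (onW_bij _ (@enum_val_bij I)))/=.
  by apply: eq_bigr => b _; rewrite mxE.
(* The hypothesis speaks of points, so a column vector is extended by 0 to a point. *)
have normE (v : 'cV[R]_#|I|) : \sum_a (N *m v) a 0 ^+ 2 = \sum_a v a 0 ^+ 2.
  pose x : points := fun l => if [pick a | g a == l] is Some a then v a 0 else 0.
  have xE a : x (g a) = v a 0.
    by rewrite /x; case: pickP => [b /eqP/g_inj ->//|/(_ a)]; rewrite eqxx.
  have := Tn x; rewrite !(reindex _ (onW_bij _ (@enum_val_bij I)))/= => H.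
  transitivity (\sum_(j < #|I|) T x (g j) ^+ 2).
    apply: eq_bigr => a _; rewrite TN tmx_in// mxE.
    by under [in RHS]eq_bigr do rewrite xE.
  transitivity (\sum_(j < #|I|) x (g j) ^+ 2); first exact: H.
  by apply: eq_bigr => a _; rewrite xE.
have uN : N \in unitmx.
  rewrite -unitmx_tr -row_free_unit -kermx_eq0; apply/eqP/row_matrixP => a.
  set r := row a _; have : r *m N^T = 0.
    by apply/sub_kermxP; exact: row_sub.
  move/(congr1 trmx); rewrite trmx_mul trmxK trmx0 => Nr.
  have := normE r^T; rewrite Nr big1; last by move=> b _; rewrite mxE expr0n.
  move/esym/eqP; rewrite psumr_eq0; last by move=> b _; exact: sqr_ge0.
  move/allP => r0; rewrite row0; apply/rowP => b; rewrite [RHS]mxE.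
  by have := r0 b (mem_index_enum b); rewrite /= sqrf_eq0 mxE => /eqP.
have [c Hc] := changes_by_unit g_inj uN.
have wT x : wprod gauss s (T x) = wprod gauss s x.
  rewrite !wprod_gauss; congr (_ * expR (- _)).
  transitivity (\sum_i T x (f i) ^+ 2); first by rewrite /s big_map big_enum.
  by rewrite Tn /s big_map big_enum.
have pW : posm (EFin \o wprod gauss s) := posm_wprod s weight_gauss.
have mT : measurable_fun setT T by rewrite TN; exact: measurable_tmx.
have c1 : c = 1.
  have := Hc _ pW; rewrite -!(int_coords_perm weight1 _ ps) -?TN//; last exact: posm_comp.
  rewrite (_ : _ \o T = EFin \o wprod gauss s); last first.
    by apply/funext => x /=; rewrite wT.
  rewrite (_ : int_coords _ _ _ = cst 1%E); last first.
    rewrite -(int_coords_gauss_cst s lee01) (int_coords_wprod us weight_gauss)//.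
    by congr int_coords; apply/funext => x /=; rewrite mule1.
  by move/(congr1 (fun F => F (fun=> 0))) => /=; rewrite mule1 => -[].
rewrite !(int_coords_wprod us weight_gauss)//; last exact: posm_comp.
pose F' x := ((wprod gauss s x)%:E * F x)%E.
have pF' : posm F' by exact: posmM.
transitivity (int_coords flat s (F' \o T)).
  by congr int_coords; apply/funext => x; rewrite /F'/= wT.
rewrite !(int_coords_perm weight1 _ ps)//; last exact: posm_comp.
by rewrite TN Hc// c1; apply/funext => x; rewrite mul1e.
Qed.

End Coordinates.

(** * The Gaussian measure on the space of points *)

Section GaussianMeasure.
Variable R : realType.
Local Notation mu := (@lebesgue_measure R).
Local Notation flat := (@cst R R 1%R).
Local Notation points := (points R).
Implicit Types (F : points -> \bar R).

Lemma posm_indic (S : set points) : measurable S -> posm (fun x => (\1_S x : R)%:E).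
Proof.
move=> mS; apply: (posm_EFin (f := \1_S)); last by move=> x; rewrite indicE.
exact: measurable_indic.
Qed.

(** The law of a point whose coordinates in [s] are independent Gaussians and whose other
    coordinates are 0. It makes the theory of integrable functions available for nested
    integrals. *)
Definition gausspt (s : seq nat) (S : set points) : \bar R :=
  int_coords (@gauss R) s (fun x => (\1_S x : R)%:E) (fun=> 0).

Section Measure.
Variable s : seq nat.
Let wg := weight_gauss R.

Let gausspt0 : gausspt s set0 = 0%E.
Proof.
rewrite /gausspt (_ : (fun x => _) = cst 0%E) ?int_coords0//.
by apply/funext => x; rewrite indic0.
Qed.

(* [gausspt] must be nonnegative on every set, so non-measurable ones matter:
   on those the nested integral is still an integral of a nonnegative function. *)
Let gausspt_ge0 S : (0 <= gausspt s S)%E.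
Proof.
rewrite /gausspt; suff H x : (0 <= int_coords (@gauss R) s (fun x => (\1_S x : R)%:E) x)%E by exact: H.
case: s x => [x|k l x] /=; first by rewrite lee_fin indicE.
elim: l k x => [|l' l IH] k x; apply: integral_ge0 => t _; apply: mule_ge0 => //;
  rewrite ?lee_fin ?wg.2 ?indicE//.
exact: IH.
Qed.

Let gausspt_sigma_additive : semi_sigma_additive (gausspt s).
Proof.
move=> A mA tA mUA.
pose G n (x : points) := (\sum_(0 <= i < n) (\1_(A i) x : R)%:E)%E.
have pG n : posm (G n) by apply: posm_sum => i; exact: posm_indic.
have GE n : (\sum_(0 <= i < n) gausspt s (A i))%E = int_coords (@gauss R) s (G n) (fun=> 0).
  by rewrite /G int_coords_sum// => i; exact: posm_indic.
under eq_fun do rewrite GE.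
apply: (int_coords_monotone wg pG).
  move=> x; apply/nondecreasing_seqP => n; rewrite /G big_nat_recr//=.
  by rewrite leeDl// lee_fin indicE.
move=> x; have := @measure_semi_sigma_additive _ _ _ (@dirac _ points x R) A mA tA mUA.
exact.
Qed.

HB.instance Definition _ := isMeasure.Build _ _ _ (gausspt s)
  gausspt0 gausspt_ge0 gausspt_sigma_additive.

Let gausspt_setT : gausspt s setT = 1%E.
Proof.
rewrite /gausspt (_ : (fun x => _) = cst 1%E) ?int_coords_gauss_cst//.
by apply/funext => x; rewrite indicT.
Qed.

HB.instance Definition _ := @Measure_isProbability.Build _ _ R (gausspt s) gausspt_setT.

Import HBNNSimple.

Lemma integral_gausspt F : posm F -> (\int[gausspt s]_x F x)%E = int_coords (@gauss R) s F (fun=> 0).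
Proof.
move=> [mF F0].
pose g := nnsfun_approx measurableT mF.
have gF x : (EFin \o g^~ x) @ \oo --> F x by apply: cvg_nnsfun_approx.
have pg n : posm (EFin \o g n).
  by apply: posm_EFin => // x; exact: fun_ge0.
have ndg x : nondecreasing_seq (fun n => (g n x)%:E).
  by move=> n m nm; rewrite lee_fin; exact/lefP/nd_nnsfun_approx.
have H := @int_coords_monotone R (@gauss R) s (fun n => EFin \o g n) F wg pg ndg gF (fun=> 0).
rewrite -(cvg_lim _ H)//.
transitivity (\int[gausspt s]_x limn (fun n => (g n x)%:E))%E.
  by apply: eq_integral => x _; apply/esym/cvg_lim => //; exact: gF.
rewrite monotone_convergence; last first.
- by move=> x _; exact: ndg.
- by move=> n x _; exact: (pg n).2.
- by move=> n; exact: (pg n).1.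
- exact: measurableT.
congr (limn _); apply/funext => n.
under eq_integral do rewrite fimfunE// -fsumEFin//.
rewrite ge0_integral_fsum//; last 2 first.
- by move=> r; apply/measurable_EFinP; apply: measurable_funM.
- by move=> r x _; rewrite nnfun_muleindic_ge0.
pose h (r : R) (x : points) := (r * \1_(g n @^-1` [set r]) x)%:E.
have ph r : posm (h r).
  split=> [|x]; last exact: nnfun_muleindic_ge0.
  by apply/measurable_EFinP; apply: measurable_funM.
have -> : EFin \o g n = fun x => (\sum_(r <- fset_set (range (g n))) h r x)%E.
  by apply/funext => x; rewrite /= {1}fimfunE fsbig_finite//= sumEFin.
rewrite int_coords_sum// fsbig_finite//=; apply: eq_bigr => r _.
(* Only nonnegative constants are pulled out of a nested integral. A negative value is never taken
   by the simple function, and both sides vanish. *)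
have [r0|r0] := ltP r 0.
  have h0 : h r = cst 0%E.
    by apply/funext => x; rewrite /h preimage_nnfun0// indic0 mulr0.
  rewrite -/(h r) h0 int_coords0 /=.
  by transitivity (\int[gausspt s]_x (h r x))%E; rewrite ?h0 ?integral0.
rewrite integralZl_indic_nnsfun// integral_indic// setIT.
rewrite (_ : h r = fun x => (r%:E * (\1_(g n @^-1` [set r]) x)%:E)%E); last first.
  by apply/funext => x; rewrite /h EFinM.
by rewrite int_coords_pull//; exact: posm_indic.
Qed.

End Measure.

Lemma measurable_line k (x : points) :
  measurable_fun setT (fun t : R => upd x k t : points).
Proof.
apply: measurable_points => l; rewrite /upd.
by case: eqP => _; [exact: measurable_id | exact: measurable_cst].
Qed.

Lemma int_coord_flat m F x : int_coord flat m F x = (\int[mu]_t F (upd x m t))%E.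
Proof. by apply: eq_integral => t _; rewrite /= mul1e. Qed.

Lemma measurable_iter_Rint m (G : points -> R) : measurable_fun setT G ->
  measurable_fun setT (iter_Rint m G : points -> R).
Proof.
move=> mG; elim: m => //= m IH.
pose K := EFin \o (iter_Rint m G : points -> R).
have pK : posm K^\+%E.
  by split=> [|x]; [apply: measurable_funepos; exact/measurable_EFinP|exact: funepos_ge0].
have nK : posm K^\-%E.
  by split=> [|x]; [apply: measurable_funeneg; exact/measurable_EFinP|exact: funeneg_ge0].
rewrite (_ : (fun x => _) = fun x => fine (int_coord flat m K^\+%E x - int_coord flat m K^\-%E x)); last first.
  apply/funext => x; rewrite /Rintegral; congr fine; rewrite integralE.
  rewrite !int_coord_flat; congr (_ - _)%E; apply: eq_integral => t _; rewrite ?funeposE ?funenegE//.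
apply: (measurableT_comp (@fine_measurable R setT measurableT)).
by apply: emeasurable_funB; [exact: (posm_int_coord _ (weight1 R) pK).1|exact: (posm_int_coord _ (weight1 R) nK).1].
Qed.

(** At each stage [Rintegral] applies [fine], which sends an infinite integral to 0, so the nested
    real integral could drift away from the Lebesgue one. Finiteness of the two full integrals
    confines this to a null set of values at every stage. The reversed [iota] reproduces the order
    of [iter_Rint], whose outermost variable has the largest index. *)
Lemma iter_RintE m (G : points -> R) x : measurable_fun setT G ->
  (int_coords flat (rev (iota 0 m)) (EFin \o G)^\+%E x < +oo)%E ->
  (int_coords flat (rev (iota 0 m)) (EFin \o G)^\-%E x < +oo)%E ->
  ((iter_Rint m G x)%:E = int_coords flat (rev (iota 0 m)) (EFin \o G)^\+%E x -
    int_coords flat (rev (iota 0 m)) (EFin \o G)^\-%E x)%E.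
Proof.
move=> mG; have pG : posm (EFin \o G)^\+%E.
  by split=> [|y]; [apply: measurable_funepos; exact/measurable_EFinP|exact: funepos_ge0].
have nG : posm (EFin \o G)^\-%E.
  by split=> [|y]; [apply: measurable_funeneg; exact/measurable_EFinP|exact: funeneg_ge0].
elim: m x => [|m IH] x.
  by move=> _ _; have := congr1 (@^~ x) (funeposneg (EFin \o G)).
rewrite -(addn1 m) iotaD add0n rev_cat /= [(m + 1)%N]addn1 /=.
set s := rev _; pose a t := int_coords flat s (EFin \o G)^\+%E (upd x m t).
pose b t := int_coords flat s (EFin \o G)^\-%E (upd x m t).
rewrite !int_coord_flat -/a -/b => a_fin b_fin.
have pa : posm (int_coords flat s (EFin \o G)^\+%E) by exact: posm_int_coords.
have pb : posm (int_coords flat s (EFin \o G)^\-%E) by exact: posm_int_coords.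
have ma : measurable_fun setT a by exact: measurable_sect.
have mb : measurable_fun setT b by exact: measurable_sect.
have ia : mu.-integrable setT a.
  apply/integrableP; split => //.
  by under eq_integral do rewrite gee0_abs ?pa.2//.
have ib : mu.-integrable setT b.
  apply/integrableP; split => //.
  by under eq_integral do rewrite gee0_abs ?pb.2//.
rewrite -[X in (_ = X)%E](@integralB _ _ _ mu setT measurableT a b ia ib).
rewrite /Rintegral.
have E : (\int[mu]_t (iter_Rint m G (upd x m t))%:E = \int[mu]_t (a t - b t))%E.
  apply: ae_eq_integral => //.
  - apply/measurable_EFinP.
    exact: (measurableT_comp (measurable_iter_Rint m mG) (measurable_line m x)).
  - exact: emeasurable_funB.
  have := integrable_ae measurableT ia; have := integrable_ae measurableT ib.
  apply: filterS2 => t /(_ I) bt /(_ I) at_ _.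
  by rewrite /= IH// ltey_eq ?at_ ?bt.
rewrite E fineK//.
by apply: integrable_fin_num => //; exact: integrableB.
Qed.

Lemma iter_Rint_gauss m (G : points -> R) (s := rev (iota 0 m)) :
  measurable_fun setT G -> (gausspt s).-integrable setT (EFin \o G) ->
  iter_Rint m (fun x => wprod (@gauss R) s x * G x) (fun=> 0) =
  (\int[gausspt s]_x G x)%R.
Proof.
move=> mG iG; pose G' (x : points) := wprod (@gauss R) s x * G x.
have us : uniq s by rewrite rev_uniq iota_uniq.
have wg := weight_gauss R.
have w0 x := wprod_ge0 s x wg.
have mG' : measurable_fun setT G'.
  apply: measurable_funM => //.
  by have := (posm_wprod s wg).1 => /measurable_EFinP.
have pG : posm (EFin \o G)^\+%E.
  by split=> [|y]; [apply: measurable_funepos; exact/measurable_EFinP|exact: funepos_ge0].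
have nG : posm (EFin \o G)^\-%E.
  by split=> [|y]; [apply: measurable_funeneg; exact/measurable_EFinP|exact: funeneg_ge0].
have E1 : int_coords flat s (EFin \o G')^\+%E (fun=> 0) = (\int[gausspt s]_x (EFin \o G)^\+%E x)%E.
  rewrite (integral_gausspt s pG) (int_coords_wprod us wg pG); congr (int_coords _ _ _ _).
  apply/funext => x; rewrite !funeposE /= -!EFin_max -EFinM /G' maxr_pMr//.
  by rewrite mulr0.
have E2 : int_coords flat s (EFin \o G')^\-%E (fun=> 0) = (\int[gausspt s]_x (EFin \o G)^\-%E x)%E.
  rewrite (integral_gausspt s nG) (int_coords_wprod us wg nG); congr (int_coords _ _ _ _).
  apply/funext => x; rewrite !funenegE /= -!EFin_max -EFinM /G' maxr_pMr//.
  by rewrite mulr0 mulrN.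
have H := iter_RintE (m := m) (x := (fun=> 0)) mG'.
rewrite -/s E1 E2 in H.
rewrite /Rintegral integralE -H//.
  by have /integrableP[_] := integrable_funepos measurableT iG;
     under eq_integral do rewrite gee0_abs ?funepos_ge0//.
by have /integrableP[_] := integrable_funeneg measurableT iG;
   under eq_integral do rewrite gee0_abs ?funeneg_ge0//.
Qed.

Lemma int_coords_gauss_prod (s : seq nat) (h : nat -> R -> R) (c : nat -> R) : uniq s ->
  (forall k, measurable_fun setT (h k)) -> (forall k t, 0 <= h k t) ->
  (forall k, k \in s -> (\int[mu]_t (gauss t * h k t)%:E = (c k)%:E)%E) ->
  int_coords (@gauss R) s (fun x => (\prod_(k <- s) h k (x k))%:E) = cst (\prod_(k <- s) c k)%:E.
Proof.
move=> us mh h0 hc; have wg := weight_gauss R.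
elim: s us hc => [_ _|k s IH /= /andP[ks us] hc].
  by apply/funext => x; rewrite /= !big_nil.
have ph l : posm (fun x : points => (h l (x l))%:E).
  apply: (@posm_EFin R (fun x => h l (x l))) => // .
  by apply: measurableT_comp (mh l) _; exact: measurable_coord.
have pp : posm (fun x : points => (\prod_(k <- s) h k (x k))%:E).
  elim: s {IH ks us hc} => [|l s IHs].
    rewrite (_ : (fun x => _) = cst 1%E); first exact: posm_cst.
    by apply/funext => x; rewrite big_nil.
  rewrite (_ : (fun x => _) = fun x => ((h l (x l))%:E * (\prod_(k <- s) h k (x k))%:E)%E).
    exact: posmM.
  by apply/funext => x; rewrite big_cons EFinM.
rewrite (_ : (fun x => _) = fun x => ((h k (x k))%:E * (\prod_(k <- s) h k (x k))%:E)%E); last first.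
  by apply/funext => x; rewrite big_cons EFinM.
rewrite (int_coords_pull wg pp); first last.
- by move=> x; rewrite lee_fin.
- by move=> l ls x t; rewrite upd_other//; apply: contraNneq ks => ->.
rewrite IH// => [|l ls]; last by rewrite hc// inE ls orbT.
apply/funext => x; rewrite big_cons /int_coord/= EFinM -(hc k) ?mem_head//.
rewrite -ge0_integralZr//.
- by apply: eq_integral => t _; rewrite upd_same EFinM muleA.
- by apply/measurable_EFinP; apply: measurable_funM => //; first [exact: wg.1|exact: mh].
- by move=> t _; rewrite lee_fin mulr_ge0//; exact: wg.2.
rewrite lee_fin big_seq; apply: prodr_ge0 => l ls.
rewrite -lee_fin -hc ?inE ?ls ?orbT//; apply: integral_ge0 => t _.
by rewrite lee_fin mulr_ge0//; exact: wg.2.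
Qed.

End GaussianMeasure.

(** * Weierstrass approximation and integrals on the half-line *)

Section Bernstein.
Variable R : realType.

Definition bern n k : {poly R} := ('C(n, k))%:R *: ('X ^+ k * (1 - 'X) ^+ (n - k)).

Lemma bernE n k x : (bern n k).[x] = 'C(n, k)%:R * (x ^+ k * (1 - x) ^+ (n - k)).
Proof. by rewrite /bern !hornerE. Qed.

Lemma bern_ge0 n k x : 0 <= x <= 1 -> 0 <= (bern n k).[x].
Proof.
by move=> /andP[x0 x1]; rewrite bernE !mulr_ge0// exprn_ge0// subr_ge0.
Qed.

(* The binomial generating polynomial in an auxiliary variable; its derivatives
   at 1 are the factorial moments. *)
Lemma bern_gen n x : (x%:P * 'X + (1 - x)%:P) ^+ n =
  \sum_(k < n.+1) (bern n k).[x] *: 'X^k.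
Proof.
rewrite addrC exprDn; apply: eq_bigr => k _.
rewrite bernE exprMn -!rmorphXn/= -mulr_natl -mul_polyC !polyCM polyC_natr.
by ring.
Qed.

Lemma bern_sum0 n x : \sum_(k < n.+1) (bern n k).[x] = 1.
Proof.
have /(congr1 (horner^~ 1)) := bern_gen n x.
rewrite horner_sum horner_exp hornerD hornerM !hornerC hornerX mulr1.
rewrite [x + _]addrC subrK expr1n => ->.
by apply: eq_bigr => k _; rewrite [RHS]hornerZ hornerXn expr1n mulr1.
Qed.

Lemma bern_sum1 n x : \sum_(k < n.+1) (bern n k).[x] * k%:R = n%:R * x.
Proof.
have /(congr1 (fun p => p^`().[1])) := bern_gen n x.
rewrite linear_sum horner_sum => E.
transitivity (\sum_(k < n.+1) ((bern n k).[x] *: 'X^k)^`().[1]).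
  by apply: eq_bigr => k _; set b := _.[x]; rewrite derivZ derivXn hornerZ hornerMn hornerXn expr1n.
rewrite -E deriv_exp derivD derivM !derivC derivX mul0r add0r mulr1 addr0.
rewrite hornerMn hornerM horner_exp hornerD hornerM !hornerC hornerX mulr1.
by rewrite [x + _]addrC subrK expr1n mulr1 mulr_natl.
Qed.

Lemma bern_sum2 n x : \sum_(k < n.+1) (bern n k).[x] * (k * k.-1)%:R = (n * n.-1)%:R * x ^+ 2.
Proof.
have /(congr1 (fun p => p^`()^`().[1])) := bern_gen n x.
rewrite !linear_sum horner_sum => E.
transitivity (\sum_(k < n.+1) ((bern n k).[x] *: 'X^k)^`()^`().[1]).
  apply: eq_bigr => k _; set b := _.[x]; rewrite !derivZ derivXn derivMn derivXn -mulrnA.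
  by rewrite hornerZ hornerMn hornerXn expr1n mulnC.
rewrite -E deriv_exp derivD derivM !derivC derivX mul0r add0r mulr1 addr0.
rewrite derivMn derivM derivC mul0r add0r deriv_exp.
rewrite derivD derivM !derivC derivX mul0r add0r mulr1 addr0.
rewrite hornerMn hornerM hornerMn hornerM horner_exp hornerD hornerM !hornerC hornerX mulr1.
rewrite [x + _]addrC subrK expr1n mulr1 -mulr_natr -[_ *+ n.-1]mulr_natr natrM; ring.
Qed.

Lemma bern_variance n x : (0 < n)%N ->
  \sum_(k < n.+1) (bern n k).[x] * (x - k%:R / n%:R) ^+ 2 = x * (1 - x) / n%:R.
Proof.
move=> n0; have nn0 : n%:R != 0 :> R by rewrite pnatr_eq0 -lt0n.
(* The square is written in 1, k and k(k-1), whose sums against the Bernstein weights are known. *)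
have E k : (x - k%:R / n%:R) ^+ 2 = x ^+ 2 * 1 - (2 * x / n%:R - (n%:R ^+ 2)^-1) * k%:R
    + (n%:R ^+ 2)^-1 * (k * k.-1)%:R :> R.
  case: k => [|k]; first by rewrite mul0n !mulr0 mul0r; ring.
  by rewrite natrM /= -natr1; field.
transitivity (x ^+ 2 * 1 - (2 * x / n%:R - (n%:R ^+ 2)^-1) * (n%:R * x) +
   (n%:R ^+ 2)^-1 * ((n * n.-1)%:R * x ^+ 2)); last first.
  by case: n n0 nn0 {E} => // m _ nn0; rewrite natrM /=; move: nn0; rewrite -natr1 => nn0; field.
rewrite -(bern_sum1 n x) -(bern_sum2 n x) -[X in x ^+ 2 * X](bern_sum0 n x).
rewrite !mulr_sumr -sumrN -!big_split/=.
by apply: eq_bigr => k _; rewrite E; ring.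
Qed.

(** The quadratic term replaces the usual splitting of the Bernstein sum into near and far nodes:
    the second moment alone then bounds the error. Close points are covered by [e]; for the others C
    = 2M/d'^2 works, with M a bound of |f| on [0, 1]. *)
Lemma uniform_bound (f : R -> R) (e : R) : continuous f -> 0 < e ->
  exists2 C : R, 0 <= C & forall x y : R, 0 <= x <= 1 -> 0 <= y <= 1 ->
    `|f x - f y| <= e + C * (x - y) ^+ 2.
Proof.
move=> cf e0.
have cK : compact `[0 : R, 1] by exact: segment_compact.
(* Compactness turns the pointwise moduli of continuity into one [d] valid at every x of the
   interval. *)
have /compact_near_coveringP/(_ _ (0 : R)^'+
  (fun d x => forall y, `|x - y| < d -> `|f x - f y| < e) _) := cK.
case.
  move=> x _.
  have /nbhs_ballP[r /= r0 fr] : \forall z \near x, `|f x - f z| < e / 2.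
    by move/cvgrPdist_lt: (cf x); apply; rewrite divr_gt0.
  have r20 : 0 < r / 2 by rewrite divr_gt0.
  exists (ball x (r / 2), [set d : R | d < r / 2]) => /=.
    by split; [exact: nbhsx_ballx|exact: nbhs_right_lt].
  move=> [z d] /= [xz dr] y zy.
  have xy : `|x - y| < r.
    rewrite (le_lt_trans (ler_distD z _ _))// [ltRHS]splitr ltrD//.
    exact: lt_trans zy dr.
  have xz' : `|x - z| < r by rewrite (lt_trans xz)// [ltRHS]splitr ltrDl.
  rewrite (le_lt_trans (ler_distD (f x) _ _))// [ltRHS]splitr ltrD//; last exact: fr.
  by rewrite distrC; exact: fr.
move=> d /= d0 H.
have [M M0 fM] : exists2 M : R, 0 <= M & forall x : R, 0 <= x <= 1 -> `|f x| <= M.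
  have cf' : {within `[0, 1], continuous (fun x : R => `|f x|)}.
    apply: continuous_subspaceT => x; apply: (continuous_comp (cf x)).
    exact: norm_continuous.
  have [c _ Hc] := EVT_max ler01 cf'.
  by exists `|f c| => // x x01; apply: Hc; rewrite in_itv.
pose d' := d / 2.
have d'0 : 0 < d' by rewrite divr_gt0.
have Hd x y : 0 <= x <= 1 -> `|x - y| < d' -> `|f x - f y| < e.
  move=> x01 xy; apply: (H d' _ d'0 x) => //.
  by rewrite /= sub0r normrN gtr0_norm// /d' [ltRHS]splitr ltrDl.
have d2 : 0 < d' ^+ 2 by rewrite exprn_gt0.
have C0 : 0 <= (2 * M) / d' ^+ 2 by rewrite divr_ge0 ?mulr_ge0// ltW.
exists ((2 * M) / d' ^+ 2) => // x y x01 y01; have [xy|xy] := ltP `|x - y| d'.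
  by rewrite ler_wpDr ?(ltW (Hd _ _ x01 xy))// mulr_ge0// sqr_ge0.
rewrite ler_wpDl ?(ltW e0)//.
rewrite (le_trans (ler_normB _ _))// (@le_trans _ _ (2 * M))//.
  by rewrite mulr_natl mulr2n lerD ?fM.
rewrite mulrAC ler_pdivlMr// ler_wpM2l ?mulr_ge0//.
by rewrite -[(x - y) ^+ 2]real_normK ?num_real// ler_pXn2r// nnegrE// ltW.
Qed.

Lemma weierstrass (f : R -> R) (e : R) : continuous f -> 0 < e ->
  exists p : {poly R}, forall x : R, 0 <= x <= 1 -> `|f x - p.[x]| <= e.
Proof.
move=> cf e0; have e20 : 0 < e / 2 by rewrite divr_gt0.
have [C C0 HC] := uniform_bound cf e20.
pose n := (Num.trunc (C / (e / 2))).+1.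
have nC : C / n%:R <= e / 2.
  by rewrite ler_pdivrMr ?ltr0n// mulrC -ler_pdivrMr// ltW// truncnS_gt.
exists (\sum_(k < n.+1) f (k%:R / n%:R) *: bern n k) => x x01.
have k01 (k : 'I_n.+1) : 0 <= (k%:R / n%:R : R) <= 1.
  by rewrite divr_ge0//= ler_pdivrMr ?ltr0n// mul1r ler_nat -ltnS ltn_ord.
have -> : f x - (\sum_(k < n.+1) f (k%:R / n%:R) *: bern n k).[x] =
    \sum_(k < n.+1) (f x - f (k%:R / n%:R)) * (bern n k).[x].
  rewrite horner_sum -[in LHS](mulr1 (f x)) -[X in f x * X](bern_sum0 n x) mulr_sumr -sumrB.
  by apply: eq_bigr => k _; rewrite [X in _ - X = _]hornerZ mulrBl.
rewrite (le_trans (ler_norm_sum _ _ _))//.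
apply: (@le_trans _ _ (\sum_(k < n.+1) ((e / 2) * (bern n k).[x] +
    C * ((bern n k).[x] * (x - k%:R / n%:R) ^+ 2)))).
  apply: ler_sum => k _; rewrite normrM (ger0_norm (bern_ge0 _ _ x01)).
  rewrite [X in _ <= _ + C * X]mulrC mulrA -mulrDl.
  by rewrite ler_wpM2r ?bern_ge0//; exact: HC.
rewrite big_split/= -!mulr_sumr bern_sum0 bern_variance// mulr1.
rewrite [leRHS]splitr lerD2l (le_trans _ nC)// mulrA ler_pM2r ?invr_gt0 ?ltr0n//.
rewrite ler_piMr//; case/andP: x01 => x0 x1; nra.
Qed.

End Bernstein.

(** * Exponential integrals on the half-line and density of test functions *)

Section HalfLine.
Variable R : realType.
Local Notation mu := (@lebesgue_measure R).
Implicit Types (F f g : R -> R) (p : {poly R}).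

Lemma cvg_id_expR (a : R) : 0 < a -> (t * expR (- (a * t))) @[t --> +oo] --> (0 : R).
Proof.
move=> a0; apply/cvgrPdist_le => e e0.
near=> t.
have t0 : 0 < t by near: t; exact: nbhs_pinfty_gt.
rewrite sub0r normrN ger0_norm ?mulr_ge0 ?expR_ge0 ?(ltW t0)//.
rewrite expRN ler_pdivrMr ?expR_gt0//.
have at0 : 0 <= a * t by rewrite mulr_ge0 ?ltW.
have := expR_ge1Dxn 1 at0; rewrite expr2 => H.
apply: (@le_trans _ _ (e * ((a * t) * (a * t) / 2))); last first.
  by rewrite ler_wpM2l ?(ltW e0)// (le_trans _ H)// lerDr.
have tb : 2 / (e * (a * a)) <= t by near: t; apply: nbhs_pinfty_ge; exact: num_real.
rewrite -[leLHS]mulr1 (_ : e * _ = t * ((e * (a * a)) / 2 * t)); last by field.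
rewrite ler_wpM2l ?(ltW t0)//.
rewrite -ler_pdivrMl ?divr_gt0 ?mulr_gt0// mulr1 invf_div.
Unshelve. all: by end_near. Qed.

Lemma cvg_expRNM (a : R) : 0 < a -> expR (- (a * t)) @[t --> +oo] --> (0 : R).
Proof.
move=> a0; apply: (cvg_comp (fun t => a * t) (fun t => expR (- t)) _ (@cvgr_expR R)).
by apply: gt0_cvgMry => //; exact: cvg_id.
Qed.

Lemma cvg_poly_expR p (a : R) : 0 < a -> (p.[t] * expR (- (a * t))) @[t --> +oo] --> (0 : R).
Proof.
elim/poly_ind: p a => [|p c IH] a a0.
  by under eq_fun do rewrite horner0 mul0r; exact: cvg_cst.
have a20 : 0 < a / 2 by rewrite divr_gt0.
(* Half of the exponent is spent on the factor t, the other half on [p]. *)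
have -> : (fun t => (p * 'X + c%:P).[t] * expR (- (a * t))) =
    (fun t => (p.[t] * expR (- (a / 2 * t))) * (t * expR (- (a / 2 * t))) +
      c * expR (- (a * t))).
  apply/funext => t; rewrite hornerMXaddC.
  rewrite (_ : - (a * t) = - (a / 2 * t) + - (a / 2 * t)) ?expRD; first by ring.
  by field.
rewrite [X in _ --> X](_ : 0 = 0 * 0 + c * 0 :> R); last by rewrite !mulr0 addr0.
apply: cvgD.
  by apply: cvgM; [exact: IH|exact: cvg_id_expR].
by apply: cvgM; [exact: cvg_cst|exact: cvg_expRNM].
Qed.

Lemma is_derive_expRN (t : R) : is_derive t 1 (fun t : R => expR (- t)) (- expR (- t)).
Proof.
have H : is_derive t 1 (-%R : R -> R) (- 1) by exact: is_deriveNid.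
have := is_derive1_comp (is_derive_expR (- t)) H.
by rewrite mulrN1.
Qed.

Lemma is_derive_rat_expR p q (t : R) : q.[t] != 0 ->
  is_derive t 1 (fun t => p.[t] * expR (- t) / q.[t])
    (((p^`() - p) * q - p * q^`()).[t] * expR (- t) / q.[t] ^+ 2).
Proof.
move=> q0.
have H1 := is_deriveM (is_derive_poly p t) (is_derive_expRN t).
have H2 := is_deriveM H1 (is_deriveV q0 (is_derive_poly q t)).
apply: (is_derive_eq H2); rewrite !hornerE /= /GRing.scale/=.
change ((horner p * (fun u : R => expR (- u))) t) with (p.[t] * expR (- t)).
by field.
Qed.

(** The integrand may change sign, so the half-line is exhausted by bounded intervals under
    dominated convergence, with |f| as the bound. *)
Lemma integral_derive_infty F f (l : R) :
  (forall t : R, 0 <= t -> is_derive t 1 F (f t)) ->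
  (forall t : R, 0 <= t -> {for t, continuous f}) ->
  mu.-integrable `[0, +oo[ (EFin \o f) ->
  F t @[t --> +oo] --> l ->
  (\int[mu]_(t in `[0, +oo[) f t = l - F 0)%R.
Proof.
move=> dF cf intf Fl.
have mD : measurable (`[0, +oo[%classic : set R) by exact: measurable_itv.
have [mf _] := integrableP _ _ _ intf.
(* The endpoint [n.+1] keeps the interval nondegenerate for n = 0. *)
pose g (n : nat) : R -> \bar R := (EFin \o f) \_ `[0, n.+1%:R].
have mI n : measurable (`[0, n.+1%:R]%classic : set R) by exact: measurable_itv.
have DI n : `[0, +oo[ `&` `[0, n.+1%:R] = `[0, n.+1%:R]%classic :> set R.
  apply/setIidPr => t /=; rewrite !in_itv/= andbT => /andP[].
  by [].
have mg n : measurable_fun (`[0, +oo[%classic : set R) (g n).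
  by apply/(measurable_restrict _ (mI n) mD); rewrite DI; apply: measurable_funS mf => //; rewrite -(DI n); exact: subIsetl.
have ci : (\int[mu]_(t in `[0%R, +oo[) g n t)%E @[n --> \oo] -->
    (\int[mu]_(t in `[0%R, +oo[) (f t)%:E)%E.
  have [|||_ _ H] := @dominated_convergence _ _ _ mu _ mD g (EFin \o f)
    (abse \o (EFin \o f)) mg mf.
  - apply: aeW => t /=; rewrite in_itv/= andbT => t0.
    apply: cvg_near_cst; near=> n; apply/eqP.
    rewrite /g patchE mem_set//= in_itv/= t0/=.
    apply: (@le_trans _ _ n%:R); last by rewrite ler_nat.
    by near: n; exact: nbhs_infty_ger.
  - exact: integrable_abse.
  - apply: aeW => t n _; rewrite /g/= patchE.
    by case: ifPn => //; rewrite abse0 lee_fin.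
  exact: H.
have gE n : (\int[mu]_(t in `[0%R, +oo[) g n t = (F n.+1%:R - F 0)%:E)%E.
  rewrite /g -integral_mkcondr DI (@continuous_FTC2 _ f F)//.
  - by apply: continuous_in_subspaceT => t /set_mem/=; rewrite in_itv/= => /andP[t0 _]; exact: cf.
  - have cF t : 0 <= t -> {for t, continuous F}.
      by move=> t0; apply/differentiable_continuous/derivable1_diffP; case: (dF t t0).
    split.
    + move=> t; rewrite in_itv/= => /andP[/ltW t0 _]; by case: (dF t t0).
    + by apply: cvg_at_right_filter; exact: cF.
    + by apply: cvg_at_left_filter; exact: cF.
  - by move=> t; rewrite in_itv/= => /andP[/ltW t0 _]; rewrite derive1E; case: (dF t t0).
have FE : (\int[mu]_(t in `[0%R, +oo[) (f t)%:E = (l - F 0)%:E)%E.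
  rewrite -(cvg_lim _ ci)//; apply/cvg_lim => //.
  under eq_fun do rewrite gE.
  apply: cvg_EFin; first by near=> n.
  apply: cvgB; last exact: cvg_cst.
  rewrite (cvg_shiftS (fun n => F n%:R)).
  exact: (cvg_comp _ F (@cvgr_idn _)).
by rewrite /Rintegral FE.
Unshelve. all: by end_near. Qed.

Lemma is_derive_poly_expRM p (a t : R) :
  is_derive t 1 (fun t => p.[t] * expR (- (a * t))) ((p^`() - a *: p).[t] * expR (- (a * t))).
Proof.
have H : is_derive t 1 (horner (- (a *: 'X))) (- (a *: 'X))^`().[t] := is_derive_poly _ _.
have H1 := is_deriveM (is_derive_poly p t) (is_derive1_comp (is_derive_expR _) H).
rewrite (_ : (fun t => _) = (horner p * (expR \o horner (- (a *: 'X))))).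
  apply: (is_derive_eq H1); rewrite /= derivN derivZ derivX /GRing.scale/= hornerD !hornerN !hornerZ hornerX hornerC mulr1.
  by ring.
by apply/funext => u; rewrite /GRing.mul/= !hornerE.
Qed.

(** The polynomial solution p of a p - p' = X^m. Then -p(t)exp(-at) is a primitive of t^m exp(-at),
    and p(0) is the Gamma integral. *)
Fixpoint gamma_poly (a : R) (m : nat) : {poly R} :=
  if m is m'.+1 then a^-1 *: ('X^m + m%:R *: gamma_poly a m') else (a^-1)%:P.

Lemma gamma_polyE a m : a != 0 ->
  a *: gamma_poly a m - (gamma_poly a m)^`() = 'X^m.
Proof.
move=> a0; elim: m => [|m IH] /=.
  by rewrite derivC subr0 -mul_polyC -polyCM divff.
rewrite scalerA divff// scale1r derivZ derivD derivXn derivZ -addrA.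
rewrite -[RHS]addr0; congr (_ + _).
rewrite -{1}[gamma_poly a m](scalerK a0) -[a *: gamma_poly a m](subrK (gamma_poly a m)^`()) IH.
rewrite /= scalerA mulrC -scalerA -scalerBr; apply/eqP.
by rewrite [m.+1%:R *: (_ + _)]scalerDr [_ *: 'X^m]scaler_nat subrr scaler0.
Qed.

Lemma gamma_poly0 a m : (gamma_poly a m).[0] = m`!%:R / a ^+ m.+1.
Proof.
elim: m => [|m IH] /=; first by rewrite hornerC fact0 expr1 mul1r.
rewrite !hornerE IH expr0n/= add0r factS natrM [in RHS]exprS invfM; ring.
Qed.

Lemma continuous_poly_expRM p (a : R) : continuous (fun t : R => p.[t] * expR (- (a * t))).
Proof.
move=> t; apply/differentiable_continuous/derivable1_diffP.
by case: (is_derive_poly_expRM p a t).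
Qed.

Lemma gamma_integral a m : 0 < a ->
  (\int[mu]_(t in `[0%R, +oo[) (t ^+ m * expR (- (a * t)))%:E = (m`!%:R / a ^+ m.+1)%:E)%E.
Proof.
move=> a0; have an0 := lt0r_neq0 a0.
have E t : (t ^+ m * expR (- (a * t)))%R = ('X^m).[t] * expR (- (a * t)).
  by rewrite hornerXn.
under eq_integral do rewrite E.
rewrite (@ge0_continuous_FTC2y _ _ (fun t => (- gamma_poly a m).[t] * expR (- (a * t))) 0 0).
- by rewrite mulr0 oppr0 expR0 mulr1 hornerN gamma_poly0 -EFinB sub0r opprK.
- by move=> t t0; rewrite hornerXn mulr_ge0 ?exprn_ge0 ?expR_ge0.
- by apply: continuous_subspaceT; exact: continuous_poly_expRM.
- exact: cvg_poly_expR.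
- by move=> t _; case: (is_derive_poly_expRM (- gamma_poly a m) a t).
- by apply: cvg_at_right_filter; exact: continuous_poly_expRM.
- move=> t _; rewrite derive1E.
  have [_ ->] := is_derive_poly_expRM (- gamma_poly a m) a t.
  by rewrite derivN scalerN opprK addrC gamma_polyE.
Qed.

Local Notation half := (`[0%R, +oo[%classic : set R).

Lemma integrable_poly_expRM p (a : R) : 0 < a ->
  mu.-integrable half (fun t => (p.[t] * expR (- (a * t)))%:E).
Proof.
move=> a0; have mH : measurable half by exact: measurable_itv.
have Hm m : mu.-integrable half (fun t => (t ^+ m * expR (- (a * t)))%:E).
  apply/integrableP; split.
    apply/measurable_EFinP; apply: measurable_funTS.
    apply: continuous_measurable_fun => t.
    by under eq_fun do rewrite -hornerXn; exact: continuous_poly_expRM.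
  under eq_integral.
    move=> t /set_mem/=; rewrite in_itv/= andbT => t0.
    rewrite ger0_norm ?mulr_ge0 ?exprn_ge0 ?expR_ge0//; over.
  by rewrite /= gamma_integral// ltry.
suff Hn n : mu.-integrable half (fun t => (\sum_(i < n) p`_i * (t ^+ i * expR (- (a * t))))%:E).
  have -> : (fun t : R => (p.[t] * expR (- (a * t)))%:E) =
      fun t => (\sum_(i < size p) p`_i * (t ^+ i * expR (- (a * t))))%:E.
    apply/funext => t; congr EFin; rewrite horner_coef mulr_suml.
    by apply: eq_bigr => i _; rewrite mulrA.
  exact: Hn.
elim: n => [|n IH].
  have -> : (fun t : R => (\sum_(i < 0) p`_i * (t ^+ i * expR (- (a * t))))%:E) = cst 0%E.
    by apply/funext => t; rewrite big_ord0.
  exact: integrable0.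
have -> : (fun t : R => (\sum_(i < n.+1) p`_i * (t ^+ i * expR (- (a * t))))%:E) =
   (fun t : R => (\sum_(i < n) p`_i * (t ^+ i * expR (- (a * t))))%:E) \+
   (fun t : R => (p`_n)%R%:E * (t ^+ n * expR (- (a * t)))%:E)%E.
  by apply/funext => t; rewrite /= big_ord_recr/= EFinD EFinM.
by apply: integrableD => //; exact: integrableZl.
Qed.

Lemma integrable_dominated f g : (forall t : R, 0 <= t -> {for t, continuous f}) ->
  (forall t : R, 0 <= t -> `|f t| <= g t) -> mu.-integrable half (EFin \o g) ->
  mu.-integrable half (EFin \o f).
Proof.
move=> cf fg ig; have mH : measurable half by exact: measurable_itv.
apply: (@le_integrable _ _ _ mu _ mH (EFin \o f) (EFin \o g)) => //.
  apply/measurable_EFinP; apply: subspace_continuous_measurable_fun => //.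
  by apply: continuous_in_subspaceT => t /set_mem/=; rewrite in_itv/= andbT; exact: cf.
move=> t /=; rewrite in_itv/= andbT => t0.
by rewrite lee_fin (le_trans (fg t t0))// ler_norm.
Qed.

Lemma poly_norm_bound p : exists q : {poly R}, forall t : R, 0 <= t -> `|p.[t]| <= q.[t].
Proof.
exists (\poly_(i < size p) `|p`_i|) => t t0.
rewrite horner_poly horner_coef (le_trans (ler_norm_sum _ _ _))// ler_sum// => i _.
by rewrite normrM ler_wpM2l// ger0_norm// exprn_ge0.
Qed.

Lemma continuous_rat_expR p q (t : R) : q.[t] != 0 ->
  {for t, continuous (fun t : R => p.[t] * expR (- t) / q.[t])}.
Proof.
move=> q0; apply/differentiable_continuous/derivable1_diffP.
by case: (is_derive_rat_expR p q0).
Qed.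

Lemma integrable_rat_expR p q : (forall t : R, 0 <= t -> 1 <= q.[t]) ->
  mu.-integrable half (fun t => (p.[t] * expR (- t) / q.[t])%:E).
Proof.
move=> q1; have [b pb] := poly_norm_bound p.
apply: (@integrable_dominated _ (fun t => b.[t] * expR (- (1 * t)))).
- move=> t t0; apply: continuous_rat_expR; apply: lt0r_neq0.
  exact: lt_le_trans (q1 t t0).
- move=> t t0; have q0 : 0 < q.[t] by exact: lt_le_trans (q1 t t0).
  rewrite mul1r !normrM (gtr0_norm (expR_gt0 _)) normfV (gtr0_norm q0).
  rewrite ler_pdivrMr// -mulrA ler_pM ?mulr_ge0 ?expR_ge0 ?pb// ?normr_ge0//.
  by rewrite ler_peMr ?expR_ge0// q1.
- exact: integrable_poly_expRM.
Qed.

(** Integration by parts in the form used later: when p(0) = 0, two integrands that differ by such a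
    derivative have the same integral. *)
Lemma integral_derive_rat_expR p q : (forall t : R, 0 <= t -> 1 <= q.[t]) ->
  (\int[mu]_(t in `[0, +oo[)
    (((p^`() - p) * q - p * q^`()).[t] * expR (- t) / (q ^+ 2).[t]) =
   - (p.[0] / q.[0]))%R.
Proof.
move=> q1; have q0 (t : R) : 0 <= t -> q.[t] != 0.
  by move=> t0; apply: lt0r_neq0; exact: lt_le_trans (q1 t t0).
have q2 (t : R) : 0 <= t -> 1 <= (q ^+ 2).[t].
  by move=> t0; rewrite horner_exp exprn_ege1// q1.
pose F t := p.[t] * expR (- t) / q.[t].
rewrite [RHS](_ : _ = 0 - F 0); last by rewrite /F oppr0 expR0 mulr1 sub0r.
apply: integral_derive_infty.
- by move=> t t0; rewrite horner_exp; apply: is_derive_rat_expR; exact: q0.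
- move=> t t0; apply: continuous_rat_expR; apply: lt0r_neq0.
  exact: lt_le_trans (q2 t t0).
- exact: integrable_rat_expR.
have cp : (p.[t] * expR (- t)) @[t --> +oo] --> (0 : R).
  rewrite (_ : (fun t => _) = fun t => p.[t] * expR (- (1 * t))).
    exact: cvg_poly_expR.
  by apply/funext => t; rewrite mul1r.
apply/cvgrPdist_le => e e0; near=> t.
have t0 : 0 <= t by near: t; apply: nbhs_pinfty_ge; exact: num_real.
rewrite sub0r normrN normrM normfV ler_pdivrMr ?normr_gt0 ?q0//.
apply: (@le_trans _ _ (e * 1)); last first.
  by rewrite ler_wpM2l ?(ltW e0)// (le_trans (q1 t t0))// ler_norm.
rewrite mulr1 -[p.[t] * _]opprK normrN -[- _]add0r.
by near: t; move/cvgrPdist_le: cp; apply.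
Unshelve. all: by end_near. Qed.

Lemma eq0_le_eps (x C : R) : 0 <= C -> (forall e : R, 0 < e -> `|x| <= C * e) -> x = 0.
Proof.
move=> C0 H; apply/normr0_eq0/le_anti/andP; split => //.
apply/ler_addgt0Pl => e e0.
have C1 : 0 < C + 1 by rewrite ltr_wpDl.
rewrite addr0 (le_trans (H _ (divr_gt0 e0 C1)))// mulrA ler_pdivrMr//.
by rewrite mulrC ler_wpM2l ?(ltW e0)// lerDl.
Qed.

(** The bound concerns t >= 0 only, where eigenvalues and integration variables live. Continuity on
    the whole line avoids subspace topologies. *)
Definition bcont f := continuous f /\ exists B : R, forall t : R, 0 <= t -> `|f t| <= B.

Lemma bcont_poly p (u : R -> R) : continuous u ->
  (forall t : R, 0 <= t -> 0 <= u t <= 1) -> bcont (fun t => p.[u t]).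
Proof.
move=> cu u01; split.
  by move=> t; apply: (continuous_comp (cu t)); exact: continuous_horner.
have [q pq] := poly_norm_bound p.
exists (\sum_(i < size p) `|p`_i|) => t t0; have /andP[ut0 ut1] := u01 t t0.
rewrite horner_coef (le_trans (ler_norm_sum _ _ _))// ler_sum// => i _.
rewrite normrM normrX ler_piMr// exprn_ile1// ger0_norm//.
Qed.

Lemma bcont_sub f g : bcont f -> bcont g -> bcont (fun t => f t - g t).
Proof.
move=> [cf [B HB]] [cg [C HC]]; split; first by move=> t; apply: cvgB; [exact: cf|exact: cg].
by exists (B + C) => t t0; rewrite (le_trans (ler_normB _ _))// lerD ?HB ?HC.
Qed.

Lemma bcont_lin (a : R) f g : bcont f -> bcont g -> bcont (fun t => a * f t + g t).
Proof.
move=> [cf [B HB]] [cg [C HC]]; split.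
  by move=> t; apply: cvgD; [apply: cvgM; [exact: cvg_cst|exact: cf]|exact: cg].
exists (`|a| * B + C) => t t0; rewrite (le_trans (ler_normD _ _))// lerD ?HC//.
by rewrite normrM ler_wpM2l ?HB.
Qed.

(* A bounded functional that kills the powers of [u] kills every compactly
   supported function, by Weierstrass in the variable [u t]. *)
Lemma functional_density (L : (R -> R) -> R) (C : R) (u v : R -> R) : 0 <= C ->
  (forall a f g, bcont f -> bcont g -> L (fun t => a * f t + g t) = a * L f + L g) ->
  (forall (f : R -> R) (B : R), bcont f -> (forall t : R, 0 <= t -> `|f t| <= B) -> `|L f| <= C * B) ->
  continuous u -> (forall t : R, 0 <= t -> 0 < u t <= 1) ->
  (forall t : R, 0 <= t -> v (u t) = t) ->
  (forall s : R, 0 < s -> {for s, continuous v}) ->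
  (forall N : R, exists2 d : R, 0 < d & forall s : R, 0 < s < d -> N <= v s) ->
  (forall k, L (fun t => u t ^+ k) = 0) ->
  forall f, continuous f -> (exists N : R, forall t : R, N <= t -> f t = 0) -> L f = 0.
Proof.
move=> C0 Llin Lbd cu u01 vu cv vinf Lu f cf [N fN].
(* This is [f] read in the variable s = u(t). Small positive s correspond to large t, where [f]
   vanishes, so the extension by 0 is continuous. *)
pose g (s : R) := if s <= 0 then 0 else f (v s).
have [d d0 Hd] := vinf N.
have g0 (s : R) : s < d -> g s = 0.
  rewrite /g; case: (leP s 0) => // s0 sd; apply: fN; apply: Hd.
  by rewrite s0.
have cg : continuous g.
  move=> s; have [sd|ds] := ltP s d.
    apply: cvg_near_cst; near=> z; rewrite !g0//.
    by near: z; exact: lt_nbhsl.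
  have s0 : 0 < s := lt_le_trans d0 ds.
  have := continuous_comp (cv s s0) (cf (v s)).
  have gs : g s = (f \o v) s by rewrite /g leNgt s0.
  rewrite /continuous_at gs.
  apply: cvg_trans; apply: near_eq_cvg; near=> z.
  rewrite /g leNgt; suff -> : 0 < z by [].
  by near: z; exact: lt_nbhsr.
have [M gM] : exists M : R, forall s : R, 0 <= s <= 1 -> `|g s| <= M.
  have cg' : {within `[0, 1], continuous (fun x : R => `|g x|)}.
    apply: continuous_subspaceT => x; apply: (continuous_comp (cg x)).
    exact: norm_continuous.
  have [c _ Hc] := EVT_max ler01 cg'.
  by exists `|g c| => x x01; apply: Hc; rewrite in_itv.
have gu (t : R) : 0 <= t -> g (u t) = f t.
  move=> t0; rewrite /g; have /andP[ut0 _] := u01 t t0.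
  by rewrite leNgt ut0/= vu.
have u01' (t : R) : 0 <= t -> 0 <= u t <= 1 by move=> /u01/andP[/ltW -> ->].
have bf : bcont f.
  by split => //; exists M => t t0; rewrite -gu//; exact/gM/u01'.
apply: (eq0_le_eps C0) => e e0.
have [p Hp] := weierstrass cg e0.
have L0 : L (fun=> 0) = 0.
  apply: (eq0_le_eps C0) => e' e'0; apply: Lbd.
    split; [exact: cst_continuous|by exists 0 => t _; rewrite normr0].
  by move=> t _; rewrite normr0 ltW.
have Lp : L (fun t => p.[u t]) = 0.
  rewrite (_ : (fun t => _) = fun t => \sum_(i < size p) p`_i * u t ^+ i); last first.
    by apply/funext => t; rewrite horner_coef.
  elim: (size p) => [|n IH].
    by rewrite (_ : (fun t => _) = fun=> 0)//; apply/funext => t; rewrite big_ord0.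
  rewrite (_ : (fun t => _) = fun t => p`_n * u t ^+ n + \sum_(i < n) p`_i * u t ^+ i); last first.
    by apply/funext => t; rewrite big_ord_recr/= addrC.
  rewrite Llin ?Lu ?mulr0 ?add0r//.
    rewrite (_ : (fun t => _) = fun t => ('X^n).[u t]); first exact: bcont_poly.
    by apply/funext => t; rewrite hornerXn.
  rewrite (_ : (fun t => _) = fun t => (\sum_(i < n) p`_i *: 'X^i).[u t]); first exact: bcont_poly.
  by apply/funext => t; rewrite horner_sum; apply: eq_bigr => i _; rewrite hornerZ hornerXn.
have bp := bcont_poly p cu u01'.
have -> : L f = L (fun t => f t - p.[u t]).
  have -> : (fun t => f t - p.[u t]) = (fun t => -1 * p.[u t] + f t).
    by apply/funext => t; ring.
  by rewrite Llin// Lp mulr0 add0r.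
apply: Lbd; first exact: bcont_sub.
by move=> t t0; rewrite -gu//; exact: Hp (u01' t t0).
Unshelve. all: by end_near. Qed.

End HalfLine.

(** * Interpolation at the eigenvalues *)

Lemma deriv_prod_seq (K : comNzRingType) (I : eqType) (r : seq I) (f : I -> {poly K}) :
  uniq r -> (\prod_(j <- r) f j)^`() = \sum_(i <- r) (f i)^`() * \prod_(j <- r | j != i) f j.
Proof.
elim: r => [|i r IH] /=; first by rewrite !big_nil derivC.
move=> /andP[ir ur]; rewrite !big_cons derivM IH// eqxx/=; congr (_ * _ + _).
  rewrite big_seq [RHS]big_seq_cond; apply: eq_bigl => j.
  by case: (boolP (j \in r)) => //= jr; apply/esym; apply: contraNneq ir => <-.
rewrite mulr_sumr; apply: eq_big_seq => j jr.
rewrite big_cons ifT; first by rewrite mulrCA.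
by apply: contraNneq ir => ->.
Qed.

Section Interpolation.
Variables (R : realType) (n : nat) (d : 'I_n -> R).
Hypothesis d_inj : injective d.

Lemma horner_ord (p : {poly R}) (x : R) : (size p <= n)%N ->
  p.[x] = \sum_(j < n) p`_(n - j.+1) * x ^+ (n - j.+1).
Proof.
move=> sp; rewrite (horner_coef_wide _ sp) (reindex_inj rev_ord_inj)/=.
by [].
Qed.

(** A row vector in the left kernel lists the coefficients of a polynomial of degree less than n
    with the n distinct roots d_i. *)
Lemma vandermonde_unit : vandermonde_D d \in unitmx.
Proof.
rewrite -row_free_unit -kermx_eq0; apply/eqP/row_matrixP => a.
set r := row a _; have : r *m vandermonde_D d = 0.
  by apply/sub_kermxP; exact: row_sub.
move=> rV; rewrite row0.
pose p := \poly_(i < n) (if insub i is Some j then r 0 (rev_ord j) else 0).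
have pE (j : 'I_n) : p`_(n - j.+1) = r 0 j.
  have jn : (n - j.+1 < n)%N by have := ltn_ord j; lia.
  rewrite coef_poly jn (insubT (fun i => i < n)%N jn); congr (r 0 _).
  by apply: val_inj => /=; have := ltn_ord j; lia.
have sp : (size p <= n)%N by exact: size_poly.
have p0 : p = 0.
  apply/eqP; apply: contraT => pn0.
  have := @max_poly_roots _ p [seq d i | i <- enum 'I_n] pn0.
  rewrite size_map size_enum_ord ltnNge sp; apply.
    apply/allP => x /mapP[i _ ->]; apply/rootP; rewrite (horner_ord _ sp).
    transitivity ((r *m vandermonde_D d) 0 i); last by rewrite rV mxE.
    by rewrite [RHS]mxE; apply: eq_bigr => j _; rewrite pE; congr (_ * _); rewrite mxE.
  by rewrite map_inj_uniq ?enum_uniq.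
by apply/rowP => j; rewrite -pE p0 coef0 mxE.
Qed.

(** The coefficient of X^(n-k-1) in the Lagrange basis polynomial of the node d_i. *)
Definition lagr (i k : 'I_n) : R := invmx (vandermonde_D d) i k.

(** Expansion along the replaced row: its cofactors are those of the Vandermonde matrix, hence,
    after division by the determinant, entries of the inverse. *)
Lemma det_replace_row (k : 'I_n) (h : 'I_n -> R) :
  (\det (vandermonde_D d))^-1 *
    \det (\matrix_(j < n, i < n) if j == k then h i else d i ^+ (n - j.+1)) =
  \sum_i h i * lagr i k.
Proof.
rewrite [X in _ * X = _](expand_det_row _ k) mulr_sumr; apply: eq_bigr => i _.
rewrite !mxE eqxx mulrCA; congr (_ * _).
rewrite /lagr /invmx vandermonde_unit !mxE; congr (_ * _).
rewrite /cofactor; congr (_ * \det _); apply/matrixP => a b; rewrite !mxE.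
by rewrite eq_sym (negbTE (neq_lift _ _)).
Qed.

Lemma lagr_poly (p : {poly R}) (k : 'I_n) : (size p <= n)%N ->
  \sum_i p.[d i] * lagr i k = p`_(n - k.+1).
Proof.
move=> sp; under eq_bigr do rewrite (horner_ord _ sp) mulr_suml.
have E (j : 'I_n) : \sum_i d i ^+ (n - j.+1) * lagr i k = (j == k)%:R.
  have := congr1 (fun M : 'M[R]_n => M j k) (mulmxV vandermonde_unit).
  by rewrite !mxE => <-; apply: eq_bigr => i _; rewrite !mxE.
rewrite exchange_big/=; transitivity (\sum_(j < n) p`_(n - j.+1) * (j == k)%:R).
  by apply: eq_bigr => j _; rewrite -E mulr_sumr; apply: eq_bigr => i _; rewrite mulrA.
rewrite (bigD1 k)//= eqxx mulr1 big1 ?addr0// => j /negbTE ->.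
by rewrite mulr0.
Qed.

(** det(1 + X diag(d)), the generating polynomial of the elementary symmetric functions of [d];
    [Pdi i] is that of the d_j with j != i. *)
Definition Pd : {poly R} := \prod_j (1 + d j *: 'X).
Definition Pdi (i : 'I_n) : {poly R} := \prod_(j | j != i) (1 + d j *: 'X).

Lemma Pd_split i : Pd = (1 + d i *: 'X) * Pdi i.
Proof. by rewrite /Pd (bigD1 i). Qed.

Lemma coef_Pd0 i : Pd`_0 = (Pdi i)`_0.
Proof. by rewrite (Pd_split i) mulrDl mul1r coefD -scalerAl coefZ coefXM mulr0 addr0. Qed.

Lemma coef_PdS i l : Pd`_l.+1 = (Pdi i)`_l.+1 + d i * (Pdi i)`_l.
Proof. by rewrite (Pd_split i) mulrDl mul1r coefD -scalerAl coefZ coefXM. Qed.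

Lemma size_Pdi i : (size (Pdi i) <= n)%N.
Proof.
have H (r : seq 'I_n) : (size (\prod_(j <- r | j != i) (1 + d j *: 'X : {poly R}))%R <=
    (count (fun j => j != i) r).+1)%N.
  elim: r => [|j r IH]; first by rewrite big_nil size_poly1.
  rewrite big_cons /=; case: (j != i) => //=; rewrite add1n.
  apply: (leq_trans (size_polyMleq _ _)).
  have : (size (1 + d j *: 'X : {poly R})%R <= 2)%N.
    rewrite (leq_trans (size_polyD _ _))// geq_max size_poly1/=.
    by rewrite (leq_trans (size_scale_leq _ _))// size_polyX.
  by move=> H2; rewrite -subn1 leq_subLR add1n; exact: (leq_add H2 IH).
apply: (leq_trans (H _)).
have := count_predC (pred1 i) (index_enum 'I_n).
rewrite (count_uniq_mem _ (index_enum_uniq _)) mem_index_enum.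
have -> : size (index_enum 'I_n) = n by rewrite -[RHS]card_ord cardT enumT.
by move=> E; rewrite -[X in (_ < X)%N]E add1n ltnS; apply: sub_count => j.
Qed.

(** Let e_l(i) be the l-th elementary symmetric function of the d_j with j != i. It is a polynomial
    in d_i with coefficients independent of i, found by solving e_l = e_l(i) + d_i e_(l-1)(i)
    upwards from l = 0. After multiplication by a power of d_i the same recursion can be solved
    downwards from l = n, which is [dpoly]. *)
Fixpoint upoly (l : nat) : {poly R} :=
  if l is l'.+1 then (Pd`_l)%:P - 'X * upoly l' else (Pd`_0)%:P.

Fixpoint dpoly (j : nat) : {poly R} :=
  if j is j'.+1 then Pd`_(n - j') *: 'X^j' - dpoly j' else 0.

Lemma upolyE i l : (upoly l).[d i] = (Pdi i)`_l.
Proof.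
elim: l => [|l IH] /=; first by rewrite hornerC (coef_Pd0 i).
by rewrite !hornerE IH (coef_PdS i); ring.
Qed.

Lemma dpolyE i j : (j <= n)%N -> (dpoly j).[d i] = d i ^+ j * (Pdi i)`_(n - j).
Proof.
elim: j => [|j IH] jn /=.
  by rewrite horner0 subn0 nth_default ?mulr0// size_Pdi.
rewrite hornerD hornerN hornerZ hornerXn IH ?(ltnW jn)//.
rewrite -(subnSK jn) (coef_PdS i) exprS; ring.
Qed.

Lemma size_upoly l : (size (upoly l) <= l.+1)%N.
Proof.
elim: l => [|l IH] /=; first exact: size_polyC_leq1.
rewrite (leq_trans (size_polyD _ _))// geq_max size_polyN.
rewrite (leq_trans (size_polyC_leq1 _))//= (leq_trans (size_polyMleq _ _))//.
by rewrite size_polyX.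
Qed.

Lemma size_dpoly j : (size (dpoly j) <= j)%N.
Proof.
elim: j => [|j IH] /=; first by rewrite size_poly0.
rewrite (leq_trans (size_polyD _ _))// geq_max size_polyN (leq_trans IH)// andbT.
by rewrite (leq_trans (size_scale_leq _ _))// size_polyXn.
Qed.

Lemma coef_upoly0 l : (upoly l)`_0 = Pd`_l.
Proof. by case: l => [|l] /=; rewrite ?coefB coefC//= coefXM subr0. Qed.

(** 1/(1 + Y d_i) is the quotient of [Pdi i] by [Pd] at Y. The numbers to be interpolated are thus,
    up to the common denominator, values at d_i of one polynomial, and the sum is its coefficient of
    X^m provided its degree is below n. *)
Lemma lagr_resolvent (k : 'I_n) (Y : R) : (forall i, 1 + Y * d i != 0) ->
  \sum_i d i ^+ (n - k.+1) / (1 + Y * d i) * lagr i k =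
  (take_poly k.+1 Pd).[Y] / Pd.[Y].
Proof.
move=> Y0; set m := (n - k.+1)%N.
have kn := ltn_ord k.
have PY i : Pd.[Y] = (1 + Y * d i) * (Pdi i).[Y].
  by rewrite (Pd_split i) hornerM !hornerE [Y * _]mulrC.
have PY0 : Pd.[Y] != 0.
  rewrite /Pd horner_prod; apply/prodf_neq0 => i _.
  by rewrite !hornerE mulrC.
(* For l <= k the upward form has degree at most m + l < n, and its coefficient of X^m is the l-th
   coefficient of [Pd]. For l > k that degree may reach n; the downward form has degree below m and
   contributes nothing to X^m. *)
pose q := \sum_(l < n) Y ^+ l *:
  (if (l <= k)%N then 'X^m * upoly l else 'X^(m - (n - l)) * dpoly (n - l)).
have qE i : q.[d i] = d i ^+ m * (Pdi i).[Y].
  rewrite horner_sum (horner_coef_wide _ (size_Pdi i)) mulr_sumr.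
  apply: eq_bigr => l _; rewrite hornerZ; case: (leqP l k) => lk.
    by rewrite hornerM hornerXn upolyE; ring.
  have ln := ltn_ord l.
  have -> : d i ^+ m = d i ^+ (m - (n - l)) * d i ^+ (n - l).
    by rewrite -exprD subnK//; lia.
  rewrite hornerM hornerXn dpolyE ?leq_subr// subKn ?(ltnW ln)//; ring.
have sq : (size q <= n)%N.
  rewrite (leq_trans (size_sum _ _ _))//; apply/bigmax_leqP => l _.
  have ln := ltn_ord l.
  rewrite (leq_trans (size_scale_leq _ _))//; case: (leqP l k) => lk.
    rewrite (leq_trans (size_polyMleq _ _))// size_polyXn.
    by have := size_upoly l; lia.
  rewrite (leq_trans (size_polyMleq _ _))// size_polyXn.
  by have := size_dpoly (n - l); lia.
transitivity (\sum_i q.[d i] * lagr i k / Pd.[Y]).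
  apply: eq_bigr => i _; rewrite qE (PY i).
  have := PY0; rewrite (PY i) mulf_eq0 negb_or => /andP[h1 h2].
  by field; rewrite h1 h2.
rewrite -mulr_suml (lagr_poly k sq); congr (_ / _).
rewrite coef_sum (horner_coef_wide _ (size_take_poly _ _)).
transitivity (\sum_(l < n | (l <= k)%N) Pd`_l * Y ^+ l).
  rewrite [RHS]big_mkcond; apply: eq_bigr => l _; rewrite coefZ.
  have ln := ltn_ord l; case: (leqP l k) => lk.
    by rewrite coefXnM ltnn subnn coef_upoly0 mulrC.
  rewrite coefXnM -/m; case: ltnP => _; first by rewrite mulr0.
  rewrite nth_default ?mulr0//.
  by rewrite (leq_trans (size_dpoly _))//; lia.
rewrite (big_ord_widen_cond n xpredT (fun l => (take_poly k.+1 Pd)`_l * Y ^+ l))//.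
by apply: eq_big => // l lk; rewrite coef_take_poly ltnS lk.
Qed.

Lemma deriv_Pd : Pd^`() = \sum_i d i *: Pdi i.
Proof.
rewrite /Pd deriv_prod_seq ?index_enum_uniq//; apply: eq_bigr => i _.
by rewrite derivD derivC add0r derivZ derivX -mul_polyC mulr1 mul_polyC.
Qed.

Lemma drop_Pd i k : drop_poly k.+1 Pd =
  (1 + d i *: 'X) * drop_poly k.+1 (Pdi i) + (d i * (Pdi i)`_k)%:P.
Proof.
apply/polyP => j; rewrite coef_drop_poly coefD mulrDl mul1r coefD -scalerAl coefZ coefXM.
rewrite !coef_drop_poly coefC addnS (coef_PdS i).
case: j => [|j] /=; first by rewrite mulr0 addr0.
by rewrite addr0 addnS.
Qed.

(** The operator X d/dX multiplies the coefficient of X^(j+k+1) by j+k+1; after the shift this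
    splits into k+1 and j. *)
Lemma drop_deriv (p : {poly R}) k :
  k.+1%:R *: drop_poly k.+1 p + 'X * (drop_poly k.+1 p)^`() = drop_poly k.+1 ('X * p^`()).
Proof.
apply/polyP => j; rewrite coefD coefZ coefXM !coef_drop_poly coefXM addnS /=.
rewrite [RHS]coef_deriv -[RHS]mulr_natl; case: j => [|j] /=.
  by rewrite addr0 add0n.
by rewrite coef_deriv coef_drop_poly -[p`__ *+ j.+1]mulr_natl !addnS !addSn -mulrDl -natrD; congr (_%:R * _); lia.
Qed.

Lemma XderivPd : 'X * Pd^`() = \sum_i (Pd - Pdi i).
Proof.
rewrite deriv_Pd mulr_sumr; apply: eq_bigr => i _.
by rewrite {1}(Pd_split i) mulrDl mul1r addrC addrA addNr add0r -scalerAl scalerAr.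
Qed.

Lemma horner_Pd (Y : R) : Pd.[Y] = \prod_i (1 + Y * d i).
Proof. by rewrite /Pd horner_prod; apply: eq_bigr => i _; rewrite !hornerE mulrC. Qed.

Lemma Pd_neq0 (Y : R) : (forall i, 1 + Y * d i != 0) -> Pd.[Y] != 0.
Proof. by move=> Y0; rewrite horner_Pd; apply/prodf_neq0 => j _. Qed.

(** By [drop_Pd] the i-th summand is D(Y)/(1 + Y d_i) - D_i(Y), where D and D_i are the tails of
    [Pd] and [Pdi i]. Summing over i uses the logarithmic derivative, which makes Y Pd'/Pd the sum
    of the 1 - 1/(1 + Y d_i), together with its truncated form given by [drop_deriv]. *)
Lemma resolvent_sum k (Y : R) : (forall i, 1 + Y * d i != 0) ->
  \sum_i d i * (Pdi i)`_k / (1 + Y * d i) =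
  (k.+1%:R * (drop_poly k.+1 Pd).[Y] + Y * (drop_poly k.+1 Pd)^`().[Y]) -
  (drop_poly k.+1 Pd).[Y] * Y * Pd^`().[Y] / Pd.[Y].
Proof.
move=> Y0.
have E1 : k.+1%:R * (drop_poly k.+1 Pd).[Y] + Y * (drop_poly k.+1 Pd)^`().[Y] =
    \sum_i ((drop_poly k.+1 Pd).[Y] - (drop_poly k.+1 (Pdi i)).[Y]).
  have := congr1 (horner^~ Y) (drop_deriv Pd k).
  rewrite XderivPd hornerD hornerZ hornerM hornerX => ->.
  rewrite linear_sum horner_sum; apply: eq_bigr => i _.
  by rewrite linearB hornerD hornerN.
have E2 : Y * Pd^`().[Y] = \sum_i (Pd.[Y] - (Pdi i).[Y]).
  have := congr1 (horner^~ Y) XderivPd; rewrite hornerM hornerX => ->.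
  by rewrite horner_sum; apply: eq_bigr => i _; rewrite hornerD hornerN.
rewrite E1 -[_ * Y * _]mulrA E2 mulr_sumr mulr_suml -sumrB; apply: eq_bigr => i _.
have PY : Pd.[Y] = (1 + Y * d i) * (Pdi i).[Y].
  by rewrite (Pd_split i) hornerM !hornerE [Y * _]mulrC.
have DY : (drop_poly k.+1 Pd).[Y] =
    (1 + Y * d i) * (drop_poly k.+1 (Pdi i)).[Y] + d i * (Pdi i)`_k.
  by rewrite (drop_Pd i) !hornerE [Y * _]mulrC.
have PY0 : Pd.[Y] != 0 by apply: Pd_neq0.
move: PY0; rewrite DY PY mulf_eq0 negb_or => /andP[h1 h2].
by field; rewrite h1 h2.
Qed.

(* The n-1 averaged columns apply (1 + y d/dX)^(n-1), whose value at 0 is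
   [\sum_k om y k * p`_k]. *)
Definition om (y : R) (k : nat) : R := (n.-1)`!%:R / (n.-1 - k)`!%:R * y ^+ k.

Lemma omS y k : (k.+1 < n)%N -> om y k.+1 = y * (n.-1 - k)%:R * om y k.
Proof.
move=> kn; rewrite /om; have -> : (n.-1 - k = (n.-1 - k.+1).+1)%N by lia.
rewrite factS natrM exprS.
have h1 : ((n.-1 - k.+1)`!%:R : R) != 0 by rewrite pnatr_eq0 -lt0n fact_gt0.
have h2 : ((n.-1 - k.+1).+1%:R : R) != 0 by rewrite pnatr_eq0.
move: h1 h2; move: ((n.-1 - k.+1)`!%:R : R) ((n.-1 - k.+1).+1%:R : R) => p q h1 h2.
by field; rewrite h1 h2.
Qed.

(** The combination of tails of [Pd] through which both [kappa] and [tau_density] are expressed, see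
    [kappaE] and [tau_densityE]. *)
Definition Spoly (y : R) : {poly R} := \sum_(k < n) om y k *: drop_poly k.+1 Pd.

Lemma coef_drop k (Y : R) : (drop_poly k Pd).[Y] = Pd`_k + Y * (drop_poly k.+1 Pd).[Y].
Proof.
have -> : drop_poly k Pd = (Pd`_k)%:P + 'X * drop_poly k.+1 Pd.
  apply/polyP => j; rewrite coefD coefC coefXM !coef_drop_poly.
  by case: j => [|j] /=; rewrite ?addr0// add0r addSnnS.
by rewrite hornerD hornerC hornerM hornerX.
Qed.

(** Summation by parts: a coefficient of [Pd] is a difference of consecutive tails, and [omS] moves
    the weight by one index. Nothing is left at the end, because n.-1 - k is 0 at the last index. *)
Lemma sum_om_coef y (Y : R) : (0 < n)%N ->
  \sum_(k < n) om y k * Pd`_k = Pd.[Y] +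
    \sum_(k < n) (y * (n.-1 - k)%:R - Y) * om y k * (drop_poly k.+1 Pd).[Y].
Proof.
move=> n0; have E k : Pd`_k = (drop_poly k Pd).[Y] - Y * (drop_poly k.+1 Pd).[Y].
  by rewrite (coef_drop k) addrK.
under eq_bigr do rewrite E mulrBr.
rewrite big_split/= sumrN.
have -> : \sum_(k < n) om y k * (drop_poly k Pd).[Y] = Pd.[Y] +
    \sum_(k < n) y * (n.-1 - k)%:R * om y k * (drop_poly k.+1 Pd).[Y].
  have [m nE] : exists m, n = m.+1 by exists n.-1; rewrite prednK.
  have H1 : \sum_(k < n) om y k * (drop_poly k Pd).[Y] =
     \sum_(0 <= k < m.+1) om y k * (drop_poly k Pd).[Y] by rewrite nE big_mkord.
  have H2 : \sum_(k < n) y * (n.-1 - k)%:R * om y k * (drop_poly k.+1 Pd).[Y] =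
     \sum_(0 <= k < m.+1) y * (m - k)%:R * om y k * (drop_poly k.+1 Pd).[Y].
    by rewrite [in RHS]big_mkord nE.
  rewrite H1 H2 big_nat_recl// [in RHS]big_nat_recr//= subnn mulr0 !mul0r addr0.
  congr (_ + _).
    rewrite /om subn0 expr0 mulr1 divff ?mul1r ?pnatr_eq0 -?lt0n ?fact_gt0//.
    by congr (_.[_]); apply/polyP => j; rewrite coef_drop_poly addn0.
  rewrite !big_nat; apply: eq_bigr => k /andP[_ km].
  by rewrite omS ?nE.
rewrite -addrA -sumrB; congr (_ + _); apply: eq_bigr => k _; ring.
Qed.

(* The Gaussian integral over [H] for |v|^2 = r, see [gauss_kappa]. *)
Definition kappa (y r : R) : R := \sum_(k < n) om y k *
  ((Pd`_k + y * \sum_i d i * (Pdi i)`_k / (1 + y * r * d i)) / Pd.[y * r]).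

Lemma kappaE y r : (0 < n)%N -> (forall i, 1 + y * r * d i != 0) ->
  kappa y r = 1 + (y * n%:R - y * r) * (Spoly y).[y * r] / Pd.[y * r]
    + y * (y * r) * (Spoly y)^`().[y * r] / Pd.[y * r]
    - y * (y * r) * (Spoly y).[y * r] * Pd^`().[y * r] / Pd.[y * r] ^+ 2.
Proof.
move=> n0 Y0; rewrite /kappa; set Y := y * r.
have PY0 : Pd.[Y] != 0 by apply: Pd_neq0.
have SE : (Spoly y).[Y] = \sum_(k < n) om y k * (drop_poly k.+1 Pd).[Y].
  by rewrite horner_sum; apply: eq_bigr => k _; rewrite hornerZ.
have S'E : (Spoly y)^`().[Y] = \sum_(k < n) om y k * (drop_poly k.+1 Pd)^`().[Y].
  by rewrite /Spoly raddf_sum horner_sum; apply: eq_bigr => k _; rewrite /= derivZ hornerZ.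
under eq_bigr do rewrite resolvent_sum// [om _ _ * _]mulrA mulrDr.
rewrite -mulr_suml big_split/= (sum_om_coef _ Y n0) SE S'E.
move: PY0; set P := Pd.[Y]; set P' := _^`().[Y] => PY0.
transitivity ((P + \sum_(k < n) ((y * n%:R - Y) * (om y k * (drop_poly k.+1 Pd).[Y])
   + y * Y * (om y k * (drop_poly k.+1 Pd)^`().[Y]) - y * Y * P' / P * (om y k * (drop_poly k.+1 Pd).[Y]))) / P).
  congr (_ / _); rewrite -addrA -big_split/=; congr (_ + _); apply: eq_bigr => k _.
  (* The factor n-1-k from [sum_om_coef] and the factor k+1 from [resolvent_sum] add up to n, so
     that the dependence on k is carried by [Spoly] alone. *)
  have -> : n%:R = (n.-1 - k)%:R + k.+1%:R :> R.
    by rewrite -natrD; congr (_%:R); have := ltn_ord k; lia.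
  by field.
by rewrite !big_split sumrN/= -!mulr_sumr; field.
Qed.

End Interpolation.

(** * Integration by parts in the variable r = |v|^2 *)

Section KappaIntegral.
Variables (R : realType) (n : nat) (d : 'I_n -> R).
Hypotheses (n0 : (0 < n)%N) (d0 : forall i, 0 < d i).
Local Notation mu := (@lebesgue_measure R).
Local Notation half := (`[0%R, +oo[%classic : set R).

(** What Lagrange interpolation makes of the right-hand side of the theorem for f(x) = 1/(1 + yx),
    see [psi_res]. *)
Definition tau_density (y t : R) : R := \sum_(k < n) expR (- t) *
  (t ^+ (n - k.+1) / (n - k.+1)`!%:R * ((take_poly k.+1 (Pd d)).[y * t] / (Pd d).[y * t])).

Lemma Pd_ge1 (y t : R) : 0 < y -> 0 <= t -> 1 <= (Pd d).[y * t].
Proof.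
move=> y0 t0; rewrite horner_Pd -[leLHS](@big1_eq _ 1 *%R _ (index_enum 'I_n) xpredT) ler_prod// => i _.
by rewrite ler01 lerDl !mulr_ge0// ltW.
Qed.

(* [kpoly^`() - kpoly] is the polynomial part of the difference between the two
   integrands of [kappa_integral]. *)
Definition kpoly : {poly R} := - (n%:R / (n`!)%:R) *: gamma_poly 1 n +
  \sum_(k < n) ((n - k.+1)`!%:R)^-1 *: gamma_poly 1 (n - k.+1).

Lemma gamma_poly10 m : (gamma_poly 1 m).[0] = m`!%:R :> R.
Proof. by rewrite gamma_poly0 expr1n divr1. Qed.

Lemma kpoly0 : kpoly.[0] = 0.
Proof.
rewrite /kpoly hornerD hornerZ horner_sum gamma_poly10.
rewrite (eq_bigr (fun=> 1)) => [|k _]; last first.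
  by rewrite hornerZ gamma_poly10 mulVf// pnatr_eq0 -lt0n fact_gt0.
by rewrite sumr_const card_ord mulNr divfK ?addNr// pnatr_eq0 -lt0n fact_gt0.
Qed.

Lemma kpolyE (t : R) : (kpoly^`() - kpoly).[t] =
  n%:R / (n`!)%:R * t ^+ n - \sum_(k < n) t ^+ (n - k.+1) / (n - k.+1)`!%:R.
Proof.
have H m : (gamma_poly 1 m)^`() - gamma_poly 1 m = - 'X^m :> {poly R}.
  by rewrite -[in RHS](@gamma_polyE _ 1 m) ?oner_eq0// scale1r opprB.
have -> : kpoly^`() - kpoly = n%:R / (n`!)%:R *: 'X^n -
    \sum_(k < n) ((n - k.+1)`!%:R)^-1 *: 'X^(n - k.+1).
  rewrite /kpoly derivD derivZ raddf_sum/= opprD addrACA -scalerBr H.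
  rewrite scalerN scaleNr opprK; congr (_ + _).
  rewrite -sumrB -sumrN; apply: eq_bigr => k _.
  by rewrite derivZ -scalerBr H scalerN.
rewrite hornerD hornerN hornerZ hornerXn horner_sum; congr (_ - _).
by apply: eq_bigr => k _; rewrite hornerZ hornerXn mulrC.
Qed.

Lemma integrable_tau_density y : 0 < y -> mu.-integrable half (EFin \o tau_density y).
Proof.
move=> y0.
pose q := Pd d \Po (y *: 'X).
pose p := \sum_(k < n) ((n - k.+1)`!%:R)^-1 *: ('X^(n - k.+1) * (take_poly k.+1 (Pd d) \Po (y *: 'X))).
rewrite (_ : EFin \o _ = fun t => (p.[t] * expR (- t) / q.[t])%:E).
  apply: integrable_rat_expR => t t0.
  by rewrite horner_comp hornerZ hornerX Pd_ge1.
apply/funext => t /=; congr EFin; rewrite /p horner_sum !mulr_suml.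
apply: eq_bigr => k _; rewrite hornerZ hornerM hornerXn !horner_comp hornerZ hornerX.
by ring.
Qed.

(** The head of [Pd] is [Pd] minus its tail; in the tail, y^(k+1) and the factorial combine into the
    weight [om y k]. *)
Lemma tau_densityE (y t : R) : 0 < y -> 0 <= t -> tau_density y t = expR (- t) *
  (\sum_(k < n) t ^+ (n - k.+1) / (n - k.+1)`!%:R -
    n%:R / n`!%:R * t ^+ n * (y * (Spoly d y).[y * t] / (Pd d).[y * t])).
Proof.
move=> y0 t0; have P0 : (Pd d).[y * t] != 0.
  by apply: lt0r_neq0; apply: lt_le_trans (Pd_ge1 y0 t0).
rewrite /tau_density /Spoly horner_sum mulr_sumr mulr_suml mulr_sumr -sumrB mulr_sumr.
apply: eq_bigr => k _; congr (_ * _).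
have -> : (take_poly k.+1 (Pd d)).[y * t] =
    (Pd d).[y * t] - (drop_poly k.+1 (Pd d)).[y * t] * (y * t) ^+ k.+1.
  by rewrite -{2}(poly_take_drop k.+1 (Pd d)) hornerD hornerM hornerXn addrK.
have kn := ltn_ord k; have -> : (n - k.+1 = n.-1 - k)%N by lia.
have f1 : (n`!%:R : R) = n%:R * (n.-1)`!%:R by rewrite -natrM -{1}(prednK n0) factS prednK.
have n1 : n%:R != 0 :> R by rewrite pnatr_eq0 -lt0n.
have f2 m : m`!%:R != 0 :> R by rewrite pnatr_eq0 -lt0n fact_gt0.
rewrite hornerZ f1 /om; have -> : t ^+ n = t ^+ (n.-1 - k) * t ^+ k.+1.
  by rewrite -exprD; congr (_ ^+ _); lia.
rewrite !exprMn exprS.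
move: (f2 n.-1) (f2 (n.-1 - k)%N); move: (_`!%:R : R) ((n.-1 - k)`!%:R : R) => a b a0 b0.
by field; rewrite b0 P0 n1 a0.
Qed.

(** n t^n exp(-t)/n! is t times the density of |v|^2, the extra t being the factor |v|^2 under the
    expectation. The two integrands differ by the derivative of exp(-t)p/q, which vanishes at 0 and
    at infinity. *)
Lemma kappa_integral (y : R) : 0 < y ->
  (\int[mu]_(t in half) (n%:R / n`!%:R * t ^+ n * expR (- t) * kappa d y t)%:E =
   \int[mu]_(t in half) (tau_density y t)%:E)%E.
Proof.
move=> y0.
pose q := Pd d \Po (y *: 'X).
(* In p/q the first term produces the derivatives of [Spoly] and [Pd] that occur in [kappaE], the
   second one the terms that are polynomial in t. *)
pose p := (n%:R / n`!%:R * y) *: ('X^(n.+1) * (Spoly d y \Po (y *: 'X))) + kpoly * q.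
have q1 t : 0 <= t -> 1 <= q.[t].
  by move=> t0; rewrite horner_comp hornerZ hornerX Pd_ge1.
have q2 t : 0 <= t -> 1 <= (q ^+ 2).[t].
  by move=> t0; rewrite horner_exp exprn_ege1// q1.
pose h (t : R) := ((p^`() - p) * q - p * q^`()).[t] * expR (- t) / (q ^+ 2).[t].
have ih : mu.-integrable half (EFin \o h) by exact: integrable_rat_expR.
have h0 : (\int[mu]_(t in half) (h t)%:E = 0)%E.
  rewrite -[LHS]fineK; last exact: integrable_fin_num.
  congr EFin; rewrite -[LHS]/(\int[mu]_(t in half) h t)%R integral_derive_rat_expR//.
  rewrite /p hornerD hornerZ !hornerM hornerXn kpoly0.
  by rewrite expr0n/= !(mul0r, mulr0) addr0 mul0r oppr0.
rewrite -[RHS]adde0 -h0 -integralD//=; last by exact: integrable_tau_density.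
apply: eq_integral => t /set_mem/=; rewrite in_itv/= andbT => t0.
rewrite -EFinD; congr EFin.
have Y0 i : 1 + y * t * d i != 0.
  by apply: lt0r_neq0; rewrite (lt_le_trans ltr01)// lerDl !mulr_ge0// ltW.
rewrite kappaE// tau_densityE//.
have P0 : (Pd d).[y * t] != 0 by apply: Pd_neq0.
have kE := kpolyE t; rewrite /h.
have -> : ((p^`() - p) * q - p * q^`()).[t] = (n%:R / n`!%:R * y) *
   ((n.+1%:R * t ^+ n * (Spoly d y).[y * t] + t ^+ n.+1 * y * (Spoly d y)^`().[y * t]
      - t ^+ n.+1 * (Spoly d y).[y * t]) * (Pd d).[y * t]
     - t ^+ n.+1 * (Spoly d y).[y * t] * y * (Pd d)^`().[y * t])
  + (kpoly^`() - kpoly).[t] * (Pd d).[y * t] ^+ 2.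
  rewrite /p derivD derivZ !derivM derivXn !deriv_comp derivZ derivX.
  rewrite !(hornerD, hornerN, hornerM, hornerZ, hornerXn, horner_comp, hornerMn, hornerX, hornerC).
  ring.
rewrite kE horner_exp horner_comp hornerZ hornerX -natr1 (exprS (t : R)).
move: P0; move: (_.[_]) (_^`().[_]) (_.[_]) (_^`().[_]) (expR _) (\sum_(k < n) _) (_ / _) => a b c e f g k P0.
by field.
Qed.

End KappaIntegral.

(** * The law of a sum of squares *)

Section RealContinuity.
Variable R : realType.
Implicit Types f g : R -> R.

Lemma continuousM_real f g : continuous f -> continuous g -> continuous (fun t => f t * g t).
Proof. by move=> cf cg t; apply: cvgM; [exact: cf|exact: cg]. Qed.

Lemma continuous_comp_real f g : continuous f -> continuous g -> continuous (fun t => g (f t)).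
Proof. by move=> cf cg t; exact: (continuous_comp (cf t) (cg (f t))). Qed.

Lemma continuous_scale_real (a : R) : continuous (fun t : R => t * a).
Proof. by move=> t; apply: cvgM; [exact: cvg_id|exact: cvg_cst]. Qed.

Lemma continuous_expRN : continuous (fun t : R => expR (- t)).
Proof. by move=> t; apply: continuous_comp; [apply: cvgN; exact: cvg_id|exact: continuous_expR]. Qed.

End RealContinuity.

Section Radial.
Variable R : realType.
Local Notation mu := (@lebesgue_measure R).
Local Notation half := (`[0%R, +oo[%classic : set R).
Local Notation points := (points R).

Definition cutoff (N t : R) : R := Num.max 0 (Num.min 1 (N - t)).

Lemma cutoff_ge0 N t : 0 <= cutoff N t.
Proof. by rewrite le_max lexx. Qed.

Lemma cutoff_le N M t : N <= M -> cutoff N t <= cutoff M t.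
Proof.
move=> NM; rewrite ge_max !le_max lexx /=; apply/orP; right.
by rewrite le_min !ge_min lexx/= lerD ?orbT.
Qed.

Lemma cutoff1 N t : t + 1 <= N -> cutoff N t = 1.
Proof.
by move=> tN; rewrite /cutoff min_l ?max_r ?ler01// lerBrDr addrC.
Qed.

Lemma cutoff0 N t : N <= t -> cutoff N t = 0.
Proof.
by move=> tN; rewrite /cutoff max_l// ge_min subr_le0 tN orbT.
Qed.

Lemma continuous_cutoff N : continuous (cutoff N).
Proof.
move=> t.
have c1 : {for t, continuous (cst 1 : R -> R^o)} by exact: cst_continuous.
have c0 : {for t, continuous (cst 0 : R -> R^o)} by exact: cst_continuous.
have cN : {for t, continuous (fun t : R => N - t : R^o)}.
  by apply: cvgB; [exact: cvg_cst|exact: cvg_id].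
exact: (continuous_max c0 (continuous_min c1 cN)).
Qed.

Lemma cvg_cutoff (t : R) : (fun N : nat => cutoff N%:R t) @ \oo --> (1 : R).
Proof.
apply: cvg_near_cst; near=> N; apply: cutoff1.
by near: N; exact: nbhs_infty_ger.
Unshelve. all: by end_near. Qed.

Lemma bcont_cutoff (f : R -> R) (N : R) : continuous f -> bcont (fun t : R => f t * cutoff N t).
Proof.
move=> cf; have cg : continuous (fun t : R => f t * cutoff N t).
  by move=> t; apply: cvgM; [exact: cf|exact: continuous_cutoff].
split=> //; have [M [_ Mf]] := compact_bounded (continuous_compact
  (continuous_subspaceT cg) (@segment_compact _ 0 (N : R))).
exists (`|M| + 1) => t t0; case: (lerP t N) => tN; last first.
  by rewrite cutoff0 ?mulr0 ?normr0 ?addr_ge0// ltW.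
apply: Mf; first by rewrite (le_lt_trans (ler_norm M))// ltrDl.
by exists t => //; rewrite /= in_itv/= t0.
Qed.

Definition depends (P : pred nat) (T : Type) (F : points -> T) :=
  forall x y : points, (forall k, P k -> x k = y k) -> F x = F y.

Lemma depends_int_coords w s (P : pred nat) (F : points -> \bar R) : depends P F ->
  depends [pred k | P k && (k \notin s)] (int_coords w s F).
Proof.
move=> dF; elim: s => [|k s IH] x y xy; first by apply: dF => l Pl; apply: xy; rewrite /= Pl.
rewrite /= /int_coord; apply: eq_integral => t _; congr (_ * _)%E.
apply: IH => l /andP[Pl ls]; rewrite /upd; case: eqVneq => // lk.
by apply: xy; rewrite /= Pl inE negb_or lk ls.
Qed.

Lemma depends_int_coords_cst w (s : seq nat) (F : points -> \bar R) x y : depends (fun k => k \in s) F ->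
  int_coords w s F x = int_coords w s F y.
Proof. move=> dF; have := @depends_int_coords w s _ F dF; apply => k /andP[/= ks].
by rewrite ks. Qed.

Definition sumsq (s : seq nat) (x : points) : R := \sum_(k <- s) x k ^+ 2.

Lemma sumsq_ge0 s x : 0 <= sumsq s x.
Proof. by apply: sumr_ge0 => k _; exact: sqr_ge0. Qed.

Lemma measurable_sumsq s : measurable_fun setT (sumsq s).
Proof.
apply: measurable_sum => k; apply: measurable_funX; exact: measurable_coord.
Qed.

Lemma integral_gauss_expR (c : R) : 0 <= c ->
  (\int[mu]_t (gauss t * expR (- (c * t ^+ 2)))%:E = ((Num.sqrt (1 + c))^-1)%:E)%E.
Proof.
move=> c0; have c1 : 0 < 1 + c by rewrite ltr_wpDr.
have a0 : 0 < Num.sqrt (1 + c) by rewrite sqrtr_gt0.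
have := @integral_affine R (Num.sqrt (1 + c)) 0 (EFin \o @gauss R) (lt0r_neq0 a0).
have wg := weight_gauss R.
rewrite /= integral_gauss mule1 (gtr0_norm a0) => <-.
- apply: eq_integral => t _; rewrite /gauss addr0 exprMn sqr_sqrtr ?(ltW c1)//.
  by rewrite -mulrA -expRD; congr (_ * expR _)%:E; ring.
- by apply/measurable_EFinP; exact: wg.1.
- by move=> t; rewrite lee_fin; exact: wg.2.
Qed.

Section Law.
Variables (n : nat) (s : seq nat).
Hypotheses (n0 : (0 < n)%N) (us : uniq s) (sn : size s = n.*2).

(** The Gamma density of shape n, which is the law of a sum of 2n squares of [gauss] variables. *)
Definition chi_density (t : R) : R := t ^+ n.-1 / (n.-1)`!%:R * expR (- t).

Lemma chi_density_ge0 t : 0 <= t -> 0 <= chi_density t.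
Proof. by move=> t0; rewrite !mulr_ge0 ?exprn_ge0 ?expR_ge0 ?invr_ge0. Qed.

Lemma chi_integral_expR (k : nat) :
  (\int[mu]_(t in half) (expR (- t) ^+ k * chi_density t)%:E = ((k.+1%:R ^+ n)^-1)%:E)%E.
Proof.
have k0 : 0 < k.+1%:R :> R by rewrite ltr0n.
have f0 : 0 < (n.-1)`!%:R :> R by rewrite ltr0n fact_gt0.
transitivity ((n.-1)`!%:R^-1%:E * \int[mu]_(t in half) (t ^+ n.-1 * expR (- (k.+1%:R * t)))%:E)%E.
  rewrite -ge0_integralZl; first last.
  - by rewrite lee_fin invr_ge0 ltW.
  - move=> t; rewrite /= in_itv/= andbT => t0.
    by rewrite lee_fin mulr_ge0 ?exprn_ge0 ?expR_ge0.
  - apply/measurable_EFinP; apply: measurable_funTS.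
    apply: continuous_measurable_fun => t.
    under eq_fun do rewrite -hornerXn; exact: continuous_poly_expRM.
  - exact: measurable_itv.
  apply: eq_integral => t _; rewrite -EFinM; congr EFin.
  rewrite -expRM_natl /chi_density -natr1 mulrDl mul1r opprD expRD mulrN.
  by field; rewrite lt0r_neq0.
rewrite gamma_integral// -EFinM prednK//; congr EFin.
by field; rewrite ?expf_neq0 ?lt0r_neq0.
Qed.

Lemma integrable_chi (f : R -> R) : bcont f ->
  mu.-integrable half (EFin \o (fun t => f t * chi_density t)).
Proof.
move=> [cf [B fB]].
have E t : chi_density t = ((n.-1)`!%:R^-1 *: 'X^(n.-1)).[t] * expR (- (1 * t)).
  by rewrite hornerZ hornerXn mul1r /chi_density [X in X * _]mulrC.
apply: (@integrable_dominated _ _ (fun t => (B *: ((n.-1)`!%:R^-1 *: 'X^(n.-1))).[t] * expR (- (1 * t)))).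
- move=> t t0; apply: cvgM; first exact: cf.
  by move/funext: E => ->; exact: continuous_poly_expRM.
- move=> t t0; rewrite [(B *: _).[t]]hornerZ -mulrA -E normrM.
  by rewrite (ger0_norm (chi_density_ge0 t0)) ler_wpM2r ?chi_density_ge0// fB.
- exact: integrable_poly_expRM.
Qed.

Lemma integrable_sumsq (f : R -> R) : bcont f ->
  (gausspt s).-integrable setT (EFin \o (f \o sumsq s)).
Proof.
move=> [cf [B fB]].
apply: (@le_integrable _ _ _ (gausspt s) _ measurableT _ (cst B%:E)).
- apply/measurable_EFinP; apply: measurableT_comp (measurable_sumsq s).
  exact: continuous_measurable_fun.
- move=> x _ /=; rewrite lee_fin (le_trans (fB _ (sumsq_ge0 s x)))//; exact: ler_norm.
- exact: finite_measure_integrable_cst.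
Qed.

Lemma gauss_sumsq_expR (k : nat) :
  (\int[gausspt s]_x (expR (- sumsq s x) ^+ k)%:E = ((k.+1%:R ^+ n)^-1)%:E)%E.
Proof.
have k0 : 0 <= k%:R :> R by rewrite ler0n.
have mk (l : nat) : measurable_fun setT (fun t : R => expR (- (k%:R * t ^+ 2))).
  apply: continuous_measurable_fun => t; apply: continuous_comp; last exact: continuous_expR.
  apply: cvgN; apply: cvgM; first exact: cvg_cst.
  exact: exprn_continuous.
have E (x : points) : expR (- sumsq s x) ^+ k = \prod_(l <- s) expR (- (k%:R * x l ^+ 2)).
  by rewrite -expRM_natl /sumsq mulrN mulr_sumr -sumrN expR_sum.
rewrite integral_gausspt; last first.
  apply: posm_EFin => [|x]; last by rewrite exprn_ge0// expR_ge0.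
  apply: measurable_funX; apply: measurableT_comp; first exact: measurable_expR.
  by apply: measurable_funN; exact: measurable_sumsq.
rewrite (_ : (fun x => _) = fun x : points => (\prod_(l <- s) expR (- (k%:R * x l ^+ 2)))%:E); last first.
  by apply/funext => x; rewrite E.
rewrite (int_coords_gauss_prod (c := fun=> (Num.sqrt (1 + k%:R))^-1) us mk).
- congr EFin; rewrite /= big_const_seq count_predT sn iter_mulr_1.
  by rewrite -mul2n exprM exprVn sqr_sqrtr ?addr_ge0// exprVn addrC natr1.
- by move=> l t; exact: expR_ge0.
- by move=> l _; exact: integral_gauss_expR.
Qed.

(** No polar coordinates: both laws have Laplace transform (k+1)^-n at every natural number k, that
    is, the same moments in the variable u = exp(-t), and [functional_density] applies. The constant
    2 is the sum of the two total masses. *)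
Lemma law_sumsq_cutoff (f : R -> R) : bcont f -> (exists N : R, forall t : R, N <= t -> f t = 0) ->
  (\int[gausspt s]_x f (sumsq s x) = \int[mu]_(t in half) (f t * chi_density t))%R.
Proof.
move=> [cf _] fN; apply/eqP; rewrite -subr_eq0; apply/eqP.
pose L (f : R -> R) := (\int[gausspt s]_x f (sumsq s x) -
  \int[mu]_(t in half) (f t * chi_density t))%R.
have bcst (c : R) : bcont (fun=> c).
  split; first by move=> t; exact: cvg_cst.
  by exists `|c|.
apply: (@functional_density R L 2 (fun t => expR (- t)) (fun t => - ln t)) => //.
- move=> a g h bg bh; rewrite /L.
  have bag : bcont (fun t => a * g t).
    by have := bcont_lin a bg (bcst 0); under eq_fun do rewrite addr0.
  have iag := integrable_sumsq bag; have jag := integrable_chi bag.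
  have ig := integrable_sumsq bg; have ih := integrable_sumsq bh.
  have jg := integrable_chi bg; have jh := integrable_chi bh.
  have -> : (\int[gausspt s]_x (a * g (sumsq s x) + h (sumsq s x)) =
    a * \int[gausspt s]_x g (sumsq s x) + \int[gausspt s]_x h (sumsq s x))%R.
    rewrite (RintegralD measurableT (f1 := fun x => a * g (sumsq s x)))//.
    by congr (_ + _); exact: RintegralZl.
  have -> : (\int[mu]_(t in half) ((a * g t + h t) * chi_density t) =
    a * \int[mu]_(t in half) (g t * chi_density t) + \int[mu]_(t in half) (h t * chi_density t))%R.
    have mH : measurable half by exact: measurable_itv.
    under eq_Rintegral do rewrite mulrDl.
    rewrite RintegralD//; congr (_ + _).
    by under eq_Rintegral do rewrite -mulrA; exact: RintegralZl.
  by ring.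
- move=> g B bg gB.
  have ig := integrable_sumsq bg; have jg := integrable_chi bg.
  have jB := integrable_chi (bcst B).
  rewrite /L (le_trans (ler_normB _ _))// mulr_natl mulr2n lerD//.
    apply: (le_trans (le_normr_Rintegral measurableT ig)).
    apply: (@le_trans _ _ (\int[gausspt s]_x B)%R).
      apply: le_Rintegral => //; first exact: integrable_norm.
        exact: finite_measure_integrable_cst.
      by move=> x _; apply: gB; exact: sumsq_ge0.
    rewrite /Rintegral -[X in fine X]/(\int[gausspt s]_x (cst B%:E) x)%E integral_cst//.
    by rewrite -[X in (_ * X)%E]/(gausspt s setT) probability_setT mule1.
  have mH : measurable half by exact: measurable_itv.
  apply: (@le_trans _ _ (\int[mu]_(t in half) `|g t * chi_density t|)%R).
    by apply: le_normr_Rintegral jg; exact: measurable_itv.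
  apply: (@le_trans _ _ (\int[mu]_(t in half) (B * chi_density t))%R).
    apply: le_Rintegral => //; first exact: integrable_norm.
    move=> t; rewrite /= in_itv/= andbT => t0.
    rewrite normrM (ger0_norm (chi_density_ge0 t0)).
    by rewrite ler_wpM2r ?chi_density_ge0// gB.
  rewrite RintegralZl//; last first.
    have := integrable_chi (bcst 1); congr (integrable _ _ _).
    by apply/funext => t /=; rewrite mul1r.
  have := chi_integral_expR 0; under eq_integral do rewrite expr0 mul1r.
  by rewrite /Rintegral => ->/=; rewrite expr1n invr1 mulr1.
- by move=> t; apply: continuous_comp; [apply: cvgN; exact: cvg_id|exact: continuous_expR].
- by move=> t t0; rewrite expR_gt0 -[leRHS]expR0 ler_expR oppr_le0.
- by move=> t t0; rewrite expRK opprK.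
- by move=> t t0; apply: cvgN; exact: continuous_ln.
- move=> N; exists (expR (- N)); first exact: expR_gt0.
  move=> t /andP[t0 tN]; rewrite lerNr -(expRK (- N)) ler_ln ?posrE ?expR_gt0//.
  exact: ltW.
- move=> k; rewrite /L /Rintegral gauss_sumsq_expR chi_integral_expR.
  by rewrite subrr.
Qed.

Lemma int_coords_gauss_sumsq (f : R -> R) (x : points) : continuous f -> (forall t, 0 <= t -> 0 <= f t) ->
  int_coords (@gauss R) s (fun x => (f (sumsq s x))%:E) x =
  (\int[mu]_(t in half) (f t * chi_density t)%:E)%E.
Proof.
move=> cf f0.
pose g (N : nat) (t : R) := f t * cutoff N%:R t.
have cg N : continuous (g N).
  by move=> t; apply: cvgM; [exact: cf|exact: continuous_cutoff].
have g0 N t : 0 <= t -> 0 <= g N t by move=> t0; rewrite mulr_ge0 ?f0 ?cutoff_ge0.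
have gN N : forall t : R, N%:R <= t -> g N t = 0.
  by move=> t Nt; rewrite /g cutoff0// mulr0.
have gle N M t : 0 <= t -> (N <= M)%N -> g N t <= g M t.
  by move=> t0 NM; rewrite ler_wpM2l ?f0// cutoff_le// ler_nat.
have gcvg t : (fun N => g N t) @ \oo --> f t.
  by rewrite -[f t]mulr1; apply: cvgM; [exact: cvg_cst|exact: cvg_cutoff].
have bg N : bcont (g N) by exact: bcont_cutoff.
have pg N : posm (fun x => (g N (sumsq s x))%:E).
  apply: posm_EFin => [|y]; last by rewrite g0// sumsq_ge0.
  by apply: measurableT_comp (measurable_sumsq s); exact: continuous_measurable_fun.
have wg := weight_gauss R.
have pf : posm (fun x => (f (sumsq s x))%:E).
  apply: posm_EFin => [|y]; last by rewrite f0// sumsq_ge0.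
  by apply: measurableT_comp (measurable_sumsq s); exact: continuous_measurable_fun.
have ndg y : nondecreasing_seq (fun N => (g N (sumsq s y))%:E).
  by move=> N M NM; rewrite lee_fin gle// sumsq_ge0.
have cvg1 y : (fun N => (g N (sumsq s y))%:E) @ \oo --> (f (sumsq s y))%:E.
  by apply: cvg_EFin; [exact: nearW|exact: gcvg].
have H1 := @int_coords_monotone R (@gauss R) s (fun N y => (g N (sumsq s y))%:E) (fun y => (f (sumsq s y))%:E) wg pg ndg cvg1 x.
have mH : measurable half by exact: measurable_itv.
have mden : measurable_fun half chi_density.
  apply: measurable_funTS; apply: measurable_funM.
    by apply: measurable_funM => //; exact: measurable_funX.
  by apply: measurableT_comp; [exact: measurable_expR|exact: measurable_funN].
have H2 : (fun N => \int[mu]_(t in half) (g N t * chi_density t)%:E)%E @ \oo -->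
    (\int[mu]_(t in half) (f t * chi_density t)%:E)%E.
  have -> : (\int[mu]_(t in half) (f t * chi_density t)%:E =
      \int[mu]_(t in half) limn (fun N => (g N t * chi_density t)%:E))%E.
    apply: eq_integral => t _; apply/esym/cvg_lim => //.
    apply: cvg_EFin; first exact: nearW.
    by apply: cvgM; [exact: gcvg|exact: cvg_cst].
  apply: cvg_monotone_convergence => //.
  - move=> N; apply/measurable_EFinP; apply: measurable_funM => //.
    by apply: measurable_funTS; exact: continuous_measurable_fun.
  - move=> N t; rewrite /= in_itv/= andbT => t0.
    by rewrite lee_fin mulr_ge0 ?g0 ?chi_density_ge0.
  - move=> t; rewrite /= in_itv/= andbT => t0 N M NM.
    by rewrite lee_fin ler_wpM2r ?gle ?chi_density_ge0.
rewrite -(cvg_lim _ H1)// -(cvg_lim _ H2)//; congr (limn _); apply/funext => N.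
(* Only the coordinates in [s] matter, so the base point can be moved to 0, the one used by
   [gausspt]. *)
rewrite (@depends_int_coords_cst _ _ _ x (fun=> 0)); last first.
  by move=> y z yz; congr (_ _)%:E; apply: eq_big_seq => k ks; rewrite yz.
rewrite -integral_gausspt//.
rewrite -[LHS]fineK; last exact: (integrable_fin_num measurableT (integrable_sumsq (bg N))).
rewrite -[RHS]fineK; last first.
  by have H := integrable_chi (bg N); apply: (integrable_fin_num _ H); exact: measurable_itv.
congr EFin; exact: (law_sumsq_cutoff (bg N) (ex_intro _ (N%:R : R) (gN N))).
Qed.

End Law.
End Radial.

(** * Hermitian matrices *)

Section MatrixDeterminantLemma.

(** One block matrix factors both as lower times upper and as upper times lower triangular. *)
Lemma det1D_mulmxC (K : comNzRingType) m n (A : 'M[K]_(m, n)) (B : 'M[K]_(n, m)) :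
  \det (1%:M + A *m B) = \det (1%:M + B *m A).
Proof.
have E1 : block_mx 1%:M (- A) B 1%:M =
    block_mx 1%:M 0 B 1%:M *m block_mx 1%:M (- A) 0 (1%:M + B *m A).
  rewrite mulmx_block !(mul1mx, mul0mx, mulmx0, mulmx1, addr0, add0r).
  by rewrite mulmxN addrCA addNr addr0.
have E2 : block_mx 1%:M (- A) B 1%:M =
    block_mx (1%:M + A *m B) (- A) 0 1%:M *m block_mx 1%:M 0 B 1%:M.
  rewrite mulmx_block !(mul1mx, mul0mx, mulmx0, mulmx1, addr0, add0r).
  by rewrite mulNmx addrK.
have := congr1 determinant E1; rewrite {1}E2 !det_mulmx !det_ublock !det_lblock.
by rewrite !det1 !mul1r !mulr1.
Qed.

Lemma det_diagD_field (K : fieldType) n (a : 'I_n -> K) (u v : 'I_n -> K) :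
  (forall i, a i != 0) ->
  \det (diag_mx (\row_i a i) + (\col_i u i) *m (\row_i v i)) =
  \prod_i a i + \sum_i u i * v i * \prod_(j | j != i) a j.
Proof.
move=> a0; pose D := diag_mx (\row_i a i).
have DE : D *m (\col_i (u i / a i)) = \col_i u i.
  apply/colP => i; rewrite mul_diag_mx !mxE mulrC divfK//.
rewrite -DE -mulmxA -[X in X + _]mulmx1 -mulmxDr det_mulmx det1D_mulmxC det_diag.
rewrite (eq_bigr a) => [|i _]; last by rewrite mxE.
rewrite det_mx11 !mxE mulrDr mulr1; congr (_ + _); rewrite mulr_sumr.
apply: eq_bigr => i _; rewrite !mxE (bigD1 i)//=.
by move: (\prod_(_ < _ | _) _) => p; field.
Qed.

(** Meant for the polynomial entries X + a_i, which are nonzero but not invertible: the identity is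
    checked in the fraction field. *)
Lemma det_diagD (K : idomainType) n (a : 'I_n -> K) (u v : 'I_n -> K) :
  (forall i, a i != 0) ->
  \det (diag_mx (\row_i a i) + (\col_i u i) *m (\row_i v i)) =
  \prod_i a i + \sum_i u i * v i * \prod_(j | j != i) a j.
Proof.
move=> a0; apply/eqP; rewrite -tofrac_eq; apply/eqP.
rewrite -det_map_mx map_mxD map_mxM rmorphD rmorph_sum/= rmorph_prod/=.
have -> : map_mx (@tofrac K) (diag_mx (\row_i a i)) = diag_mx (\row_i tofrac (a i)).
  by rewrite map_diag_mx; congr diag_mx; apply/rowP => i; rewrite !mxE.
have -> : map_mx (@tofrac K) (\col_i u i) = \col_i tofrac (u i).
  by apply/colP => i; rewrite !mxE.
have -> : map_mx (@tofrac K) (\row_i v i) = \row_i tofrac (v i).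
  by apply/rowP => i; rewrite !mxE.
rewrite det_diagD_field => [|i]; last by rewrite tofrac_eq0.
congr (_ + _); apply: eq_bigr => i _.
by rewrite !rmorphM rmorph_prod.
Qed.

End MatrixDeterminantLemma.

Definition ctr (R : realType) m n (A : 'M[R[i]]_(m, n)) : 'M[R[i]]_(n, m) :=
  map_mx Num.conj (A^T).

Notation "A ^H" := (ctr A) (at level 8, format "A ^H").

Section Hermitian.
Variable R : realType.
Local Notation C := R[i].

Definition nsq (z : C) : R := complex.Re z ^+ 2 + complex.Im z ^+ 2.

Lemma nsq_ge0 z : 0 <= nsq z.
Proof. by rewrite addr_ge0 ?sqr_ge0. Qed.

Lemma nsqE z : ((nsq z)%:C)%C = z^* * z.
Proof. by rewrite add_Re2_Im2 normCK mulrC. Qed.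

Definition psd n (M : 'M[C]_n) :=
  M^H = M /\ forall v : 'cV[C]_n, 0 <= (v^H *m M *m v) 0 0.

Lemma ctrE m n (A : 'M[C]_(m, n)) i j : A^H i j = (A j i)^*.
Proof. by rewrite !mxE. Qed.

Lemma ctrM m n p (A : 'M[C]_(m, n)) (B : 'M[C]_(n, p)) : (A *m B)^H = B^H *m A^H.
Proof. by rewrite /ctr trmx_mul map_mxM. Qed.

Lemma ctrK m n (A : 'M[C]_(m, n)) : A^H^H = A.
Proof. by apply/matrixP => i j; rewrite !ctrE conjCK. Qed.

Lemma ctrD m n (A B : 'M[C]_(m, n)) : (A + B)^H = A^H + B^H.
Proof. by rewrite /ctr linearD map_mxD. Qed.

Lemma ctrZ m n c (A : 'M[C]_(m, n)) : (c *: A)^H = c^* *: A^H.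
Proof. by rewrite /ctr linearZ/= map_mxZ. Qed.

Lemma ctr_diag n (a : 'I_n -> R) :
  (diag_mx (\row_i ((a i)%:C)%C))^H = diag_mx (\row_i ((a i)%:C)%C) :> 'M[C]_n.
Proof.
rewrite /ctr tr_diag_mx map_diag_mx; congr diag_mx; apply/rowP => i; rewrite !mxE.
exact: conjc_real.
Qed.

Lemma unitarymx_ctr n (P : 'M[C]_n) : P \is unitarymx -> P *m P^H = 1%:M /\ P^H *m P = 1%:M.
Proof.
move=> /unitarymxP Pu; have P1 : P *m P^H = 1%:M by exact: Pu.
by split => //; exact: mulmx1C.
Qed.

Lemma nsq_sum n (v : 'cV[C]_n) : (v^H *m v) 0 0 = ((\sum_i nsq (v i 0))%:C)%C.
Proof. by rewrite mxE rmorph_sum/=; apply: eq_bigr => i _; rewrite ctrE nsqE. Qed.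

Lemma nsq_sum_diag n (a : 'I_n -> R) (v : 'cV[C]_n) :
  (v^H *m diag_mx (\row_i ((a i)%:C)%C) *m v) 0 0 = ((\sum_i a i * nsq (v i 0))%:C)%C.
Proof.
rewrite -mulmxA mul_diag_mx mxE rmorph_sum/=; apply: eq_bigr => i _.
by rewrite ctrE !mxE rmorphM/= nsqE; ring.
Qed.

Lemma psd_diag n (a : 'I_n -> R) : (forall i, 0 <= a i) -> psd (diag_mx (\row_i ((a i)%:C)%C)).
Proof.
move=> a0; split; first exact: ctr_diag.
move=> v; rewrite nsq_sum_diag ler0c sumr_ge0// => i _.
by rewrite mulr_ge0// nsq_ge0.
Qed.

Lemma psdD n (A B : 'M[C]_n) : psd A -> psd B -> psd (A + B).
Proof.
move=> [hA pA] [hB pB]; split; first by rewrite ctrD hA hB.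
by move=> v; rewrite mulmxDr mulmxDl mxE addr_ge0.
Qed.

Lemma psd_congr m n (X : 'M[C]_(m, n)) (A : 'M[C]_m) : psd A -> psd (X^H *m A *m X).
Proof.
move=> [hA pA]; split; first by rewrite !ctrM ctrK hA mulmxA.
by move=> v; have := pA (X *m v); rewrite ctrM !mulmxA.
Qed.

Lemma psd1 n : psd (1%:M : 'M[C]_n).
Proof.
split; first by rewrite /ctr trmx1 map_mx1.
by move=> v; rewrite mulmx1 nsq_sum ler0c sumr_ge0// => i _; exact: nsq_ge0.
Qed.

Lemma psdZ n (y : R) (A : 'M[C]_n) : 0 <= y -> psd A -> psd ((y%:C)%C *: A).
Proof.
move=> y0 [hA pA]; split.
  by rewrite ctrZ hA; congr (_ *: _); exact: conjc_real.
by move=> v; rewrite -scalemxAr -scalemxAl mxE mulr_ge0 ?ler0c.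
Qed.

Lemma psd_gram m n (X : 'M[C]_(m, n)) : psd (X *m X^H).
Proof. by have := psd_congr (X^H) (psd1 n); rewrite mulmx1 ctrK. Qed.

Lemma psd_spectral n (M : 'M[C]_n) : psd M ->
  (forall i, 0 <= complex.Re (spectral_diag M 0 i)) /\
  M = (spectralmx M)^H *m diag_mx (\row_i ((complex.Re (spectral_diag M 0 i))%:C)%C) *m spectralmx M.
Proof.
move=> [hM pM]; have hermM : M \is hermsymmx.
  by apply/is_hermitianmxP; rewrite expr0 scale1r; exact/esym/hM.
have SE : spectral_diag M = \row_i ((complex.Re (spectral_diag M 0 i))%:C)%C.
  apply/rowP => i; rewrite mxE RRe_real//.
  by have /mxOverP := hermitian_spectral_diag_real hermM; apply.
set a := fun i => complex.Re (spectral_diag M 0 i).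
have uP := spectral_unitarymx M.
have ME : M = (spectralmx M)^H *m diag_mx (\row_i ((a i)%:C)%C) *m spectralmx M.
  have /orthomx_spectralP ME := hermitian_normalmx hermM.
  rewrite [LHS]ME SE; congr (_ *m _ *m _).
  exact: (invmx_unitary uP).
split=> // i; have [P1 P2] := unitarymx_ctr uP.
(* Testing [M] on its i-th eigenvector reads off the i-th eigenvalue. *)
have := pM ((spectralmx M)^H *m delta_mx i 0).
rewrite {2}ME ctrM ctrK -!mulmxA (mulmxA (spectralmx M)) P1 mul1mx.
rewrite (mulmxA (spectralmx M)) P1 mul1mx mulmxA nsq_sum_diag ler0c.
rewrite (bigD1 i)//= big1 ?addr0.
  by rewrite mxE !eqxx /nsq/= expr1n expr0n addr0 mulr1.
by move=> j ji; rewrite mxE (negbTE ji) /nsq/= expr0n/= addr0 mulr0.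
Qed.

Lemma unit_vector m (v : 'cV[C]_m.+1) : exists U : 'M[C]_m.+1, exists c : C,
  [/\ U \is unitarymx, v = c *: col 0 U & nsq c = \sum_i nsq (v i 0)].
Proof.
(* All rows are equal; only the first one matters, and Gram-Schmidt yields a unitary matrix whatever
   the rank, so v = 0 needs no separate case. *)
pose A : 'M[C]_m.+1 := \matrix_i v^H; pose S := schmidt A.
have uS : S \is unitarymx by exact: schmidt_unitarymx.
have [S1 S2] := unitarymx_ctr uS.
have : (row 0 A <= row 0 S)%MS.
  apply: (submx_trans (row_schmidt_sub _ _)).
  apply/sumsmx_subP => k; rewrite leqn0 => /eqP k0.
  by rewrite genmxE (_ : k = 0)//; exact: val_inj.
rewrite rowK => /sub_rVP[c vc].
have vE : v = c^* *: col 0 (S^H).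
  rewrite -[v]ctrK vc ctrZ; congr (_ *: _).
  by apply/colP => i; rewrite !(mxE, ctrE).
exists (S^H), (c^*); split; [by rewrite trmxC_unitary|exact: vE|].
apply: complexI; rewrite -nsq_sum vE ctrZ -scalemxAl -scalemxAr scalerA mxE.
have -> : ((col 0 (S^H))^H *m col 0 (S^H)) 0 0 = (S *m S^H) 0 0.
  by rewrite !mxE; apply: eq_bigr => i _; rewrite !(mxE, ctrE) conjCK.
rewrite S1 mxE eqxx mulr1.
exact: nsqE.
Qed.

(** Eigenvectors for distinct eigenvalues are orthogonal, and there are n of them. Building [P] from
    them lists the eigenvalues in the order of [d], which a spectral decomposition would leave
    unspecified. *)
Lemma posdef_diagonalize n (A : 'M[C]_n) (d : 'I_n -> R) : posdefmx A ->
  (forall i, eigenvalue A ((d i)%:C)%C) -> injective d ->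
  (forall i, 0 < d i) /\ exists2 P : 'M[C]_n, P \is unitarymx &
    A = P^H *m diag_mx (\row_i ((d i)%:C)%C) *m P.
Proof.
move=> [/is_hermitianmxP hA0 pA] eA dI.
have hA : A = A^H by rewrite {1}hA0 expr0 scale1r.
have /(_ _)/cid2-/all_sig2[w wA w0] : forall i, exists2 v : 'rV[C]_n, v *m A = ((d i)%:C)%C *: v & v != 0.
  by move=> i; have /eigenvalueP := eA i.
have dE i j : ((d i)%:C)%C * (w i *m (w j)^H) 0 0 = ((d j)%:C)%C * (w i *m (w j)^H) 0 0.
  transitivity ((w i *m A *m (w j)^H) 0 0); first by rewrite wA -scalemxAl [RHS]mxE.
  rewrite -mulmxA {1}hA -ctrM wA ctrZ -scalemxAr [LHS]mxE; congr (_ * _).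
  exact: conjc_real.
have wo i j : i != j -> (w i *m (w j)^H) 0 0 = 0.
  move=> ij; have /eqP := dE i j; rewrite -subr_eq0 -mulrBl mulf_eq0 => /orP[|/eqP//].
  by rewrite subr_eq0 => /eqP/complexI/dI/eqP; rewrite (negbTE ij).
pose r i := \sum_k nsq (w i 0 k).
have rE i : (w i *m (w i)^H) 0 0 = ((r i)%:C)%C.
  by rewrite mxE rmorph_sum/=; apply: eq_bigr => k _; rewrite ctrE nsqE mulrC.
have r0 i : 0 < r i.
  rewrite lt_neqAle sumr_ge0 ?andbT => [|k _]; last exact: nsq_ge0.
  apply: contra (w0 i) => /eqP/esym/eqP; rewrite psumr_eq0 => [/allP H|k _]; last exact: nsq_ge0.
  apply/eqP/rowP => k; have := H k (mem_index_enum k); rewrite /= [RHS]mxE /nsq.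
  rewrite paddr_eq0 ?sqr_ge0// !sqrf_eq0 => /andP[/eqP a /eqP b].
  by case: (w i 0 k) a b => ? ? /= -> ->.
split.
  move=> i; have := pA _ (w0 i); rewrite wA -scalemxAl mxE (rE i).
  by rewrite -rmorphM/= ltcR pmulr_lgt0.
pose s i := (Num.sqrt (r i))^-1.
have sr i : s i * s i * r i = 1.
  rewrite /s -invfM -expr2 sqr_sqrtr ?(ltW (r0 i))// mulVf//.
  by rewrite gt_eqF.
pose P : 'M[C]_n := \matrix_i (((s i)%:C)%C *: w i).
have uP : P \is unitarymx.
  apply/unitarymxP/matrixP => i j.
  have -> : (P *m P^H) i j = ((s i * s j)%:C)%C * (w i *m (w j)^H) 0 0.
    rewrite !mxE mulr_sumr; apply: eq_bigr => k _; rewrite !(ctrE, mxE) rmorphM/= rmorphM/=.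
    have -> : (((s j)%:C)%C)^* = ((s j)%:C)%C by exact: conjc_real.
    by ring.
  rewrite [RHS]mxE; case: eqVneq => [<-|ij]; last by rewrite wo// mulr0.
  by rewrite rE -rmorphM/= sr.
exists P => //; have [P1 P2] := unitarymx_ctr uP.
have PA : P *m A = diag_mx (\row_i ((d i)%:C)%C) *m P.
  apply/row_matrixP => i; rewrite row_mul rowK -scalemxAl wA.
  by apply/rowP => j; rewrite mul_diag_mx !mxE mulrCA.
by rewrite -mulmxA -PA mulmxA P2 mul1mx.
Qed.

(** With this sign all coefficients are nonnegative when [M] is positive semidefinite, so averages
    of them are integrals of nonnegative functions. *)
Definition chi n (M : 'M[C]_n) : {poly C} := \det ('X%:M + map_mx polyC M).

Lemma chi_unitary n (P M : 'M[C]_n) : P \is unitarymx -> chi (P^H *m M *m P) = chi M.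
Proof.
move=> /unitarymx_ctr[P1 P2]; rewrite /chi !map_mxM.
have Q2 : map_mx polyC (P^H) *m map_mx polyC P = 1%:M by rewrite -map_mxM P2 map_mx1.
transitivity (\det (map_mx polyC (P^H) *m ('X%:M + map_mx polyC M) *m map_mx polyC P)).
  rewrite mulmxDr mulmxDl; congr (\det (_ + _)).
  by rewrite -mulmxA mul_scalar_mx -scalemxAr Q2 scalemx1.
by rewrite !det_mulmx mulrAC -det_mulmx Q2 det1 mul1r.
Qed.

Definition chi_diag n (a : 'I_n -> R) (S : pred 'I_n) : {poly C} :=
  \prod_(j | S j) ('X + ((a j)%:C)%C%:P).

Lemma chi_diag_rank1 n (a : 'I_n -> R) (y : R) (h : 'cV[C]_n) :
  chi (diag_mx (\row_i ((a i)%:C)%C) + (y%:C)%C *: (h *m h^H)) =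
  chi_diag a xpredT + \sum_i ((y * nsq (h i 0))%:C)%C *: chi_diag a (predC1 i).
Proof.
rewrite /chi map_mxD map_mxZ map_mxM addrA.
have -> : ('X%:M : 'M[{poly C}]_n) + map_mx polyC (diag_mx (\row_i ((a i)%:C)%C)) =
    diag_mx (\row_i ('X + ((a i)%:C)%C%:P)).
  by apply/matrixP => i j; rewrite !mxE; case: (i == j); rewrite ?mulr1n ?mulr0n ?polyC0 ?addr0.
have -> : ((y%:C)%C)%:P *: (map_mx polyC h *m map_mx polyC (h^H)) =
    (\col_i (((y%:C)%C)%:P * (h i 0)%:P)) *m (\row_i ((h i 0)^*)%:P).
  by rewrite scalemxAl; congr (_ *m _); apply/matrixP => i j; rewrite !(mxE, ctrE) ?ord1.
rewrite det_diagD => [|i]; last first.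
  by rewrite -size_poly_eq0 size_XaddC.
congr (_ + _); apply: eq_bigr => i _; rewrite -!polyCM mul_polyC.
by congr (_ *: _); rewrite rmorphM/= nsqE; ring.
Qed.

(* The real part of ((1 + y d/dX)^q p)(0). *)
Definition ell (y : R) (q : nat) (p : {poly C}) : R :=
  \sum_(k < q.+1) (q ^_ k)%:R * y ^+ k * complex.Re p`_k.

Lemma ellD y q p1 p2 : ell y q (p1 + p2) = ell y q p1 + ell y q p2.
Proof.
rewrite /ell -big_split/=; apply: eq_bigr => k _; rewrite coefD -mulrDr; congr (_ * _).
by case: p1`_k => a b; case: p2`_k.
Qed.

Lemma ellZ y q (c : R) p : ell y q ((c%:C)%C *: p) = c * ell y q p.
Proof.
rewrite /ell mulr_sumr; apply: eq_bigr => k _; rewrite coefZ mulrCA; congr (_ * _).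
by case: p`_k => a b /=; rewrite mul0r subr0.
Qed.

Lemma ell_sum y q (I : finType) (F : I -> {poly C}) : ell y q (\sum_i F i) = \sum_i ell y q (F i).
Proof.
apply: (big_morph (ell y q)); first exact: ellD.
by rewrite /ell big1// => k _; rewrite coef0 mulr0.
Qed.

Lemma ell_ge0 n y q (a : 'I_n -> R) S : 0 <= y -> (forall i, 0 <= a i) ->
  0 <= ell y q (chi_diag a S).
Proof.
move=> y0 a0; apply: sumr_ge0 => k _; apply: mulr_ge0.
  by rewrite mulr_ge0 ?ler0n ?exprn_ge0.
suff : forall k, 0 <= (chi_diag a S)`_k by move=> /(_ k); rewrite lecE => /andP[].
move: k => _; rewrite /chi_diag; apply: (big_ind (fun p : {poly C} => forall k, 0 <= p`_k)).
- by move=> k; rewrite coef1 ler0n.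
- by move=> p1 p2 h1 h2 k; rewrite coefM sumr_ge0// => i _; rewrite mulr_ge0.
- by move=> i _ k; rewrite coefD coefX coefC addr_ge0 ?ler0n//; case: ifP; rewrite ?ler0c.
Qed.

Lemma ell0 y p : ell y 0 p = complex.Re p`_0.
Proof. by rewrite /ell big_ord1 ffactn0 expr0 !mul1r. Qed.

Lemma ellS y q p : ell y q.+1 p = ell y q p + y * ell y q p^`().
Proof.
rewrite /ell big_ord_recl [X in _ = X + _]big_ord_recl /= !ffactn0 -addrA; congr (_ + _).
have -> : \sum_(i < q) (q ^_ bump 0 i)%:R * y ^+ bump 0 i * complex.Re p`_(bump 0 i) =
   \sum_(i < q.+1) (q ^_ i.+1)%:R * y ^+ i.+1 * complex.Re p`_i.+1.
  by rewrite big_ord_recr/= ffact_small// !mul0r addr0.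
rewrite mulr_sumr -big_split/=; apply: eq_bigr => i _.
rewrite coef_deriv /bump /= add1n.
have -> : complex.Re (p`_i.+1 *+ i.+1) = i.+1%:R * complex.Re p`_i.+1.
  move: p`_i.+1 => z; rewrite mulr_natl; elim: (i.+1) => [|m IH]; rewrite ?mulr0n// !mulrS -IH.
  by case: (z *+ m) => ? ?; case: z {IH}.
have -> : (q.+1 ^_ i.+1)%N = (q ^_ i.+1 + q ^_ i * i.+1)%N.
  by rewrite ffactSS !ffactnSr; have := ltn_ord i; rewrite -mulnDr mulnC => iq; congr (_ * _)%N; lia.
by rewrite natrD natrM exprS; ring.
Qed.

Lemma deriv_chi_diag n (a : 'I_n -> R) :
  (chi_diag a xpredT)^`() = \sum_i chi_diag a (predC1 i).
Proof.
rewrite /chi_diag deriv_prod_seq ?index_enum_uniq//.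
by apply: eq_bigr => i _; rewrite derivD derivX derivC addr0 mul1r.
Qed.

Lemma ellS_chi n y q (a : 'I_n -> R) : ell y q.+1 (chi_diag a xpredT) =
  ell y q (chi_diag a xpredT) + \sum_i y * ell y q (chi_diag a (predC1 i)).
Proof. by rewrite ellS deriv_chi_diag ell_sum mulr_sumr. Qed.

Lemma ell_diag_rank1 n y q (a : 'I_n -> R) (h : 'cV[C]_n) :
  ell y q (chi (diag_mx (\row_i ((a i)%:C)%C) + (y%:C)%C *: (h *m h^H))) =
  ell y q (chi_diag a xpredT) + \sum_i nsq (h i 0) * (y * ell y q (chi_diag a (predC1 i))).
Proof.
rewrite chi_diag_rank1 ellD ell_sum; congr (_ + _); apply: eq_bigr => i _.
by rewrite ellZ; ring.
Qed.

Lemma chi_diagE n (a : 'I_n -> R) : chi (diag_mx (\row_i ((a i)%:C)%C)) = chi_diag a xpredT.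
Proof.
have := chi_diag_rank1 a 0 0; rewrite mul0mx scaler0 addr0 => ->.
by rewrite [X in _ + X]big1 ?addr0// => i _; rewrite mul0r scale0r.
Qed.

Lemma ell0_chi n y (M : 'M[C]_n) : ell y 0 (chi M) = complex.Re (\det M).
Proof.
rewrite ell0; congr complex.Re; rewrite -horner_coef0 /chi -horner_evalE -det_map_mx.
congr (\det _); apply/matrixP => i j; rewrite !mxE /= /horner_eval hornerD hornerMn hornerX hornerC.
by rewrite mul0rn add0r.
Qed.

End Hermitian.

(** * Complex Gaussian coordinates *)

Lemma sum_pair_bool (V : nmodType) (int_coord : finType) (F : int_coord * bool -> V) :
  \sum_q F q = \sum_p (F (p, true) + F (p, false)).
Proof.
rewrite (eq_bigr (fun q => F (q.1, q.2))) => [|[]//].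
by rewrite -(pair_bigA _ (fun p b => F (p, b)))/=; apply: eq_bigr => p _; rewrite big_bool.
Qed.

Section ComplexCoordinates.
Variable R : realType.
Local Notation C := R[i].
Local Notation points := (points R).
Local Notation mu := (@lebesgue_measure R).
Local Notation half := (`[0%R, +oo[%classic : set R).

(* As in [mx_of_coords], the complex coordinate [k] occupies the real coordinates
   [2k] and [2k+1]. *)
Definition cc (x : points) (k : nat) : C := Complex (x (2 * k)%N) (x (2 * k + 1)%N).

Definition cblk (s : seq nat) : seq nat := flatten [seq [:: (2 * k)%N; (2 * k + 1)%N] | k <- s].

Lemma cblk_cons k s : cblk (k :: s) = (2 * k)%N :: (2 * k + 1)%N :: cblk s.
Proof. by []. Qed.

Lemma cblk_cat s1 s2 : cblk (s1 ++ s2) = cblk s1 ++ cblk s2.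
Proof. by rewrite /cblk map_cat flatten_cat. Qed.

Lemma mem_cblk l s : (l \in cblk s) = (l./2 \in s).
Proof.
elim: s => // k s IH; rewrite cblk_cons !in_cons IH orbA; congr (_ || _).
by apply/orP/eqP => [[/eqP->|/eqP->]|]; [lia|lia|]; case: (boolP (odd l)) => ol lk; [right|left]; apply/eqP; lia.
Qed.

Lemma uniq_cblk s : uniq s -> uniq (cblk s).
Proof.
elim: s => // k s IH /= /andP[ks us]; rewrite IH// andbT in_cons !mem_cblk negb_or.
have -> : (2 * k)./2 = k by lia.
have -> : (2 * k + 1)./2 = k by lia.
by rewrite ks !andbT; apply/eqP; lia.
Qed.

Lemma size_cblk s : size (cblk s) = (size s).*2.
Proof. by elim: s => // k s IH; rewrite cblk_cons /= IH. Qed.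

Lemma perm_cblk s1 s2 : perm_eq s1 s2 -> perm_eq (cblk s1) (cblk s2).
Proof. by move=> h; apply: perm_flatten; exact: perm_map. Qed.

Lemma sumsq_cblk s x : sumsq (cblk s) x = \sum_(k <- s) nsq (cc x k).
Proof.
elim: s => [|k s IH]; first by rewrite /sumsq !big_nil.
by rewrite /sumsq cblk_cons !big_cons -/(sumsq _ _) IH addrA.
Qed.

Definition cmeas (h : points -> C) := measurable_fun setT (@complex.Re R \o h) /\
  measurable_fun setT (@complex.Im R \o h).

Lemma cmeas_cst c : cmeas (cst c).
Proof. by split; exact: measurable_cst. Qed.

Lemma cmeas_cc k : cmeas (cc^~ k).
Proof. by split; exact: measurable_coord. Qed.

Lemma cmeasD g h : cmeas g -> cmeas h -> cmeas (fun x => g x + h x).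
Proof.
move=> [g1 g2] [h1 h2]; split.
  rewrite (_ : _ \o _ = (@complex.Re R \o g) \+ (@complex.Re R \o h)); first exact: measurable_funD.
  by apply/funext => x /=; case: (g x) => ? ?; case: (h x).
rewrite (_ : _ \o _ = (@complex.Im R \o g) \+ (@complex.Im R \o h)); first exact: measurable_funD.
by apply/funext => x /=; case: (g x) => ? ?; case: (h x).
Qed.

Lemma cmeasM g h : cmeas g -> cmeas h -> cmeas (fun x => g x * h x).
Proof.
move=> [g1 g2] [h1 h2]; split.
  rewrite (_ : _ \o _ = ((@complex.Re R \o g) \* (@complex.Re R \o h)) \- ((@complex.Im R \o g) \* (@complex.Im R \o h))).
    by apply: measurable_funB; exact: measurable_funM.
  by apply/funext => x /=; case: (g x) => ? ?; case: (h x).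
rewrite (_ : _ \o _ = ((@complex.Re R \o g) \* (@complex.Im R \o h)) \+ ((@complex.Im R \o g) \* (@complex.Re R \o h))).
  by apply: measurable_funD; exact: measurable_funM.
by apply/funext => x /=; case: (g x) => ? ?; case: (h x).
Qed.

Lemma cmeas_conj g : cmeas g -> cmeas (fun x => (g x)^*).
Proof.
move=> [g1 g2]; split.
  by rewrite (_ : _ \o _ = @complex.Re R \o g)//; apply/funext => x /=; case: (g x).
rewrite (_ : _ \o _ = (\- (@complex.Im R \o g))%R); first exact: measurable_funN.
by apply/funext => x /=; case: (g x).
Qed.

Lemma cmeas_sum (I : Type) (r : seq I) (P : pred I) (F : I -> points -> C) :
  (forall i, cmeas (F i)) -> cmeas (fun x => \sum_(i <- r | P i) F i x).
Proof.
move=> mF; elim: r => [|i r IH].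
  by under eq_fun do rewrite big_nil; exact: cmeas_cst.
under eq_fun do rewrite big_cons; case: (P i) => //; exact: cmeasD.
Qed.

Lemma cmeas_prod (I : Type) (r : seq I) (P : pred I) (F : I -> points -> C) :
  (forall i, cmeas (F i)) -> cmeas (fun x => \prod_(i <- r | P i) F i x).
Proof.
move=> mF; elim: r => [|i r IH].
  by under eq_fun do rewrite big_nil; exact: cmeas_cst.
under eq_fun do rewrite big_cons; case: (P i) => //; exact: cmeasM.
Qed.

Definition mxmeas m n (F : points -> 'M[C]_(m, n)) := forall i j, cmeas (fun x => F x i j).

Lemma mxmeas_cst m n (M : 'M[C]_(m, n)) : mxmeas (fun=> M).
Proof. by move=> i j; exact: cmeas_cst. Qed.

Lemma mxmeasM m n p (F : points -> 'M[C]_(m, n)) (G : points -> 'M[C]_(n, p)) :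
  mxmeas F -> mxmeas G -> mxmeas (fun x => F x *m G x).
Proof.
move=> mF mG i j; under eq_fun do rewrite mxE.
by apply: cmeas_sum => k; exact: cmeasM.
Qed.

Lemma mxmeasD m n (F G : points -> 'M[C]_(m, n)) :
  mxmeas F -> mxmeas G -> mxmeas (fun x => F x + G x).
Proof. by move=> mF mG i j; under eq_fun do rewrite mxE; exact: cmeasD. Qed.

Lemma mxmeasZ m n c (F : points -> 'M[C]_(m, n)) : mxmeas F -> mxmeas (fun x => c *: F x).
Proof.
by move=> mF i j; under eq_fun do rewrite mxE; apply: cmeasM => //; exact: cmeas_cst.
Qed.

Lemma mxmeas_ctr m n (F : points -> 'M[C]_(m, n)) : mxmeas F -> mxmeas (fun x => (F x)^H).
Proof. by move=> mF i j; under eq_fun do rewrite ctrE; exact: cmeas_conj. Qed.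

Lemma cmeas_det n (F : points -> 'M[C]_n) : mxmeas F -> cmeas (fun x => \det (F x)).
Proof.
move=> mF; rewrite /determinant; apply: cmeas_sum => s.
by apply: cmeasM; [exact: cmeas_cst|apply: cmeas_prod => i; exact: mF].
Qed.

Lemma measurable_nsq g : cmeas g -> measurable_fun setT (fun x => nsq (g x)).
Proof. by move=> [g1 g2]; apply: measurable_funD; apply: measurable_funX. Qed.

(** [g] says where the entries are stored, so that the same lemmas cover the matrix H, each of its
    columns and the vector v. *)
Definition mxat m n (g : 'I_m -> 'I_n -> nat) (x : points) : 'M[C]_(m, n) :=
  \matrix_(i, j) cc x (g i j).

Lemma mxmeas_at m n (g : 'I_m -> 'I_n -> nat) : mxmeas (mxat g).
Proof. by move=> i j; under eq_fun do rewrite mxE; exact: cmeas_cc. Qed.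

Definition locs m n (g : 'I_m -> 'I_n -> nat) : seq nat :=
  [seq g p.1 p.2 | p <- enum {: 'I_m * 'I_n}].

(** On real and imaginary parts [phi] is a real linear isometry of the block. The second argument of
    [G] carries quantities that depend on coordinates outside the block. *)
Lemma int_coords_mx_isometry m n (g : 'I_m -> 'I_n -> nat)
  (phi : {linear 'M[C]_(m, n) -> 'M[C]_(m, n)}) (G : 'M[C]_(m, n) -> points -> \bar R) :
  injective (fun p => g p.1 p.2) -> posm (fun x => G (mxat g x) x) ->
  (forall M x y, (forall l, l \notin cblk (locs g) -> x l = y l) -> G M x = G M y) ->
  (forall M, \sum_i \sum_j nsq (phi M i j) = \sum_i \sum_j nsq (M i j)) ->
  int_coords (@gauss R) (cblk (locs g)) (fun x => G (phi (mxat g x)) x) =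
  int_coords (@gauss R) (cblk (locs g)) (fun x => G (mxat g x) x).
Proof.
move=> g_inj pG GE phi_iso.
pose f (q : 'I_m * 'I_n * bool) : nat := (2 * g q.1.1 q.1.2 + q.2)%N.
have f_inj : injective f.
  move=> [p b] [p' b']; rewrite /f /= => E.
  have bb : b = b' by case: b E; case: b' => //; lia.
  by congr (_, _) => //; apply: g_inj; move: E; rewrite bb; lia.
have ug : uniq (locs g) by rewrite map_inj_uniq ?enum_uniq.
have pf : perm_eq (cblk (locs g)) [seq f q | q <- enum {: 'I_m * 'I_n * bool}].
  apply: uniq_perm; first exact: uniq_cblk.
    by rewrite map_inj_uniq ?enum_uniq.
  move=> l; rewrite mem_cblk; apply/mapP/mapP => [[p _ lp]|[[p b] _ ->]].
    by exists (p, odd l); rewrite ?mem_enum// /f/= -lp; lia.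
  by exists p; rewrite ?mem_enum// /f/=; case: b; lia.
pose part (l : nat) (z : C) := if odd l then complex.Im z else complex.Re z.
pose T (x : points) : points := fun l =>
  if [pick p : 'I_m * 'I_n | g p.1 p.2 == l./2] is Some p then part l (phi (mxat g x) p.1 p.2) else x l.
have Tf x q : T x (f q) = part q.2 (phi (mxat g x) q.1.1 q.1.2).
  case: q => [p b]; rewrite /T /f /=; case: pickP => [p' /eqP gp|/(_ p)]; last first.
    by rewrite (_ : _./2 = g p.1 p.2) ?eqxx//; case: b; lia.
  have -> : p' = p by apply: g_inj; rewrite gp; case: b {gp}; lia.
  by rewrite /part oddD oddM; case: b gp.
have TE x : mxat g (T x) = phi (mxat g x).
  apply/matrixP => i j; rewrite mxE /cc.
  have := Tf x ((i, j), false); have := Tf x ((i, j), true).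
  by rewrite /f/= addn0 addn1 => -> ->; rewrite /part/=; case: (phi _ i j).
have To x l : l \notin cblk (locs g) -> T x l = x l.
  rewrite mem_cblk /T => /mapP lg; case: pickP => // p /eqP lp; case: lg.
  by exists p; rewrite ?mem_enum.
have wg := weight_gauss R.
transitivity (int_coords (@gauss R) (cblk (locs g)) ((fun x => G (mxat g x) x) \o T)).
  congr int_coords; apply/funext => x; rewrite /= TE; apply: GE => l lg.
  by rewrite To.
pose dl (p : 'I_m * 'I_n) : 'M[C]_(m, n) := delta_mx p.1 p.2.
pose I2 : C := Complex 0 1.
have partD l z w : part l (z + w) = part l z + part l w.
  by rewrite /part; case: odd; case: z; case: w.
have part0 l : part l 0 = 0 by rewrite /part; case: odd.
have partZ l c z : part l ((c%:C)%C * z) = c * part l z.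
  by rewrite /part; case: odd; case: z => a b /=; rewrite mul0r ?subr0 ?addr0.
have atE x : mxat g x = \sum_p (((x (f (p, false)))%:C)%C *: dl p + ((x (f (p, true)))%:C)%C *: (I2 *: dl p)).
  rewrite [LHS]matrix_sum_delta pair_bigA/=; apply: eq_bigr => p _.
  rewrite scalerA -scalerDl mxE; congr (_ *: _).
  by rewrite /f/= addn0 /cc /I2; simpc.
rewrite !(int_coords_perm wg _ pf)//; last first.
  apply: posm_comp => //; apply/measurable_points => l.
  rewrite /T; case: pickP => [p _|_]; last exact: measurable_coord.
  have [h1 h2] : cmeas (fun x => phi (mxat g x) p.1 p.2).
    rewrite (_ : (fun x => _) = fun x => \sum_q (mxat g x q.1 q.2 * phi (dl q) p.1 p.2)).
      by apply: cmeas_sum => q; apply: cmeasM; [exact: mxmeas_at|exact: cmeas_cst].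
    apply/funext => x; rewrite {1}(matrix_sum_delta (mxat g x)) pair_bigA/= linear_sum summxE.
    by apply: eq_bigr => q _; rewrite linearZ mxE.
  by rewrite /part; case: odd.
apply: int_coords_isometry => //.
(* The real matrix of [phi] in the basis formed by the elementary matrices (index [false]) and their
   multiples by i (index [true]). *)
- exists (fun q q' : 'I_m * 'I_n * bool => part q.2 (phi ((if q'.2 then I2 else 1) *: dl q'.1) q.1.1 q.1.2)) => x q.
  rewrite Tf atE linear_sum summxE.
  rewrite (big_morph (part q.2) (partD _) (part0 _)).
  rewrite sum_pair_bool; apply: eq_bigr => p _.
  rewrite /= scale1r linearD mxE partD addrC.
  by congr (_ + _); rewrite linearZ mxE partZ mulrC.
- by move=> x l; rewrite -(perm_mem pf); exact: To.
- move=> x; rewrite !sum_pair_bool.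
  transitivity (\sum_i \sum_j nsq (phi (mxat g x) i j)).
    rewrite pair_bigA/=; apply: eq_bigr => p _; rewrite !Tf /part/= addrC.
    by [].
  rewrite phi_iso pair_bigA/=; apply: eq_bigr => p _.
  by rewrite addrC mxE /nsq/= /f/= addn0.
Qed.

Lemma integral_expR_exp (c : R) : 0 <= c ->
  (\int[mu]_(t in half) (expR (- (c * t)) * chi_density 1 t)%:E = ((1 + c)^-1)%:E)%E.
Proof.
move=> c0; have c1 : 0 < 1 + c by rewrite ltr_wpDr.
have := @gamma_integral R (1 + c) 0 c1; rewrite fact0 expr1 div1r => <-.
apply: eq_integral => t _; congr EFin.
by rewrite /chi_density /= expr0 fact0 divr1 !mul1r -expRD; congr expR; ring.
Qed.

Lemma integral_id_expR_exp (c : R) : 0 <= c ->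
  (\int[mu]_(t in half) (t * expR (- (c * t)) * chi_density 1 t)%:E = ((1 + c)^-1 / (1 + c))%:E)%E.
Proof.
move=> c0; have c1 : 0 < 1 + c by rewrite ltr_wpDr.
have := @gamma_integral R (1 + c) 1 c1; rewrite (_ : 1`!%:R = 1)// div1r expr2 invfM => <-.
apply: eq_integral => t _; congr EFin.
by rewrite /chi_density /= expr0 fact0 divr1 expr1 !mul1r -mulrA -expRD; congr (_ * expR _); ring.
Qed.

(** The squared modulus of a complex Gaussian has the exponential law, which is [chi_density 1], and
    distinct entries are independent. *)
Lemma int_coords_gauss_cprod (I : eqType) (r : seq I) (g : I -> nat) (phi : I -> R -> R) (c : I -> R) :
  injective g -> uniq r -> (forall i, continuous (phi i)) ->
  (forall i (t : R), 0 <= t -> 0 <= phi i t) ->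
  (forall i, (\int[mu]_(t in half) (phi i t * chi_density 1 t)%:E = (c i)%:E)%E) ->
  int_coords (@gauss R) (cblk [seq g i | i <- r]) (fun x => (\prod_(i <- r) phi i (nsq (cc x (g i))))%:E) =
  cst (\prod_(i <- r) c i)%:E.
Proof.
move=> g_inj ur cphi phi0 phic; have wg := weight_gauss R.
have p1 i : posm (fun x => (phi i (nsq (cc x (g i))))%:E).
  apply: posm_EFin => [|x]; last by rewrite phi0// nsq_ge0.
  apply: measurableT_comp (measurable_nsq (cmeas_cc _)).
  exact: continuous_measurable_fun.
have pr (r' : seq I) : posm (fun x => (\prod_(i <- r') phi i (nsq (cc x (g i))))%:E).
  elim: r' => [|i r' IH].
    by under eq_fun do rewrite big_nil; exact: posm_cst.
  rewrite (_ : (fun x => _) = fun x => ((phi i (nsq (cc x (g i))))%:E *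
     (\prod_(i <- r') phi i (nsq (cc x (g i))))%:E)%E); first exact: posmM.
  by apply/funext => x; rewrite big_cons EFinM.
have J1 i : int_coords (@gauss R) (cblk [:: g i]) (fun x => (phi i (nsq (cc x (g i))))%:E) = cst (c i)%:E.
  have -> : (fun x => (phi i (nsq (cc x (g i))))%:E) =
      fun x => (phi i (sumsq (cblk [:: g i]) x))%:E.
    by apply/funext => y; rewrite sumsq_cblk big_seq1.
  have u1 : uniq (cblk [:: g i]) by exact: uniq_cblk.
  apply/funext => x.
  have := @int_coords_gauss_sumsq R 1 (cblk [:: g i]) isT u1 (size_cblk _) (phi i) x (cphi i) (phi0 i).
  by move=> ->; rewrite phic.
elim: r ur => [_|i r IH]; last rewrite cons_uniq => /andP[ir ur].
  by apply/funext => x /=; rewrite !big_nil.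
have c0 j : 0 <= c j.
  rewrite -lee_fin -phic; apply: integral_ge0 => t; rewrite /= in_itv/= andbT => t0.
  by rewrite lee_fin mulr_ge0 ?phi0 ?chi_density_ge0.
rewrite map_cons -cat1s cblk_cat int_coords_cat.
rewrite (_ : (fun x => _) = fun x => ((phi i (nsq (cc x (g i))))%:E *
     (\prod_(i <- r) phi i (nsq (cc x (g i))))%:E)%E); last first.
  by apply/funext => x; rewrite big_cons EFinM.
rewrite (int_coords_pull wg (pr r)); last 2 first.
- move=> l; rewrite mem_cblk => /mapP[j jr lj] x t; rewrite /cc !upd_other//.
    by apply: contraNneq ir => ll; rewrite (_ : i = j)//; apply: g_inj; lia.
  by apply: contraNneq ir => ll; rewrite (_ : i = j)//; apply: g_inj; lia.
- exact: (p1 i).2.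
rewrite IH//.
rewrite (_ : (fun x => _) = fun x => ((\prod_(i <- r) c i)%:E * (phi i (nsq (cc x (g i))))%:E)%E); last first.
  by apply/funext => x /=; rewrite muleC.
have pc : 0 <= \prod_(i <- r) c i by apply: prodr_ge0 => j _.
rewrite (int_coords_pull wg (p1 i)) ?J1//.
by apply/funext => x /=; rewrite big_cons -EFinM mulrC.
Qed.

(** Against exp(-c_i |z_i|^2), a factor |z_i|^2 multiplies the integral by one further 1/(1 +
    c_i). *)
Lemma int_coords_gauss_quad n (g : 'I_n -> nat) (c B : 'I_n -> R) (A0 : R) : injective g ->
  (forall i, 0 <= c i) -> (forall i, 0 <= B i) -> 0 <= A0 ->
  int_coords (@gauss R) (cblk [seq g i | i <- enum 'I_n])
    (fun x => (expR (- (\sum_i c i * nsq (cc x (g i)))) *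
               (A0 + \sum_i nsq (cc x (g i)) * B i))%:E) =
  cst ((\prod_i (1 + c i)^-1) * (A0 + \sum_i B i / (1 + c i)))%:E.
Proof.
move=> g_inj c0 B0 A00; have wg := weight_gauss R.
set s := cblk _; pose E0 (x : points) := \prod_i expR (- (c i * nsq (cc x (g i)))).
have E0E x : expR (- (\sum_i c i * nsq (cc x (g i)))) = E0 x by rewrite -sumrN expR_sum.
have ce (k : R) : continuous (fun t : R => expR (- (k * t))).
  move=> t; apply: continuous_comp; last exact: continuous_expR.
  by apply: cvgN; apply: cvgM; [exact: cvg_cst|exact: cvg_id].
have p1 : int_coords (@gauss R) s (EFin \o E0) = cst (\prod_i (1 + c i)^-1)%:E.
  rewrite -[in RHS]big_enum/= -(@int_coords_gauss_cprod _ (enum 'I_n) g (fun i t => expR (- (c i * t))))//.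
  - by congr int_coords; apply/funext => x; rewrite /= /E0 big_enum.
  - exact: enum_uniq.
  - by move=> i; exact: integral_expR_exp.
have p2 j : int_coords (@gauss R) s (fun x => (E0 x * nsq (cc x (g j)))%:E) = cst ((\prod_i (1 + c i)^-1) / (1 + c j))%:E.
  pose phi i (t : R) := if i == j then t * expR (- (c i * t)) else expR (- (c i * t)).
  pose cj i := if i == j then (1 + c i)^-1 / (1 + c i) else (1 + c i)^-1.
  have -> : (\prod_i (1 + c i)^-1) / (1 + c j) = \prod_(i <- enum 'I_n) cj i.
    rewrite big_enum/= (bigD1 j)//= [RHS](bigD1 j)//= /cj eqxx mulrAC; congr (_ * _).
    by apply: eq_bigr => i /negbTE ->.
  rewrite -(@int_coords_gauss_cprod _ (enum 'I_n) g phi)//.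
  - congr int_coords; apply/funext => x; rewrite /= big_enum/=; congr EFin.
    rewrite /E0 (bigD1 j)//= [RHS](bigD1 j)//= /phi eqxx mulrC mulrA; congr (_ * _).
    by apply: eq_bigr => i /negbTE ->.
  - exact: enum_uniq.
  - move=> i; rewrite /phi; case: eqP => _ t; last exact: ce.
    by apply: cvgM; [exact: cvg_id|exact: ce].
  - by move=> i t t0; rewrite /phi; case: eqP => _; rewrite ?mulr_ge0 ?expR_ge0.
  - move=> i; rewrite /phi /cj; case: eqP => _; first exact: integral_id_expR_exp.
    exact: integral_expR_exp.
have mE0 : measurable_fun setT E0.
  apply: measurable_prod => i _; apply: measurableT_comp; first exact: measurable_expR.
  apply: measurable_funN; apply: measurable_funM => //.
  exact: (measurable_nsq (cmeas_cc _)).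
have E00 x : 0 <= E0 x by apply: prodr_ge0 => i _; exact: expR_ge0.
have q1 : posm (EFin \o E0) by exact: posm_EFin.
have q2 j : posm (fun x => (E0 x * nsq (cc x (g j)))%:E).
  apply: posm_EFin => [|x]; last by rewrite mulr_ge0 ?nsq_ge0.
  by apply: measurable_funM => //; exact: (measurable_nsq (cmeas_cc _)).
rewrite (_ : (fun x => _) = fun x => (A0%:E * (EFin \o E0) x +
    \sum_i (B i)%:E * (E0 x * nsq (cc x (g i)))%:E)%E); last first.
  apply/funext => x; rewrite E0E mulrDr EFinD /= -EFinM mulrC; congr (_ + _)%E.
  rewrite mulr_sumr -sumEFin; apply: eq_bigr => i _.
  by rewrite -EFinM; congr EFin; ring.
have pB i : posm (fun x => (B i)%:E * (E0 x * nsq (cc x (g i)))%:E)%E.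
  by apply: posmM => //; apply: posm_cst; rewrite lee_fin.
rewrite (int_coordsD s wg (F := fun x => (A0%:E * (EFin \o E0) x)%E)); last 2 first.
- by apply: posmM => //; apply: posm_cst; rewrite lee_fin.
- exact: posm_sum.
rewrite (int_coords_pull wg q1)// p1 (int_coords_sum s _ wg pB).
apply/funext => x /=; rewrite -EFinM.
have H i : int_coords (@gauss R) s (fun x => (B i)%:E * (E0 x * nsq (cc x (g i)))%:E)%E x =
    (B i * ((\prod_i (1 + c i)^-1) / (1 + c i)))%:E.
  have Bi : forall y : points, (0 <= (B i)%:E)%E by move=> y; rewrite lee_fin.
  have -> := @int_coords_pull R (@gauss R) s (fun=> (B i)%:E) _ wg (q2 i) (fun k _ y t => erefl) Bi.
  by rewrite p2.
rewrite (eq_bigr _ (fun i _ => H i)).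
rewrite sumEFin -EFinD; congr EFin; rewrite mulrDr mulrC; congr (_ + _).
by rewrite mulr_sumr; apply: eq_bigr => i _; ring.
Qed.

End ComplexCoordinates.

(** * Averaging over the columns *)

Section ColumnExpectation.
Variable R : realType.
Local Notation C := R[i].
Local Notation points := (points R).
Local Notation mu := (@lebesgue_measure R).
Local Notation half := (`[0%R, +oo[%classic : set R).

(** The integrands need only agree at the points reached by the integration. A matrix that is
    constant there can thus be diagonalised once, at [x0]. *)
Lemma int_coords_ext w (s : seq nat) (F F' : points -> \bar R) (x0 : points) :
  (forall x : points, (forall l, l \notin s -> x l = x0 l) -> F x = F' x) ->
  int_coords w s F x0 = int_coords w s F' x0.
Proof.
elim: s x0 => [|k s IH] x0 FF'; first exact: FF'.
apply: eq_integral => t _; congr (_ * _)%E; apply: IH => x xl; apply: FF' => l.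
by rewrite in_cons negb_or => /andP[lk ls]; rewrite xl// upd_other.
Qed.

Lemma psd_chi n (M : 'M[C]_n) : psd M -> exists a : 'I_n -> R, (forall i, 0 <= a i) /\ 
  exists P : 'M[C]_n, [/\ P \is unitarymx, M = P^H *m diag_mx (\row_i ((a i)%:C)%C) *m P &
  chi M = chi_diag a xpredT].
Proof.
move=> /psd_spectral[a0 ME]; exists (fun i => complex.Re (spectral_diag M 0 i)); split => //.
exists (spectralmx M); have uP := spectral_unitarymx M; split => //.
by rewrite {1}ME chi_unitary// chi_diagE.
Qed.

Lemma ell_psd_ge0 n y q (M : 'M[C]_n) : 0 <= y -> psd M -> 0 <= ell y q (chi M).
Proof. by move=> y0 /psd_chi[a [a0 [P [_ _ ->]]]]; exact: ell_ge0. Qed.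

Lemma psd_det_ge0 n (M : 'M[C]_n) : psd M -> 0 <= complex.Re (\det M).
Proof. by move=> pM; rewrite -(ell0_chi 0); exact: ell_psd_ge0. Qed.

Lemma nsq_tr m n (M : 'M[C]_(m, n)) :
  ((\sum_i \sum_j nsq (M i j))%:C)%C = \tr (M^H *m M).
Proof.
rewrite exchange_big/= /mxtrace rmorph_sum/=; apply: eq_bigr => j _.
by rewrite mxE rmorph_sum/=; apply: eq_bigr => i _; rewrite ctrE nsqE.
Qed.

Lemma nsq_mul_unitary m n (P : 'M[C]_m) (M : 'M[C]_(m, n)) : P \is unitarymx ->
  \sum_i \sum_j nsq ((P *m M) i j) = \sum_i \sum_j nsq (M i j).
Proof.
move=> /unitarymx_ctr[P1 P2]; apply: complexI; rewrite !nsq_tr ctrM.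
by rewrite -mulmxA (mulmxA (P^H)) P2 mul1mx.
Qed.

Lemma nsq_unitary_mul m n (P : 'M[C]_n) (M : 'M[C]_(m, n)) : P \is unitarymx ->
  \sum_i \sum_j nsq ((M *m P) i j) = \sum_i \sum_j nsq (M i j).
Proof.
move=> /unitarymx_ctr[P1 P2]; apply: complexI; rewrite !nsq_tr ctrM.
by rewrite -mulmxA mxtrace_mulC -!mulmxA P1 mulmx1.
Qed.

Variable n : nat.
Local Notation gaussC s := (@int_coords R (@gauss R) (cblk s)).

Lemma int_coords_gauss_quad_mx (g : 'I_n -> 'I_1 -> nat) (c B : 'I_n -> R) (A0 : R) :
  injective (fun p => g p.1 p.2) ->
  (forall i, 0 <= c i) -> (forall i, 0 <= B i) -> 0 <= A0 ->
  gaussC (locs g)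
    (fun x => (expR (- (\sum_i c i * nsq (mxat g x i 0))) *
               (A0 + \sum_i nsq (mxat g x i 0) * B i))%:E) =
  cst ((\prod_i (1 + c i)^-1) * (A0 + \sum_i B i / (1 + c i)))%:E.
Proof.
move=> g_inj c0 B0 A00; have wg := weight_gauss R.
have g0_inj : injective (fun i => g i 0).
  by move=> i j ij; have := g_inj (i, 0) (j, 0) ij; case.
have pe : perm_eq (locs g) [seq g i 0 | i <- enum 'I_n].
  apply: uniq_perm; [by rewrite map_inj_uniq ?enum_uniq|by rewrite map_inj_uniq ?enum_uniq|move=> l].
  apply/mapP/mapP => [[[i j] _ ->]|[i _ ->]].
    by exists i; rewrite ?mem_enum//= (ord1 j).
  by exists (i, 0); rewrite ?mem_enum.
rewrite (int_coords_perm wg _ (perm_cblk pe)).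
  rewrite -(int_coords_gauss_quad g0_inj c0 B0 A00); congr int_coords; apply/funext => x.
  by congr (expR (- _) * (_ + _))%:E; apply: eq_bigr => i _; rewrite mxE.
have mn i : measurable_fun setT (fun x : points => nsq (mxat g x i 0)).
  by have H := @measurable_nsq R _ (@mxmeas_at R _ _ g i 0).
apply: posm_EFin => [|x].
  apply: measurable_funM.
    apply: measurableT_comp; first exact: measurable_expR.
    apply: measurable_funN; apply: measurable_sum => i; exact: measurable_funM.
  by apply: measurable_funD => //; apply: measurable_sum => i; exact: measurable_funM.
rewrite mulr_ge0 ?expR_ge0// addr_ge0 ?sumr_ge0// => i _.
by rewrite mulr_ge0 ?nsq_ge0.
Qed.

Definition colidx (j i : 'I_n) (_ : 'I_1) : nat := (i * n + j)%N.

Lemma idx_inj (i j i' j' : 'I_n) : (i * n + j = i' * n + j')%N -> (i, j) = (i', j').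
Proof.
move=> E; have n0 : (0 < n)%N := leq_ltn_trans (leq0n _) (ltn_ord i).
have hi : i = i'.
  apply: val_inj => /=; have := congr1 (divn^~ n) E.
  by rewrite /= !divnMDl// !divn_small// !addn0.
by move: E; rewrite hi => /addnI/val_inj ->.
Qed.

Lemma colidx_inj j : injective (fun p => colidx j p.1 p.2).
Proof. by move=> [i k] [i' k'] /idx_inj[->]; rewrite (ord1 k) (ord1 k'). Qed.

Lemma mem_locs_col j (i k : 'I_n) : ((i * n + k)%N \in locs (colidx j)) = (k == j).
Proof.
apply/mapP/eqP => [[p _ /idx_inj[_ ->]]//|->].
by exists (i, 0); rewrite ?mem_enum.
Qed.

Definition off (s : seq nat) (T : Type) (F : points -> T) :=
  forall x y : points, (forall l, l \notin cblk s -> x l = y l) -> F x = F y.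

(** [M] is constant along column j and can be diagonalised; the rotated column is again Gaussian and
    its squared moduli have mean 1, which gives the recursion [ellS_chi]. *)
Lemma column_expectation (j : 'I_n) (y : R) (q : nat) (M : points -> 'M[C]_n) :
  0 <= y -> (forall x, psd (M x)) -> off (locs (colidx j)) M ->
  gaussC (locs (colidx j)) (fun x =>
    (ell y q (chi (M x + (y%:C)%C *: (mxat (colidx j) x *m (mxat (colidx j) x)^H))))%:E) =
  fun x => (ell y q.+1 (chi (M x)))%:E.
Proof.
move=> y0 pM oM; apply/funext => x0.
have [a [a0 [P [uP ME chiM]]]] := psd_chi (pM x0).
rewrite chiM; set h := mxat (colidx j).
have [P1 P2] := unitarymx_ctr uP.
pose G (v : 'M[C]_(n, 1)) (x : points) := (ell y q (chi_diag a xpredT) +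
  \sum_i nsq (v i 0) * (y * ell y q (chi_diag a (predC1 i))))%:E.
transitivity (gaussC (locs (colidx j)) (fun x => G (P *m h x) x) x0).
  apply: int_coords_ext => x xx0; rewrite (oM x x0 xx0) /G -ell_diag_rank1.
  have -> : M x0 + (y%:C)%C *: (h x *m (h x)^H) = P^H *m (diag_mx (\row_i ((a i)%:C)%C) +
      (y%:C)%C *: ((P *m h x) *m (P *m h x)^H)) *m P.
    have Q : P^H *m ((P *m h x) *m (P *m h x)^H) *m P = h x *m (h x)^H.
      by rewrite ctrM !mulmxA P2 mul1mx -mulmxA P2 mulmx1.
    rewrite {1}ME mulmxDr mulmxDl -scalemxAr -scalemxAl; congr (_ + _ *: _).
    exact/esym/Q.
  by rewrite chi_unitary.
have B0 i : 0 <= y * ell y q (chi_diag a (predC1 i)) by rewrite mulr_ge0// ell_ge0.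
rewrite (int_coords_mx_isometry (phi := mulmx P) (G := G)) => //; first last.
- by move=> v; exact: nsq_mul_unitary.
- apply: posm_EFin => [|x].
    apply: measurable_funD => //; apply: measurable_sum => i; apply: measurable_funM => //.
    by have H := @measurable_nsq R _ (@mxmeas_at R _ _ (colidx j) i 0).
  by rewrite addr_ge0 ?ell_ge0// sumr_ge0// => i _; rewrite mulr_ge0 ?nsq_ge0.
- exact: colidx_inj.
(* With c = 0 the exponential disappears and the plain means of the squared moduli remain. *)
have := @int_coords_gauss_quad_mx (colidx j) (fun=> 0) _ _ (@colidx_inj j) (fun=> lexx 0) B0 (ell_ge0 q xpredT y0 a0).
move=> /(congr1 (fun F => F x0))/=; rewrite big1 => [|i _]; last by rewrite addr0 invr1.
rewrite mul1r (eq_bigr (fun i => y * ell y q (chi_diag a (predC1 i)))) => [|i _]; last first.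
  by rewrite addr0 divr1.
rewrite -ellS_chi => <-; congr (int_coords _ _ _ _); apply/funext => x.
by rewrite [X in expR (- X)]big1 ?oppr0 ?expR0 ?mul1r// => i _; rewrite mul0r.
Qed.

Definition cols (js : seq 'I_n) : seq nat := flatten [seq locs (colidx j) | j <- js].

Lemma mem_cols js (i k : 'I_n) : ((i * n + k)%N \in cols js) = (k \in js).
Proof.
by elim: js => // j js IH; rewrite /cols /= mem_cat mem_locs_col in_cons IH.
Qed.

Lemma cols_ord js l : l \in cols js -> exists i k : 'I_n, l = (i * n + k)%N.
Proof.
elim: js => // j js IH; rewrite /cols /= mem_cat => /orP[/mapP[p _ ->]|/IH//].
by exists p.1, j.
Qed.

Lemma uniq_cols js : uniq js -> uniq (cols js).
Proof.
elim: js => // j js IH; rewrite cons_uniq => /andP[jjs ujs].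
have -> : cols (j :: js) = locs (colidx j) ++ cols js by [].
rewrite cat_uniq IH// andbT map_inj_uniq ?enum_uniq ?andTb; last exact: colidx_inj.
apply/hasPn => l lj; have [i [k lE]] := cols_ord lj; move: lj; rewrite lE mem_cols mem_locs_col => kj.
by apply: contraNneq jjs => <-.
Qed.

Lemma mxat_off p q (g : 'I_p -> 'I_q -> nat) s :
  (forall i j, g i j \notin s) -> off s (@mxat R _ _ g).
Proof.
move=> gs x y xy; apply/matrixP => i j; rewrite !mxE /cc !xy// mem_cblk.
  by rewrite (_ : _./2 = g i j) ?gs//; lia.
by rewrite (_ : _./2 = g i j) ?gs//; lia.
Qed.

Lemma off_sub s s' (T : Type) (F : points -> T) : {subset s <= s'} -> off s' F -> off s F.
Proof.
move=> ss oF x y xy; apply: oF => l ls; apply: xy; apply: contra ls.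
by rewrite !mem_cblk; exact: ss.
Qed.

Lemma columns_expectation (js : seq 'I_n) (y : R) (q : nat) (M : points -> 'M[C]_n) :
  0 <= y -> uniq js -> (forall x, psd (M x)) -> off (cols js) M ->
  gaussC (cols js) (fun x => (ell y q (chi (M x + (y%:C)%C *:
    \sum_(j <- js) (mxat (colidx j) x *m (mxat (colidx j) x)^H))))%:E) =
  fun x => (ell y (q + size js) (chi (M x)))%:E.
Proof.
move=> y0; elim: js q M => [|j js IH] q M.
  move=> _ _ _; apply/funext => x.
  by rewrite /= big_nil scaler0 addr0 addn0.
rewrite cons_uniq => /andP[jjs ujs] pM oM.
have sub : {subset cols js <= cols (j :: js)} by move=> l ls; rewrite /cols/= mem_cat ls orbT.
pose M' x := M x + (y%:C)%C *: (mxat (colidx j) x *m (mxat (colidx j) x)^H).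
have pM' x : psd (M' x) by apply: (psdD (pM x)); apply: (psdZ y0); exact: psd_gram.
have oM' : off (cols js) M'.
  move=> x x' xx; rewrite /M' (off_sub sub oM xx).
  have -> : mxat (colidx j) x = mxat (colidx j) x' => //.
  by apply: (mxat_off _ xx) => i k; rewrite mem_cols.
have E x : M x + (y%:C)%C *: (\sum_(j0 <- j :: js) (mxat (colidx j0) x *m (mxat (colidx j0) x)^H)) =
    M' x + (y%:C)%C *: \sum_(j <- js) (mxat (colidx j) x *m (mxat (colidx j) x)^H).
  by rewrite big_cons scalerDr addrA.
under eq_fun do rewrite E.
have -> : cols (j :: js) = locs (colidx j) ++ cols js by [].
rewrite cblk_cat int_coords_cat (IH q M' ujs pM' oM') column_expectation//.
  by apply/funext => x; rewrite /= addnS.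
by apply: off_sub oM => l ls; rewrite /cols/= mem_cat ls.
Qed.

End ColumnExpectation.

(** * Averaging over the matrix and over the auxiliary vector *)

Section Kappa.
Variables (R : realType) (m : nat).
Local Notation n := m.+1.
Local Notation C := R[i].
Local Notation points := (points R).
Local Notation gaussC s := (@int_coords R (@gauss R) (cblk s)).
Variable d : 'I_n -> R.
Hypothesis d0 : forall i, 0 < d i.

Lemma real_prodXD (a : 'I_n -> R) S :
  chi_diag a S = map_poly (real_complex R) (\prod_(j | S j) ('X + (a j)%:P)).
Proof.
rewrite rmorph_prod/=; apply: eq_bigr => j _.
by rewrite rmorphD/= map_polyX map_polyC.
Qed.

(** Since d_j (X + 1/d_j) = 1 + d_j X, the factor det D turns the polynomial built on D^-1 into [Pd]
    or [Pdi i]. *)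
Lemma Re_coef_chi_diag (S : pred 'I_n) k :
  (\prod_(j | S j) d j) * complex.Re (chi_diag (fun j => (d j)^-1) S)`_k =
  (\prod_(j | S j) (1 + d j *: 'X))`_k.
Proof.
rewrite real_prodXD coef_map/= -coefCM rmorph_prod/= -big_split/=.
rewrite (eq_bigr (fun j => 1 + d j *: 'X))// => j _.
by rewrite mulrDr -polyCM divff ?gt_eqF// mul_polyC addrC.
Qed.

Lemma ell_chi_diag y : (\prod_j d j) * ell y m (chi_diag (fun j => (d j)^-1) xpredT) =
  \sum_(k < n) om n y k * (Pd d)`_k.
Proof.
rewrite /ell mulr_sumr; apply: eq_bigr => k _.
rewrite mulrCA Re_coef_chi_diag /om /=; congr (_ * _ * _).
have h : m`!%:R = (m ^_ k)%:R * (m - k)`!%:R :> R.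
  by rewrite -natrM ffact_fact// -ltnS.
by rewrite h mulfK// pnatr_eq0 -lt0n fact_gt0.
Qed.

Lemma ell_chi_diag1 y i : (\prod_j d j) * ell y m (chi_diag (fun j => (d j)^-1) (predC1 i)) =
  \sum_(k < n) om n y k * (d i * (Pdi d i)`_k).
Proof.
rewrite /ell mulr_sumr; apply: eq_bigr => k _.
rewrite mulrCA (bigD1 i)//= -[d i * _ * _]mulrA Re_coef_chi_diag /om /=; congr (_ * _ * _).
have h : m`!%:R = (m ^_ k)%:R * (m - k)`!%:R :> R.
  by rewrite -natrM ffact_fact// -ltnS.
by rewrite h mulfK// pnatr_eq0 -lt0n fact_gt0.
Qed.

Definition hidx (i j : 'I_n) : nat := (i * n + j)%N.
Local Notation H := (@mxat R n n hidx).
Local Notation D := (diag_mx (\row_i ((d i)%:C)%C) : 'M[C]_n).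

Lemma hidx_inj : injective (fun p => hidx p.1 p.2).
Proof. by move=> [i k] [i' k'] /idx_inj. Qed.

Lemma col_H x j : mxat (colidx j) x = col j (H x).
Proof. by apply/colP => i; rewrite !mxE. Qed.

Lemma gram_cols (X : 'M[C]_n) : X *m X^H = \sum_j col j X *m (col j X)^H.
Proof.
apply/matrixP => i k; rewrite mxE summxE; apply: eq_bigr => j _.
by rewrite !mxE big_ord1 !(mxE, ctrE).
Qed.

Definition detW (y : R) (X : 'M[C]_n) : R := complex.Re (\det (1%:M + (y%:C)%C *: (X^H *m D *m X))).

Lemma detW_chi y (X : 'M[C]_n) : detW y X = (\prod_j d j) *
  ell y 0 (chi (diag_mx (\row_i (((d i)^-1)%:C)%C) + (y%:C)%C *: (X *m X^H))).
Proof.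
rewrite ell0_chi /detW -mulmxA scalemxAr det1D_mulmxC.
pose D' : 'M[C]_n := diag_mx (\row_i (((d i)^-1)%:C)%C).
have DD : D *m D' = 1%:M.
  apply/matrixP => i j; rewrite mul_diag_mx !mxE; case: eqVneq => [->|_].
    by rewrite mulr1n -rmorphM/= divff ?gt_eqF.
  by rewrite mulr0n mulr0.
have -> : 1%:M + (y%:C)%C *: (D *m X) *m X^H = D *m (D' + (y%:C)%C *: (X *m X^H)).
  rewrite mulmxDr DD; congr (_ + _).
  by rewrite -scalemxAr -scalemxAl mulmxA.
rewrite det_mulmx det_diag; have -> : \prod_i (\row_i ((d i)%:C)%C : 'rV[C]_n) 0 i = ((\prod_j d j)%:C)%C.
  by rewrite rmorph_prod/=; apply: eq_bigr => i _; rewrite mxE.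
by case: (\det _) => a b /=; rewrite mul0r subr0.
Qed.

Lemma psd_W y (X : 'M[C]_n) : 0 <= y -> psd (1%:M + (y%:C)%C *: (X^H *m D *m X)).
Proof.
move=> y0; apply: psdD; first exact: psd1.
by apply: psdZ => //; apply: psd_congr; apply: psd_diag => i; exact: ltW.
Qed.

Lemma detW_ge0 y X : 0 <= y -> 0 <= detW y X.
Proof. by move=> y0; apply: psd_det_ge0; exact: psd_W. Qed.

Lemma measurable_detW y (F : points -> 'M[C]_n) : mxmeas F -> measurable_fun setT (fun x => detW y (F x)).
Proof.
move=> mF; have [h _] : cmeas (fun x => \det (1%:M + (y%:C)%C *: ((F x)^H *m D *m F x))).
  apply: cmeas_det; apply: mxmeasD; first exact: mxmeas_cst.
  apply: mxmeasZ; apply: mxmeasM => //; apply: mxmeasM; last exact: mxmeas_cst.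
  exact: mxmeas_ctr.
exact: h.
Qed.

Lemma measurable_qform (F : points -> 'cV[C]_n) : mxmeas F ->
  measurable_fun setT (fun x => \sum_i d i * nsq (F x i 0)).
Proof.
move=> mF; apply: measurable_sum => i; apply: measurable_funM => //.
exact: (@measurable_nsq R (fun x => F x i 0) (mF i 0)).
Qed.

Lemma posm_kappa_integrand (y r : R) : 0 <= y ->
  posm (fun x => (expR (- (y * r * \sum_i d i * nsq (H x i 0))) * detW y (H x))%:E).
Proof.
move=> y0.
apply: posm_EFin => [|x]; last by rewrite mulr_ge0 ?expR_ge0 ?detW_ge0.
apply: measurable_funM; last by apply: measurable_detW; exact: mxmeas_at.
apply: measurableT_comp; first exact: measurable_expR.
apply: measurable_funN; apply: measurable_funM => //.
have mH : mxmeas (fun x => col ord0 (H x)).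
  by move=> i j; under eq_fun do rewrite !mxE; exact: cmeas_cc.
have := measurable_qform mH; congr (measurable_fun _ _).
by apply/funext => x; apply: eq_bigr => i _; rewrite mxE.
Qed.

(** The exponential involves the first column only. The other m columns are averaged first, which
    gives [ell y m]; the result is affine in the squared moduli of the first column, and its
    integral is given by [int_coords_gauss_quad_mx]. *)
Lemma gauss_kappa (y r : R) : 0 <= y -> 0 <= r ->
  gaussC (locs hidx) (fun x => (expR (- (y * r * \sum_i d i * nsq (H x i 0))) * detW y (H x))%:E) =
  cst (kappa d y r)%:E.
Proof.
move=> y0 r0; have wg := weight_gauss R.
pose js := [seq j <- enum 'I_n | j != 0].
have pe : perm_eq (locs hidx) (cols (ord0 :: js)).
  apply: uniq_perm.
  - by rewrite map_inj_uniq ?enum_uniq//; exact: hidx_inj.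
  - by apply: uniq_cols; rewrite /= mem_filter eqxx/= filter_uniq// enum_uniq.
  move=> l; apply/mapP/idP => [[[i k] _ ->]|/cols_ord[i [k ->]]]; last first.
    by exists (i, k); rewrite ?mem_enum.
  by rewrite mem_cols in_cons mem_filter mem_enum andbT; case: eqP.
have sjs : size js = m.
  have := count_predC (pred1 (ord0 : 'I_n)) (enum 'I_n).
  rewrite size_enum_ord count_uniq_mem ?enum_uniq// mem_enum /= -size_filter.
  by rewrite add1n => -[].
pose h := @mxat R n 1 (colidx (ord0 : 'I_n)).
pose D' : 'M[C]_n := diag_mx (\row_i (((d i)^-1)%:C)%C).
pose M (x : points) := D' + (y%:C)%C *: (h x *m (h x)^H).
pose c (x : points) := expR (- (y * r * \sum_i d i * nsq (h x i 0))) * \prod_j d j.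
pose S (x : points) := \sum_(j <- js) (mxat (colidx j) x *m (mxat (colidx j) x)^H).
have pd0 : 0 <= \prod_j d j by apply: prodr_ge0 => j _; exact: ltW.
have c0 x : 0 <= c x by rewrite mulr_ge0 ?expR_ge0.
have pD' : psd D' by apply: psd_diag => i; rewrite invr_ge0 ltW.
have pM x : psd (M x) by apply: (psdD pD'); apply: (psdZ y0); exact: psd_gram.
have hoff : off (cols js) h.
  by apply: mxat_off => i k; rewrite mem_cols mem_filter eqxx.
have SE x : H x *m (H x)^H = h x *m (h x)^H + S x.
  rewrite gram_cols (bigD1 ord0)//= /h col_H; congr (_ + _).
  rewrite /S big_filter big_enum_cond/=; apply: eq_bigr => j _.
  by rewrite col_H.
have FE (x : points) : (expR (- (y * r * \sum_i d i * nsq (H x i 0))) * detW y (H x))%:E =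
    ((c x)%:E * (ell y 0 (chi (M x + (y%:C)%C *: S x)))%:E)%E.
  rewrite detW_chi SE scalerDr addrA mulrA EFinM /c /h; congr (_%:E * _)%E.
  congr (expR (- (_ * _)) * _); apply: eq_bigr => i _.
  by rewrite !mxE.
have pF := posm_kappa_integrand r y0.
rewrite (int_coords_perm wg pF (perm_cblk pe)).
have -> : cols (ord0 :: js) = locs (colidx (ord0 : 'I_n)) ++ cols js by [].
rewrite cblk_cat int_coords_cat; under eq_fun do rewrite FE.
have pS : posm (fun x => (ell y 0 (chi (M x + (y%:C)%C *: S x)))%:E).
  apply: posm_EFin => [|x].
    rewrite (_ : (fun x => _) = fun x => complex.Re (\det (M x + (y%:C)%C *: S x))); last first.
      by apply/funext => x; rewrite ell0_chi.
    suff hm : cmeas (fun x => \det (M x + (y%:C)%C *: S x)) by exact: hm.1.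
    apply: cmeas_det; apply: mxmeasD.
      apply: mxmeasD; first exact: mxmeas_cst.
      by apply: mxmeasZ; apply: mxmeasM; [exact: mxmeas_at|apply: mxmeas_ctr; exact: mxmeas_at].
    apply: mxmeasZ => i k; rewrite /S; under eq_fun do rewrite summxE.
    apply: cmeas_sum => j; apply: mxmeasM; [exact: mxmeas_at|apply: mxmeas_ctr; exact: mxmeas_at].
  apply: (ell_psd_ge0 _ y0); apply: (psdD (pM x)); apply: (psdZ y0).
  rewrite /S; elim: {pe sjs S hoff SE FE pF} js => [|j js IH].
    by rewrite big_nil -(mulmx0 n (0 : 'M[C]_n)); have := psd_gram (0 : 'M[C]_n); rewrite mul0mx mulmx0.
  by rewrite big_cons; apply: (psdD _ IH); exact: psd_gram.
rewrite (int_coords_pull wg pS); last 2 first.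
- move=> l lc x t; rewrite /c; have -> // : h (upd x l t) = h x.
  by apply: hoff => l' l'c; rewrite upd_other//; apply: contraNneq l'c => ->.
- by move=> x; rewrite lee_fin.
have ujs : uniq js by rewrite filter_uniq// enum_uniq.
have oM : off (cols js) M by move=> x x' xx; rewrite /M (hoff _ _ xx).
rewrite (@columns_expectation R n js y 0 M y0 ujs pM oM).
rewrite add0n sjs.
(* The averaged determinant is [A0] plus the sum of the |h_i|^2 times [B i], with h the first
   column. *)
pose A0 := (\prod_j d j) * ell y m (chi_diag (fun j => (d j)^-1) xpredT).
pose B i := (\prod_j d j) * (y * ell y m (chi_diag (fun j => (d j)^-1) (predC1 i))).
have di0 i : 0 <= (d i)^-1 by rewrite invr_ge0 ltW.
have yrd0 i : 0 <= y * r * d i by rewrite !mulr_ge0// ltW.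
have B0 i : 0 <= B i by rewrite mulr_ge0// mulr_ge0// ell_ge0.
have A00 : 0 <= A0 by rewrite mulr_ge0// ell_ge0.
transitivity (gaussC (locs (colidx (ord0 : 'I_n))) (fun x =>
    (expR (- (\sum_i (y * r * d i) * nsq (mxat (colidx (ord0 : 'I_n)) x i 0))) *
      (A0 + \sum_i nsq (mxat (colidx (ord0 : 'I_n)) x i 0) * B i))%:E)).
  apply: congr1; apply/funext => x; rewrite -EFinM; congr EFin; rewrite /c /M ell_diag_rank1 -[_ * _ * (ell _ _ _ + _)]mulrA.
  have <- : y * r * (\sum_i d i * nsq (h x i 0)) = \sum_i (y * r * d i) * nsq (h x i 0).
    by rewrite mulr_sumr; apply: eq_bigr => i _; rewrite mulrA.
  congr (_ * _); rewrite mulrDr; congr (_ + _); rewrite mulr_sumr; apply: eq_bigr => i _.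
  by rewrite mulrCA.
rewrite (int_coords_gauss_quad_mx (@colidx_inj _ _) yrd0 B0 A00).
congr (cst _%:E); rewrite prodfV -horner_Pd /kappa.
have BE i : B i / (1 + y * r * d i) =
    \sum_(k < n) om n y k * (y * (d i * (Pdi d i)`_k / (1 + y * r * d i))).
  rewrite /B mulrCA ell_chi_diag1 mulr_sumr mulr_suml; apply: eq_bigr => k _.
  by ring.
rewrite /A0 ell_chi_diag (eq_bigr _ (fun i _ => BE i)).
rewrite exchange_big/= -big_split/= mulr_sumr; apply: eq_bigr => k _.
rewrite -mulr_sumr -mulr_sumr -mulrDr; ring.
Qed.

Definition ridge (A : 'M[C]_n) (y : R) (X : 'M[C]_n) : R :=
  \sum_i (1 + y * complex.Re (spectral_diag (X^H *m A *m X) 0 i))^-1.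

(** The vector is stored after the n*n entries of the matrix, so the two blocks are disjoint. *)
Definition vidx (i : 'I_n) (_ : 'I_1) : nat := (n * n + i)%N.
Local Notation v := (@mxat R n 1 vidx).

Lemma vidx_inj : injective (fun p => vidx p.1 p.2).
Proof. by move=> [i k] [i' k'] /addnI/val_inj /= ->; rewrite (ord1 k) (ord1 k'). Qed.

Lemma hidx_lt i j : (hidx i j < n * n)%N.
Proof.
by rewrite /hidx (@leq_trans (i.+1 * n)%N) ?leq_mul2r ?ltn_ord ?orbT// mulSn addnC ltn_add2r.
Qed.

Lemma hidx_vidx i j : hidx i j \notin locs vidx.
Proof.
apply/mapP => -[[i' k] _] E; have := hidx_lt i j.
by rewrite E /vidx /=; lia.
Qed.

Lemma vidx_hidx i j : vidx i j \notin locs hidx.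
Proof.
apply/mapP => -[[i' k] _] /= E; have := hidx_lt i' k.
by rewrite -E /vidx; lia.
Qed.

(* Once [v] is rotated to an eigenbasis of [W], each |v_i|^2 contributes one more
   factor 1 / (1 + y a_i) to the product of the Gaussian integrals. *)
Lemma ridge_vector (W : points -> 'M[C]_n) y (x : points) : 0 <= y -> (forall x, psd (W x)) ->
  off (locs vidx) W ->
  gaussC (locs vidx) (fun x => (expR (- (y * complex.Re (((v x)^H *m W x *m v x) 0 0))) *
     \sum_i nsq (v x i 0))%:E) x =
  ((\prod_i (1 + y * complex.Re (spectral_diag (W x) 0 i)))^-1 *
    \sum_i (1 + y * complex.Re (spectral_diag (W x) 0 i))^-1)%:E.
Proof.
move=> y0 pW oW; have wg := weight_gauss R.
have [a0 WE] := psd_spectral (pW x).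
set a := fun i => complex.Re (spectral_diag (W x) 0 i) in a0 WE *.
set P := spectralmx (W x) in WE; have uP : P \is unitarymx by exact: spectral_unitarymx.
pose G (u : 'M[C]_(n, 1)) (x : points) :=
  (expR (- \sum_i (y * a i) * nsq (u i 0)) * (0 + \sum_i nsq (u i 0) * 1))%:E.
transitivity (gaussC (locs vidx) (fun x => G (P *m v x) x) x).
  apply: int_coords_ext => z zx; rewrite (oW z x zx) /G; congr EFin.
  have -> : \sum_i y * a i * nsq ((P *m v z) i 0) = y * complex.Re (((v z)^H *m W x *m v z) 0 0).
    have -> : (v z)^H *m W x *m v z = (P *m v z)^H *m diag_mx (\row_i ((a i)%:C)%C) *m (P *m v z).
      by rewrite {1}WE ctrM !mulmxA.
    by rewrite nsq_sum_diag /= mulr_sumr; apply: eq_bigr => i _; rewrite mulrA.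
  congr (_ * _); rewrite add0r; have := nsq_mul_unitary (v z) uP.
  rewrite (eq_bigr (fun i => nsq ((P *m v z) i 0) * 1)) => [|i _]; last by rewrite big_ord1 mulr1.
  by move=> ->; apply: eq_bigr => i _; rewrite big_ord1.
have ya0 i : 0 <= y * a i by apply: mulr_ge0 => //; exact: a0.
rewrite (int_coords_mx_isometry (phi := mulmx P) (G := G)) => //; first last.
- by move=> u; exact: nsq_mul_unitary.
- have mn i : measurable_fun setT (fun x => nsq (v x i 0)).
    exact: (@measurable_nsq R _ (@mxmeas_at R _ _ vidx i 0)).
  apply: posm_EFin => [|z].
    apply: measurable_funM.
      apply: measurableT_comp; first exact: measurable_expR.
      apply: measurable_funN; apply: measurable_sum => i; exact: measurable_funM.
    by apply: measurable_funD => //; apply: measurable_sum => i; exact: measurable_funM.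
  rewrite mulr_ge0 ?expR_ge0// add0r sumr_ge0// => i _.
  by rewrite mulr1 nsq_ge0.
- exact: vidx_inj.
have := @int_coords_gauss_quad_mx R n vidx (fun i => y * a i) (fun=> 1) 0 vidx_inj ya0 (fun=> ler01) (lexx 0).
move=> /(congr1 (fun F => F x)) => ->; congr EFin; rewrite prodfV add0r; congr (_ * _).
by apply: eq_bigr => i _; rewrite mul1r.
Qed.

Lemma det1D_unitary y (U W : 'M[C]_n) : U \is unitarymx ->
  \det (1%:M + (y%:C)%C *: (U^H *m W *m U)) = \det (1%:M + (y%:C)%C *: W).
Proof.
move=> /unitarymx_ctr[U1 U2].
have -> : 1%:M + (y%:C)%C *: (U^H *m W *m U) = U^H *m (1%:M + (y%:C)%C *: W) *m U.
  have E : U^H *m 1%:M *m U = 1%:M by rewrite mulmx1.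
  rewrite mulmxDr mulmxDl -scalemxAr -scalemxAl; congr (_ + _).
  exact/esym/E.
rewrite det_mulmx det_mulmx mulrAC -det_mulmx.
have E : \det (U^H *m U) = 1 by rewrite U2 det1.
by rewrite [X in X * _]E mul1r.
Qed.

Lemma det1D_psd y (W : 'M[C]_n) : psd W -> complex.Re (\det (1%:M + (y%:C)%C *: W)) =
  \prod_i (1 + y * complex.Re (spectral_diag W 0 i)).
Proof.
move=> /psd_spectral[a0 WE].
rewrite {1}WE det1D_unitary; last exact: spectral_unitarymx.
have -> : 1%:M + (y%:C)%C *: diag_mx (\row_i ((complex.Re (spectral_diag W 0 i))%:C)%C) =
    diag_mx (\row_i ((1 + y * complex.Re (spectral_diag W 0 i))%:C)%C) :> 'M[C]_n.
  apply/matrixP => i j; rewrite !mxE; case: (i == j).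
    by rewrite !mulr1n rmorphD rmorphM.
  by rewrite !mulr0n mulr0 addr0.
rewrite det_diag; have -> : \prod_i (\row_i ((1 + y * complex.Re (spectral_diag W 0 i))%:C)%C : 'rV[C]_n) 0 i =
    ((\prod_i (1 + y * complex.Re (spectral_diag W 0 i)))%:C)%C.
  by rewrite rmorph_prod/=; apply: eq_bigr => i _; rewrite mxE.
by [].
Qed.

Lemma nsqM (z w : C) : nsq (z * w) = nsq z * nsq w.
Proof. by case: z => a b; case: w => c e; rewrite /nsq /=; ring. Qed.

Lemma sumsq_v (x : points) : sumsq (cblk (locs vidx)) x = \sum_i nsq (v x i 0).
Proof.
rewrite sumsq_cblk big_map big_enum/= -(pair_bigA _ (fun i j => nsq (cc x (vidx i j))))/=.
by apply: eq_bigr => i _; rewrite big_ord1 mxE.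
Qed.

Section RidgeIntegral.
Variables (A P : 'M[C]_n) (y : R).
Hypotheses (uP : P \is unitarymx) (AE : A = P^H *m D *m P) (y0 : 0 < y).
Let yge0 : 0 <= y := ltW y0.
Local Notation W X := (X^H *m A *m X).

Lemma psd_A (X : 'M[C]_n) : psd (W X).
Proof. by apply: psd_congr; rewrite AE; apply: psd_congr; apply: psd_diag => i; exact: ltW. Qed.

(** Its partial integrals over v and over H are given by [ridge_joint] and [joint_H]; exchanging the
    order of integration relates the two. *)
Definition joint_integrand (x : points) : \bar R :=
  ((complex.Re (\det (1%:M + (y%:C)%C *: W (H x))))%:E *
   (expR (- (y * complex.Re (((v x)^H *m W (H x) *m v x) 0 0))) * \sum_i nsq (v x i 0))%:E)%E.

Lemma mxmeas_W : mxmeas (fun x => W (H x)).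
Proof.
apply: mxmeasM; last exact: mxmeas_at.
by apply: mxmeasM; [apply: mxmeas_ctr; exact: mxmeas_at|exact: mxmeas_cst].
Qed.

Lemma posm_det : posm (fun x => (complex.Re (\det (1%:M + (y%:C)%C *: W (H x))))%:E).
Proof.
apply: posm_EFin => [|x].
  suff h : cmeas (fun x => \det (1%:M + (y%:C)%C *: W (H x))) by exact: h.1.
  apply: cmeas_det; apply: mxmeasD; first exact: mxmeas_cst.
  by apply: mxmeasZ; exact: mxmeas_W.
apply: psd_det_ge0; apply: (psdD (psd1 _ _)); apply: (psdZ yge0); exact: psd_A.
Qed.

Lemma posm_vector : posm (fun x => (expR (- (y * complex.Re (((v x)^H *m W (H x) *m v x) 0 0))) *
  \sum_i nsq (v x i 0))%:E).
Proof.
apply: posm_EFin => [|x]; last first.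
  by rewrite mulr_ge0 ?expR_ge0// sumr_ge0// => i _; exact: nsq_ge0.
apply: measurable_funM.
  apply: measurableT_comp; first exact: measurable_expR.
  apply: measurable_funN; apply: measurable_funM => //.
  suff h : mxmeas (fun x => (v x)^H *m W (H x) *m v x) by exact: (h 0 0).1.
  apply: mxmeasM; last exact: mxmeas_at.
  by apply: mxmeasM; [apply: mxmeas_ctr; exact: mxmeas_at|exact: mxmeas_W].
apply: measurable_sum => i.
exact: (@measurable_nsq R _ (@mxmeas_at R _ _ vidx i 0)).
Qed.

Lemma ridge_joint x : (ridge A y (H x))%:E = gaussC (locs vidx) joint_integrand x.
Proof.
have wg := weight_gauss R.
have oH : off (locs vidx) H by apply: mxat_off; exact: hidx_vidx.
rewrite (int_coords_pull wg posm_vector); last 2 first.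
- move=> l lv z t; have -> // : H (upd z l t) = H z.
  by apply: oH => l' l'v; rewrite upd_other//; apply: contraNneq l'v => ->.
- exact: posm_det.2.
rewrite (@ridge_vector (fun x => W (H x)) y x yge0); last 2 first.
- by move=> z; exact: psd_A.
- by move=> z z' zz; rewrite (oH z z' zz).
(* The determinant in front cancels the one produced by the integral over v; it is nonzero because
   the eigenvalues are nonnegative. *)
rewrite -EFinM (det1D_psd _ (psd_A _)) mulVKf//.
apply/prodf_neq0 => i _; apply: lt0r_neq0.
rewrite ltr_pwDl// mulr_ge0//; exact: (psd_spectral (psd_A _)).1.
Qed.

(** The integrand is a function of P H U, where [P] diagonalises [A] and [U] takes the first basis
    vector to the direction of v. Multiplication by a unitary matrix on either side preserves the
    law of H. *)
Lemma joint_H x (r := \sum_i nsq (v x i 0)) :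
  gaussC (locs hidx) joint_integrand x = (r * kappa d y r)%:E.
Proof.
have wg := weight_gauss R.
have ov : off (locs hidx) v by apply: mxat_off; exact: vidx_hidx.
have [U [c [uU vE cr]]] := unit_vector (v x).
have r0 : 0 <= nsq c by exact: nsq_ge0.
have rc : r = nsq c by [].
pose Q (X : 'M[C]_n) := expR (- (y * r * \sum_i d i * nsq (X i 0))) * detW y X.
pose G (X : 'M[C]_n) (z : points) := (r%:E * (Q X)%:E)%E.
have mQ (F : points -> 'M[C]_n) : mxmeas F -> posm (fun z => G (F z) z).
  move=> mF; apply: posmM; first by apply: posm_cst; rewrite lee_fin rc.
  apply: posm_EFin => [|z]; last by rewrite mulr_ge0 ?expR_ge0// detW_ge0.
  apply: measurable_funM; last exact: measurable_detW.
  apply: measurableT_comp; first exact: measurable_expR.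
  apply: measurable_funN; apply: measurable_funM => //.
  apply: measurable_sum => i; apply: measurable_funM => //.
  exact: (@measurable_nsq R (fun x => F x i 0) (mF i 0)).
transitivity (gaussC (locs hidx) (fun z => G (P *m (H z *m U)) z) x).
  apply: int_coords_ext => z zx; pose X := H z.
  have aux (a e e' r' : R) : e = e' -> (a%:E * (e * r')%:E = r'%:E * (e' * a)%:E)%E.
    by move=> ->; rewrite -!EFinM; congr EFin; ring.
  have WE : (P *m (X *m U))^H *m D *m (P *m (X *m U)) = U^H *m W X *m U.
    by rewrite AE !ctrM !mulmxA.
  have VE : (v x)^H *m W X *m v x = (P *m (X *m v x))^H *m D *m (P *m (X *m v x)).
    by rewrite AE !ctrM !mulmxA.
  rewrite /joint_integrand /G (ov z x zx) /Q /detW WE (det1D_unitary y _ uU) VE.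
  apply: aux; rewrite nsq_sum_diag /= -mulrA; congr (expR (- (_ * _))).
  rewrite mulr_sumr; apply: eq_bigr => i _; rewrite rc mulrCA -nsqM vE; congr (_ * nsq _).
  by rewrite -!scalemxAr [LHS]mxE; congr (_ * _); rewrite colE !mulmxA -colE [LHS]mxE.
have iU := @int_coords_mx_isometry R n n hidx (mulmxr U) (fun X z => G (P *m X) z) hidx_inj
  (mQ _ (mxmeasM (mxmeas_cst P) (@mxmeas_at R _ _ hidx))) (fun _ _ _ _ => erefl)
  (fun M => nsq_unitary_mul M uU).
have iP := @int_coords_mx_isometry R n n hidx (mulmx P) G hidx_inj
  (mQ _ (@mxmeas_at R _ _ hidx)) (fun _ _ _ _ => erefl)
  (fun M => nsq_mul_unitary M uP).
transitivity (gaussC (locs hidx) (fun z => G (P *m H z) z) x).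
  exact: (congr1 (fun F => F x) iU).
transitivity (gaussC (locs hidx) (fun z => G (H z) z) x).
  exact: (congr1 (fun F => F x) iP).
have r0' : 0 <= r by rewrite rc.
have -> := @int_coords_pull R (@gauss R) (cblk (locs hidx)) (fun=> r%:E) _ wg (posm_kappa_integrand r yge0)
  (fun _ _ _ _ => erefl) (fun=> r0').
by rewrite (gauss_kappa yge0 r0') EFinM.
Qed.

Lemma kappa_ge0 r : 0 <= r -> 0 <= kappa d y r.
Proof.
move=> r0; rewrite -lee_fin; have := congr1 (fun F => F (fun=> 0)) (gauss_kappa yge0 r0).
move=> /= <-; exact: (posm_int_coords _ (weight_gauss R) (posm_kappa_integrand r yge0)).2.
Qed.

Lemma continuous_sum (I : Type) (s : seq I) (F : I -> R -> R) :
  (forall i, continuous (F i)) -> continuous (fun t : R => \sum_(i <- s) F i t).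
Proof.
move=> cF; elim: s => [|i s IH] t.
  by under eq_fun do rewrite big_nil; exact: cvg_cst.
by under eq_fun do rewrite big_cons; apply: cvgD; [exact: cF|exact: IH].
Qed.

Lemma continuous_kappa (p : R -> R) : continuous p -> (forall t, 0 <= p t) ->
  continuous (fun t : R => kappa d y (p t)).
Proof.
move=> cp p0; have cst_c (c : R) : continuous (fun _ : R => c) by move=> t; exact: cvg_cst.
have cD (f g : R -> R) : continuous f -> continuous g -> continuous (fun t : R => f t + g t).
  by move=> cf cg t; apply: cvgD; [exact: cf|exact: cg].
have cV (f : R -> R) : continuous f -> (forall t, f t != 0) -> continuous (fun t : R => (f t)^-1).
  by move=> cf f0 t; apply: cvgV => //; exact: cf.
have yp0 i t : 1 + y * p t * d i != 0.
  by apply: lt0r_neq0; rewrite ltr_pwDl// !mulr_ge0// ltW.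
rewrite /kappa; apply: continuous_sum => k; apply: continuousM_real; first exact: cst_c.
apply: continuousM_real.
  apply: (cD); first exact: cst_c.
  apply: continuousM_real; first exact: cst_c.
  apply: continuous_sum => i; apply: continuousM_real; first exact: cst_c.
  apply: (cV) => [|t]; last exact: yp0.
  apply: (cD); first exact: cst_c.
  by apply: continuousM_real; [apply: continuousM_real => //; exact: cst_c|exact: cst_c].
apply: (cV) => [|t]; last by apply: Pd_neq0 => i; exact: yp0.
move=> t; apply: (@continuous_comp _ _ _ (fun t => y * p t) (horner (Pd d))).
  by apply: continuousM_real => //; exact: cst_c.
exact: continuous_horner.
Qed.

Lemma ridge_integral x : gaussC (locs hidx) (fun x => (ridge A y (H x))%:E) x =
  (\int[@lebesgue_measure R]_(t in `[0%R, +oo[) (tau_density d y t)%:E)%E.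
Proof.
have wg := weight_gauss R.
have -> : (fun x => (ridge A y (H x))%:E) = gaussC (locs vidx) joint_integrand.
  by apply/funext => z; exact: ridge_joint.
have pJ : posm joint_integrand by apply: posmM; [exact: posm_det|exact: posm_vector].
have pe : perm_eq (cblk (locs hidx) ++ cblk (locs vidx)) (cblk (locs vidx) ++ cblk (locs hidx)).
  by rewrite perm_catC.
rewrite -int_coords_cat (int_coords_perm wg pJ pe) int_coords_cat.
(* [kappa] may have poles at negative r, whereas the law of |v|^2 is stated for functions continuous
   on the whole line; r is replaced by max(0, r). *)
pose p (t : R) := Num.max 0 t.
have p0 t : 0 <= p t by rewrite le_max lexx.
have cp : continuous p.
  move=> t; have c0 : {for t, continuous (cst 0 : R -> R^o)} by exact: cst_continuous.
  have c1 : {for t, continuous (id : R -> R^o)} by exact: cvg_id.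
  exact: (continuous_max c0 c1).
pose f (t : R) := p t * kappa d y (p t).
have cf : continuous f.
  by move=> t; apply: cvgM; [exact: cp|exact: continuous_kappa].
have f0 t : 0 <= t -> 0 <= f t by move=> t0; rewrite mulr_ge0 ?kappa_ge0.
have -> : gaussC (locs hidx) joint_integrand = fun x => (f (sumsq (cblk (locs vidx)) x))%:E.
  apply/funext => z; rewrite joint_H -sumsq_v /f /p max_r//.
  exact: sumsq_ge0.
have uv : uniq (locs vidx) by rewrite map_inj_uniq ?enum_uniq//; exact: vidx_inj.
have sv : size (cblk (locs vidx)) = n.*2.
  by rewrite size_cblk size_map -cardE card_prod !card_ord muln1.
rewrite (@int_coords_gauss_sumsq R n (cblk (locs vidx)) isT (uniq_cblk uv) sv f x cf f0).
rewrite -kappa_integral//; apply: eq_integral => t /set_mem/=.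
rewrite in_itv/= andbT => t0; congr EFin; rewrite /f /p max_r// /chi_density /=.
have f1 : (n`!%:R : R) = n%:R * m`!%:R by rewrite -natrM -factS.
have n1 : n%:R != 0 :> R by rewrite pnatr_eq0.
have m1 : m`!%:R != 0 :> R by rewrite pnatr_eq0 -lt0n fact_gt0.
rewrite f1 exprS; move: n1 m1; move: (n%:R : R) (m`!%:R : R) => a b a0 b0.
by field; rewrite a0 b0.
Qed.

End RidgeIntegral.
End Kappa.

(** * From resolvents to all test functions *)

Section Spectrum.
Variables (R : realType) (m : nat).
Local Notation n := m.+1.
Local Notation C := R[i].
Local Notation points := (points R).
Variables (W : points -> 'M[C]_n).
Hypotheses (pW : forall x, psd (W x)) (mW : mxmeas W).

Definition eig (x : points) (i : 'I_n) : R := complex.Re (spectral_diag (W x) 0 i).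

Definition spectral_sum (f : R -> R) (x : points) : R := \sum_i f (eig x i).

Lemma eig_ge0 x i : 0 <= eig x i.
Proof. exact: (psd_spectral (pW x)).1. Qed.

Fixpoint mxpow (k : nat) (x : points) : 'M[C]_n := if k is k'.+1 then W x *m mxpow k' x else 1%:M.

Lemma mxpowE k x : mxpow k x = (spectralmx (W x))^H *m diag_mx (\row_i ((eig x i ^+ k)%:C)%C) *m spectralmx (W x).
Proof.
have [P1 P2] := unitarymx_ctr (spectral_unitarymx (W x)).
have WE := (psd_spectral (pW x)).2.
elim: k => [|k IH] /=.
  rewrite (_ : diag_mx _ = 1%:M) ?mulmx1 ?P2//.
  by apply/matrixP => i j; rewrite !mxE expr0.
rewrite IH {1}WE -!mulmxA (mulmxA (spectralmx (W x))) P1 mul1mx.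
congr (_ *m _); rewrite !mulmxA; congr (_ *m _).
by rewrite mulmx_diag; congr diag_mx; apply/rowP => i; rewrite !mxE exprS rmorphM.
Qed.

(** Measurability of single eigenvalues, in the order chosen by [spectral_diag], is not claimed.
    Their power sums are traces of powers of W, hence polynomial in its entries. *)
Lemma measurable_spectral_sumX k : measurable_fun setT (spectral_sum (fun t => t ^+ k)).
Proof.
have mk : mxmeas (mxpow k).
  elim: k => [|k IH]; first exact: mxmeas_cst.
  exact: mxmeasM.
rewrite (_ : spectral_sum _ = fun x => complex.Re (\tr (mxpow k x))); last first.
  apply/funext => x; rewrite mxpowE -mulmxA mxtrace_mulC -mulmxA.
  have [P1 P2] := unitarymx_ctr (spectral_unitarymx (W x)).
  rewrite P1 mulmx1 mxtrace_diag (eq_bigr (fun i => ((eig x i ^+ k)%:C)%C)) => [|i _]; last by rewrite mxE.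
  by rewrite -rmorph_sum.
suff h : cmeas (fun x => \tr (mxpow k x)) by exact: h.1.
by apply: cmeas_sum => i; exact: mk.
Qed.

Lemma measurable_spectral_sum_poly (p : {poly R}) : measurable_fun setT (spectral_sum (horner p)).
Proof.
rewrite (_ : spectral_sum _ = fun x => \sum_(k < size p) p`_k * spectral_sum (fun t => t ^+ k) x).
  by apply: measurable_sum => k; apply: measurable_funM => //; exact: measurable_spectral_sumX.
apply/funext => x; rewrite /spectral_sum; under [RHS]eq_bigr do rewrite mulr_sumr.
rewrite exchange_big/=; apply: eq_bigr => i _; exact: horner_coef.
Qed.

(** A pointwise limit of the polynomial case: the N-th polynomial is within 1/(N+1) of [f] on
    [0, N+1]. *)
Lemma measurable_spectral_sum (f : R -> R) : continuous f -> measurable_fun setT (spectral_sum f).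
Proof.
move=> cf.
have /choice[p pP] : forall N : nat, exists p : {poly R}, forall t : R, 0 <= t <= N.+1%:R -> `|f t - p.[t]| <= N.+1%:R^-1.
  move=> N; have N0 : 0 < N.+1%:R :> R by rewrite ltr0n.
  have cg := continuous_comp_real (@continuous_scale_real R N.+1%:R) cf.
  have Ni : 0 < (N.+1%:R : R)^-1 by rewrite invr_gt0.
  have [q qP] := weierstrass cg Ni.
  exists (q \Po (N.+1%:R^-1 *: 'X)) => t /andP[t0 tN].
  rewrite horner_comp hornerZ hornerX.
  have := qP (N.+1%:R^-1 * t); rewrite mulrAC mulVf ?lt0r_neq0// mul1r; apply.
  by rewrite mulr_ge0 ?(ltW Ni)//= mulrC ler_pdivrMr// mul1r.
apply: (@measurable_fun_cvg _ _ _ _ (fun N => spectral_sum (horner (p N)))).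
  by move=> N; exact: measurable_spectral_sum_poly.
have H x i : (fun N => (p N).[eig x i]) @ \oo --> f (eig x i).
  apply/cvgrPdist_le => e e0; near=> N.
  apply: (@le_trans _ _ (N.+1%:R^-1)).
    apply: pP; rewrite eig_ge0/=; near: N.
    have := nbhs_infty_ger (eig x i); apply: filterS => N iN.
    by rewrite (le_trans iN)// ler_nat.
  near: N; have := @cvg_harmonic R; move/cvgrPdist_le => /(_ e e0).
  apply: filterS => N; rewrite /harmonic sub0r normrN ger0_norm//= invr_ge0 ler0n.
move=> x _; rewrite /spectral_sum.
elim: (index_enum _) => [|i r IH].
  by under eq_fun do rewrite big_nil; rewrite big_nil; exact: cvg_cst.
by under eq_fun do rewrite big_cons; rewrite big_cons; apply: cvgD; [exact: H|exact: IH].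
Unshelve. all: by end_near. Qed.

Lemma spectral_sum_bound (f : R -> R) (B : R) x : (forall t : R, 0 <= t -> `|f t| <= B) ->
  `|spectral_sum f x| <= n%:R * B.
Proof.
move=> fB; rewrite (le_trans (ler_norm_sum _ _ _))//.
apply: (@le_trans _ _ (\sum_(i < n) B)); last by rewrite sumr_const card_ord mulr_natl.
by apply: ler_sum => i _; apply: fB; exact: eig_ge0.
Qed.

Lemma spectral_sum_lin (a : R) f g x :
  spectral_sum (fun t => a * f t + g t) x = a * spectral_sum f x + spectral_sum g x.
Proof. by rewrite /spectral_sum mulr_sumr -big_split. Qed.

Lemma integrable_spectral_sum s (f : R -> R) : bcont f ->
  (gausspt s).-integrable setT (EFin \o spectral_sum f).
Proof.
move=> [cf [B fB]].
apply: (@le_integrable _ _ _ (gausspt s) _ measurableT _ (cst (n%:R * B)%:E)).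
- by apply/measurable_EFinP; exact: measurable_spectral_sum.
- by move=> x _ /=; rewrite lee_fin (le_trans (spectral_sum_bound x fB))// ler_norm.
- exact: finite_measure_integrable_cst.
Qed.

End Spectrum.

(** * The functions f_k as linear functionals of f *)

Section Kernels.
Variable R : realType.
Local Notation mu := (@lebesgue_measure R).
Local Notation half := (`[0%R, +oo[%classic : set R).

Definition fk_integrand (n k : nat) (f : R -> R) (x t : R) : R :=
  expR (- t) * (t * x) ^+ (n - k.+1) * f (t * x).

Definition fk_integrable n f x := forall k, mu.-integrable half (EFin \o fk_integrand n k f x).

Lemma fk_lin n k a f g (x : R) : fk_integrable n f x -> fk_integrable n g x ->
  fk n (fun t => a * f t + g t) k x = a * fk n f k x + fk n g k x.
Proof.
move=> If Ig; have If' := If k; have Ig' := Ig k.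
have mH : measurable half by exact: measurable_itv.
transitivity (\int[mu]_(t in half) (a * fk_integrand n k f x t + fk_integrand n k g x t))%R.
  by apply: eq_Rintegral => t _; rewrite /fk_integrand; ring.
rewrite RintegralD//; last first.
  rewrite (_ : _ \o _ = fun t => (a%:E * (EFin \o fk_integrand n k f x) t)%E).
    exact: integrableZl.
  by apply/funext => t /=; rewrite EFinM.
by congr (_ + _); exact: RintegralZl.
Qed.

Lemma bcont_fk_integrable n (f : R -> R) (x : R) : 0 < x -> bcont f -> fk_integrable n f x.
Proof.
move=> x0 [cf [B fB]] k.
apply: (@integrable_dominated R _ (fun t => (B *: (x *: 'X) ^+ (n - k.+1)).[t] * expR (- (1 * t)))).
- move=> t _; apply: continuousM_real.
    apply: continuousM_real; first exact: continuous_expRN.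
    exact: (continuous_comp_real (@continuous_scale_real R x) (@exprn_continuous R (n - k.+1))).
  exact: (continuous_comp_real (@continuous_scale_real R x) cf).
- move=> t t0; have tx : 0 <= t * x by rewrite mulr_ge0// ltW.
  rewrite /fk_integrand hornerZ horner_exp hornerZ hornerX mul1r !normrM.
  rewrite (ger0_norm (expR_ge0 _)) (ger0_norm (exprn_ge0 _ tx)) [x * t]mulrC.
  rewrite -[leRHS]mulrA [leRHS]mulrC [X in _ <= X * _]mulrC ler_wpM2l ?fB//.
  by rewrite mulr_ge0 ?expR_ge0 ?exprn_ge0.
- exact: integrable_poly_expRM.
Qed.

Lemma fk_norm n k (f : R -> R) (B x : R) : 0 < x -> bcont f -> (forall t : R, 0 <= t -> `|f t| <= B) ->
  `|fk n f k x| <= B * fk n (fun=> 1) k x.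
Proof.
move=> x0 bf fB; have bB : bcont (fun=> B : R).
  by split; [move=> t; exact: cvg_cst|exists `|B| => t _].
have b1 : bcont (fun=> 1 : R).
  by split; [move=> t; exact: cvg_cst|exists `|1| => t _].
have If := bcont_fk_integrable n x0 bf k.
have IB := bcont_fk_integrable n x0 bB k.
have I1 := bcont_fk_integrable n x0 b1 k.
have mH : measurable half by exact: measurable_itv.
apply: (@le_trans _ _ (\int[mu]_(t in half) `|fk_integrand n k f x t|)%R).
  by apply: le_normr_Rintegral If; exact: measurable_itv.
apply: (@le_trans _ _ (\int[mu]_(t in half) fk_integrand n k (fun=> B) x t)%R).
  apply: le_Rintegral => //; first exact: integrable_norm.
  move=> t; rewrite /= in_itv/= andbT => t0; have tx : 0 <= t * x by rewrite mulr_ge0// ltW.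
  rewrite /fk_integrand !normrM (ger0_norm (expR_ge0 _)) (ger0_norm (exprn_ge0 _ tx)).
  by rewrite ler_wpM2l ?mulr_ge0 ?expR_ge0 ?exprn_ge0 ?fB.
have E : (\int[mu]_(t in half) (B * fk_integrand n k (fun=> 1) x t))%R = B * fk n (fun=> 1) k x.
  exact: RintegralZl.
rewrite -E (_ : (\int[mu]_(t in half) fk_integrand n k (fun=> B) x t)%R =
  (\int[mu]_(t in half) (B * fk_integrand n k (fun=> 1) x t))%R)//.
by apply: eq_Rintegral => t _; rewrite /fk_integrand; ring.
Qed.

Lemma fk1 n k (x : R) : 0 < x -> fk n (fun=> 1) k x = (n - k.+1)`!%:R * x ^+ (n - k.+1).
Proof.
move=> x0; rewrite /fk /Rintegral.
have xq : 0 <= x ^+ (n - k.+1) by rewrite exprn_ge0// ltW.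
have := @gamma_integral R 1 (n - k.+1) ltr01; rewrite expr1n divr1 => H.
rewrite (_ : (\int[mu]_(t in half) _)%E = ((x ^+ (n - k.+1))%:E * \int[mu]_(t in half) (t ^+ (n - k.+1) * expR (- (1 * t)))%:E)%E).
  by rewrite H -EFinM/= mulrC.
rewrite -ge0_integralZl; first last.
- by rewrite lee_fin.
- by move=> t; rewrite /= in_itv/= andbT => t0; rewrite lee_fin mulr_ge0 ?exprn_ge0 ?expR_ge0.
- apply/measurable_EFinP; apply: measurable_funTS.
  apply: continuous_measurable_fun => t.
  under eq_fun do rewrite -hornerXn; exact: continuous_poly_expRM.
- exact: measurable_itv.
by apply: eq_integral => t _; rewrite -EFinM; congr EFin; rewrite mul1r exprMn; ring.
Qed.

End Kernels.

(** * Comparison of the two sides for a general test function *)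

Section Assembly.
Variables (R : realType) (m : nat).
Local Notation n := m.+1.
Local Notation C := R[i].
Local Notation points := (points R).
Local Notation mu := (@lebesgue_measure R).
Local Notation half := (`[0%R, +oo[%classic : set R).
Variables (d : 'I_n -> R) (A P : 'M[C]_n).
Hypotheses (d0 : forall i, 0 < d i) (d_inj : injective d) (uP : P \is unitarymx)
  (AE : A = P^H *m diag_mx (\row_i ((d i)%:C)%C) *m P).
Local Notation H := (@mxat R n n (@hidx m)).

Definition wishart (x : points) : 'M[C]_n := (H x)^H *m A *m H x.

Let pW x : psd (wishart x) := psd_A d0 AE (H x).
Let mW : mxmeas wishart := mxmeas_W A.
Local Notation S := (spectral_sum wishart).
Variable s : seq nat.
Hypothesis sE : perm_eq (cblk (locs (@hidx m))) s.

(** The right-hand side of the theorem, each quotient of determinants being expanded by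
    [det_replace_row]; in this form it is visibly linear in [f]. *)
Definition psi (f : R -> R) : R :=
  \sum_(k < n) \sum_(i < n) ((n - k.+1)`!%:R^-1 * fk n f k (d i)) * lagr d i k.

Definition defect (f : R -> R) : R := (\int[gausspt s]_x S f x)%R - psi f.

Lemma psi_lin a f g : (forall i, fk_integrable n f (d i)) -> (forall i, fk_integrable n g (d i)) ->
  psi (fun t => a * f t + g t) = a * psi f + psi g.
Proof.
move=> If Ig; rewrite /psi mulr_sumr -big_split/=; apply: eq_bigr => k _.
rewrite mulr_sumr -big_split/=; apply: eq_bigr => i _.
by rewrite fk_lin//; ring.
Qed.

Lemma defect_lin a f g : bcont f -> bcont g ->
  defect (fun t => a * f t + g t) = a * defect f + defect g.
Proof.
move=> bf bg; rewrite /defect psi_lin; last 2 first.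
- by move=> i; exact: bcont_fk_integrable.
- by move=> i; exact: bcont_fk_integrable.
have bcst0 : bcont (fun=> 0 : R).
  by split; [move=> t; exact: cvg_cst|exists 0 => t _; rewrite normr0].
have If := integrable_spectral_sum pW mW s bf.
have Ig := integrable_spectral_sum pW mW s bg.
have Iaf : (gausspt s).-integrable setT (EFin \o (fun x => a * S f x)).
  rewrite (_ : _ \o _ = fun x => (a%:E * (EFin \o S f) x)%E); first exact: integrableZl.
  by apply/funext => x /=; rewrite EFinM.
have -> : (\int[gausspt s]_x S (fun t => a * f t + g t) x =
    \int[gausspt s]_x (a * S f x + S g x))%R.
  by apply: eq_Rintegral => x _; exact: spectral_sum_lin.
rewrite (RintegralD measurableT Iaf Ig).
have -> : (\int[gausspt s]_x (a * S f x) = a * \int[gausspt s]_x S f x)%R by exact: RintegralZl.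
by ring.
Qed.

(** The term n bounds the mean of a sum over n eigenvalues, the double sum bounds [psi]. *)
Definition defect_bound : R := n%:R + \sum_(k < n) \sum_(i < n)
  `|(n - k.+1)`!%:R^-1 * lagr d i k| * fk n (fun=> 1) k (d i).

Lemma defect_bound_ge0 : 0 <= defect_bound.
Proof.
rewrite addr_ge0// sumr_ge0// => k _; rewrite sumr_ge0// => i _.
by rewrite mulr_ge0// fk1// mulr_ge0// exprn_ge0// ltW.
Qed.

Lemma defect_norm f B : bcont f -> (forall t : R, 0 <= t -> `|f t| <= B) ->
  `|defect f| <= defect_bound * B.
Proof.
move=> bf fB; have If := integrable_spectral_sum pW mW s bf.
rewrite /defect (le_trans (ler_normB _ _))// mulrDl lerD//.
  apply: (le_trans (le_normr_Rintegral measurableT If)).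
  apply: (@le_trans _ _ (\int[gausspt s]_x (n%:R * B))%R).
    apply: le_Rintegral => //; first exact: integrable_norm.
      exact: finite_measure_integrable_cst.
    by move=> x _; exact: spectral_sum_bound.
  rewrite /Rintegral -[X in fine X]/(\int[gausspt s]_x (cst (n%:R * B)%:E) x)%E integral_cst//.
  by rewrite -[X in (_ * X)%E]/(gausspt s setT) probability_setT mule1.
rewrite /psi (le_trans (ler_norm_sum _ _ _))// mulr_suml ler_sum// => k _.
rewrite (le_trans (ler_norm_sum _ _ _))// mulr_suml ler_sum// => i _.
rewrite mulrAC normrM -mulrA ler_wpM2l// mulrC.
exact: fk_norm.
Qed.

(** The zeroth power of [inv1], which [geom] does not reach. Interpolation at Y = 0 shows that each
    k contributes 1 to [psi], and W has n eigenvalues. *)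
Lemma defect1 : defect (fun=> 1) = 0.
Proof.
rewrite /defect; have -> : (\int[gausspt s]_x S (fun=> 1) x)%R = n%:R.
  rewrite (_ : (fun x => S (fun=> 1) x) = fun=> n%:R); last first.
    by apply/funext => x; rewrite /spectral_sum sumr_const card_ord.
  rewrite /Rintegral -[X in fine X]/(\int[gausspt s]_x (cst n%:R%:E) x)%E integral_cst//.
  by rewrite -[X in (_ * X)%E]/(gausspt s setT) probability_setT mule1.
apply/eqP; rewrite subr_eq0; apply/eqP; rewrite /psi.
rewrite (eq_bigr (fun=> 1)) => [|k _]; first by rewrite sumr_const card_ord.
have := @lagr_resolvent R n d d_inj k 0.
have h0 i : 1 + 0 * d i != 0 by rewrite mul0r addr0 oner_neq0.
have P1 : (Pd d).[0] = 1.
  by rewrite horner_Pd; apply: big1 => i _; rewrite mul0r addr0.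
move=> /(_ h0); rewrite P1 divr1 horner_coef0 coef_take_poly/= -horner_coef0 P1 => E.
transitivity (\sum_i d i ^+ (n - k.+1) / (1 + 0 * d i) * lagr d i k); last exact: E.
apply: eq_bigr => i _.
by rewrite mul0r addr0 divr1 fk1// mulKf// pnatr_eq0 -lt0n fact_gt0.
Qed.

(** The absolute value changes nothing on the half-line and makes the function continuous on the
    whole line for y > 0. *)
Definition res (y t : R) : R := (1 + y * `|t|)^-1.

Lemma bcont_res y : 0 < y -> bcont (res y).
Proof.
move=> y0; split.
  move=> t; apply: cvgV; first by apply: lt0r_neq0; rewrite ltr_pwDl// mulr_ge0// ltW.
  apply: cvgD; first exact: cvg_cst.
  by apply: cvgM; [exact: cvg_cst|exact: (@norm_continuous _ R^o)].
exists 1 => t t0; have h : 1 <= 1 + y * `|t| by rewrite lerDl mulr_ge0// ltW.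
rewrite ger0_norm ?invr_ge0 ?(le_trans ler01)// invf_le1//.
exact: lt_le_trans h.
Qed.

Lemma Rintegral_sum (I : Type) (r : seq I) (F : I -> R -> R) :
  (forall i, mu.-integrable half (EFin \o F i)) ->
  mu.-integrable half (EFin \o (fun t => \sum_(i <- r) F i t)) /\
  (\int[mu]_(t in half) (\sum_(i <- r) F i t) = \sum_(i <- r) \int[mu]_(t in half) F i t)%R.
Proof.
move=> iF; have mH : measurable half by exact: measurable_itv.
elim: r => [|i r [I1 E1]].
  rewrite big_nil; have E : (fun t : R => \sum_(i <- [::]) F i t) = fun=> 0.
    by apply/funext => t; rewrite big_nil.
  rewrite E; split; first exact: integrable0.
  by rewrite /Rintegral integral0_eq.
have E : (fun t : R => \sum_(i <- i :: r) F i t) = fun t => F i t + \sum_(i <- r) F i t.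
  by apply/funext => t; rewrite big_cons.
rewrite E big_cons; split; last by rewrite RintegralD// E1.
rewrite (_ : EFin \o _ = ((EFin \o F i) \+ (EFin \o (fun t : R => (\sum_(i <- r) F i t)%R)))%E).
  by apply: integrableD => //; exact: measurable_itv.
by apply/funext => t /=; rewrite EFinD.
Qed.

(** Interpolation is applied under the integral sign, at Y = yt for each t. *)
Lemma psi_res y : 0 < y -> psi (res y) = (\int[mu]_(t in half) tau_density d y t)%R.
Proof.
move=> y0; pose F k i (t : R) := lagr d i k / (n - k.+1)`!%:R * fk_integrand n k (res y) (d i) t.
have iF k i : mu.-integrable half (EFin \o F k i).
  have := bcont_fk_integrable n (d0 i) (bcont_res y0) k => h.
  rewrite (_ : _ \o _ = fun t => ((lagr d i k / (n - k.+1)`!%:R)%:E * (EFin \o fk_integrand n k (res y) (d i)) t)%E).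
    by apply: integrableZl => //; exact: measurable_itv.
  by apply/funext => t /=; rewrite EFinM.
have FE k i : (\int[mu]_(t in half) F k i t)%R = ((n - k.+1)`!%:R^-1 * fk n (res y) k (d i)) * lagr d i k.
  have h := bcont_fk_integrable n (d0 i) (bcont_res y0) k.
  have mH : measurable half by exact: measurable_itv.
  rewrite /F RintegralZl//.
  by rewrite [X in _ * X](_ : _ = fk n (res y) k (d i))//; ring.
transitivity (\sum_(k < n) \int[mu]_(t in half) (\sum_(i < n) F k i t))%R.
  apply: eq_bigr => k _; rewrite (Rintegral_sum _ (iF k)).2.
  by apply: eq_bigr => i _; rewrite FE.
rewrite -(Rintegral_sum _ (fun k => (Rintegral_sum _ (iF k)).1)).2.
apply: eq_Rintegral => t /set_mem/=; rewrite in_itv/= andbT => t0.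
apply: eq_bigr => k _.
have Y0 i : 1 + y * t * d i != 0.
  by apply: lt0r_neq0; rewrite ltr_pwDl// !mulr_ge0// ltW.
rewrite -(lagr_resolvent d_inj k Y0) !mulr_sumr; apply: eq_bigr => i _.
rewrite /F /fk_integrand /res ger0_norm ?mulr_ge0 ?(ltW (d0 i))// exprMn mulrA.
move: (Y0 i); rewrite !mulrA; move: (1 + _) => q q0.
have f0 : ((n - k.+1)`!%:R : R) != 0 by rewrite pnatr_eq0 -lt0n fact_gt0.
by move: f0; move: ((n - k.+1)`!%:R : R) => g g0; field; rewrite g0 q0.
Qed.

Lemma defect_res y : 0 < y -> defect (res y) = 0.
Proof.
move=> y0; rewrite /defect psi_res//; apply/eqP; rewrite subr_eq0; apply/eqP.
rewrite /Rintegral; congr fine; rewrite -(ridge_integral d0 uP AE y0 (fun=> 0)).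
have SE x : S (res y) x = ridge A y (H x).
  apply: eq_bigr => i _; rewrite /res ger0_norm//; exact: eig_ge0.
under eq_integral do rewrite SE.
have pr : posm (fun x => (ridge A y (H x))%:E).
  rewrite (_ : (fun x => _) = EFin \o S (res y)); last by apply/funext => x; rewrite /= SE.
  apply: posm_EFin => [|x].
    by apply: measurable_spectral_sum => //; exact: (bcont_res y0).1.
  rewrite SE sumr_ge0// => i _; rewrite invr_ge0 addr_ge0// mulr_ge0 ?(ltW y0)//.
  exact: (psd_spectral (pW x)).1.
rewrite integral_gausspt//.
by rewrite -(int_coords_perm (weight_gauss R) pr sE).
Qed.

Lemma defectZ a f : bcont f -> defect (fun t => a * f t) = a * defect f.
Proof.
move=> bf; have b0 : bcont (fun=> 0 : R).
  by split; [move=> t; exact: cvg_cst|exists 0 => t _; rewrite normr0].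
have H0 : defect (fun=> 0) = 0.
  apply/normr0_eq0/le_anti; rewrite normr_ge0 andbT.
  by rewrite -[leRHS](mulr0 defect_bound); apply: defect_norm => // t _; rewrite normr0.
rewrite -[RHS]addr0 -H0 -defect_lin//; congr defect.
by apply/funext => t; rewrite addr0.
Qed.

Definition inv1 (t : R) : R := (1 + `|t|)^-1.

Lemma inv1_gt0 t : 0 < inv1 t.
Proof. by rewrite invr_gt0 ltr_pwDl. Qed.

Lemma inv1_le1 t : inv1 t <= 1.
Proof. by rewrite invf_le1 ?lerDl// ltr_pwDl. Qed.

Lemma continuous_inv1 : continuous inv1.
Proof.
move=> t; apply: cvgV; first by apply: lt0r_neq0; rewrite ltr_pwDl.
by apply: cvgD; [exact: cvg_cst|exact: (@norm_continuous _ R^o)].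
Qed.

(* [geom e 0] is a multiple of [res], and [geom e k] tends to [inv1 ^+ k.+1] with [e]:
   this extracts the powers of [inv1] from the resolvents one by one. *)
Definition geom (e : R) (k : nat) (t : R) : R := inv1 t ^+ k.+1 / (1 - e * inv1 t).

Lemma geom_den e t : 0 < e <= 2^-1 -> 2^-1 <= 1 - e * inv1 t.
Proof.
move=> /andP[e0 e2]; have := ler_pM (ltW e0) (ltW (inv1_gt0 t)) e2 (inv1_le1 t).
by rewrite mulr1; move: (e * inv1 t) => z h; lra.
Qed.

Lemma bcont_geom e k : 0 < e <= 2^-1 -> bcont (geom e k) /\ forall t : R, `|geom e k t| <= 2.
Proof.
move=> e2; have den t := geom_den t e2.
have den0 t : 0 < 1 - e * inv1 t by rewrite (lt_le_trans _ (den t))// invr_gt0.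
have bd t : `|geom e k t| <= 2.
  rewrite ger0_norm ?mulr_ge0 ?exprn_ge0 ?invr_ge0 ?(ltW (den0 t)) ?(ltW (inv1_gt0 t))//.
  rewrite -[leRHS]mul1r ler_pM ?exprn_ge0 ?invr_ge0 ?(ltW (den0 t)) ?(ltW (inv1_gt0 t))//.
    by rewrite exprn_ile1 ?inv1_le1 ?(ltW (inv1_gt0 t)).
  by rewrite invf_ple ?posrE.
split=> //; split; last by exists 2.
apply: continuousM_real.
  exact: (continuous_comp_real continuous_inv1 (@exprn_continuous R k.+1)).
move=> t; apply: cvgV; first exact: lt0r_neq0.
apply: cvgB; first exact: cvg_cst.
by apply: cvgM; [exact: cvg_cst|exact: continuous_inv1].
Qed.

Lemma geomS e k t : 0 < e <= 2^-1 -> inv1 t ^+ k.+1 = - e * geom e k.+1 t + geom e k t.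
Proof.
move=> e2; have h : 1 - e * inv1 t != 0.
  by apply: lt0r_neq0; rewrite (lt_le_trans _ (geom_den t e2))// invr_gt0.
by rewrite /geom [in RHS]exprS; move: h; move: (inv1 t) (inv1 t ^+ k.+1) => a b h; field.
Qed.

Lemma defect_geom k e : 0 < e <= 2^-1 -> defect (geom e k) = 0.
Proof.
elim: k e => [|k IH] e e2; have /andP[e0 eh] := e2.
  have e1 : 0 < 1 - e by rewrite subr_gt0 (le_lt_trans eh)// invf_lt1 ?ltr1n.
  have y0 : 0 < (1 - e)^-1 by rewrite invr_gt0.
  (* The quotient is 1/(1 - e + |t|), a multiple of the resolvent at y = 1/(1 - e). *)
  have -> : geom e 0 = fun t => (1 - e)^-1 * res (1 - e)^-1 t.
    apply/funext => t; have h : 1 + `|t| != 0 by apply: lt0r_neq0; rewrite ltr_pwDl.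
    have h2 : 1 - e + `|t| != 0 by apply: lt0r_neq0; rewrite ltr_pwDl.
    have h1 : 1 - e != 0 by exact: lt0r_neq0.
    rewrite /geom /res /inv1 expr1; move: h h2 h1; move: `|t| => a h h2 h1.
    have -> : 1 - e / (1 + a) = (1 - e + a) / (1 + a) by rewrite -[X in X - _](divff h) -mulrBl addrAC.
    have -> : 1 + (1 - e)^-1 * a = (1 - e + a) / (1 - e) by rewrite [RHS]mulrDl divff// [_^-1 * a]mulrC.
    by rewrite !invf_div mulrA mulVf// mul1r mulrA mulVf// mul1r.
  by rewrite defectZ ?defect_res ?mulr0//; exact: bcont_res.
(* The induction hypothesis holds for every admissible e', while the left side does not involve e'.
   It is at most e' times a fixed bound, hence 0, and division by the given [e] settles
   [geom e k.+1]. *)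
have L (e' : R) : 0 < e' <= 2^-1 -> defect (fun t => inv1 t ^+ k.+1) = - e' * defect (geom e' k.+1).
  move=> e2'; rewrite (_ : (fun t => _) = fun t => - e' * geom e' k.+1 t + geom e' k t).
    by rewrite defect_lin ?IH ?addr0//; [exact: (bcont_geom k.+1 e2').1|exact: (bcont_geom k e2').1].
  by apply/funext => t; exact: geomS.
have D0 : defect (fun t => inv1 t ^+ k.+1) = 0.
  apply: (@eq0_le_eps R _ (defect_bound * 2)); first by rewrite mulr_ge0// defect_bound_ge0.
  move=> r r0; pose e' := Num.min r 2^-1.
  have e2' : 0 < e' <= 2^-1 by rewrite lt_min r0 invr_gt0 ltr0n /= ge_min lexx orbT.
  have /andP[e0' _] := e2'.
  rewrite (L e' e2') normrM normrN (gtr0_norm e0') mulrC.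
  have := defect_norm (bcont_geom k.+1 e2').1 (fun t _ => (bcont_geom k.+1 e2').2 t) => h.
  apply: ler_pM => //; first exact: ltW.
  by rewrite ge_min lexx.
have /eqP := L e e2; rewrite D0 eq_sym mulf_eq0 oppr_eq0 => /orP[|/eqP//].
by rewrite gt_eqF.
Qed.

Lemma defect_powers k : defect (fun t => inv1 t ^+ k) = 0.
Proof.
case: k => [|k]; first by rewrite -[RHS]defect1; congr defect; apply/funext => t; rewrite expr0.
have e2 : 0 < (2^-1 : R) <= 2^-1 by rewrite invr_gt0 ltr0n lexx.
rewrite (_ : (fun t => _) = fun t => - 2^-1 * geom 2^-1 k.+1 t + geom 2^-1 k t).
  rewrite defect_lin ?defect_geom ?mulr0 ?addr0//.
    exact: (bcont_geom k.+1 e2).1.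
  exact: (bcont_geom k e2).1.
by apply/funext => t; exact: geomS.
Qed.

Lemma defect_compact f : continuous f -> (exists N : R, forall t : R, N <= t -> f t = 0) -> defect f = 0.
Proof.
apply: (@functional_density R defect defect_bound inv1 (fun s => s^-1 - 1)).
- exact: defect_bound_ge0.
- by move=> a g h; exact: defect_lin.
- by move=> g B; exact: defect_norm.
- exact: continuous_inv1.
- by move=> t _; rewrite inv1_gt0 inv1_le1.
- by move=> t t0; rewrite /inv1 invrK ger0_norm// addrC addKr.
- move=> z z0; apply: cvgB; last exact: cvg_cst.
  by apply: cvgV; [exact: lt0r_neq0|exact: cvg_id].
- move=> N; exists (`|N| + 1)^-1; first by rewrite invr_gt0 ltr_wpDl.
  move=> z /andP[z0 zN]; rewrite lerBrDr (@le_trans _ _ (`|N| + 1))//.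
    by rewrite lerD2r ler_norm.
  rewrite -[leLHS]invrK lef_pV2 ?posrE ?invr_gt0 ?ltr_wpDl//.
  exact: ltW.
- exact: defect_powers.
Qed.

Definition growth (f : R -> R) := forall a : R, 0 < a ->
  (\int[mu]_(t in half) (expR (- (a * t)) * f t ^+ 2)%:E < +oo)%E.

(** By |ab| <= a^2 + b^2 with a = (tx)^(n-k-1) and b = f(tx). The term exp(-t)f(tx)^2 is integrable
    by the growth condition at 1/x, after a change of scale. *)
Lemma growth_fk_integrable (f : R -> R) (x : R) : 0 < x -> continuous f -> growth f -> fk_integrable n f x.
Proof.
move=> x0 cf gf k.
pose g (t : R) := expR (- (x^-1 * t)) * f t ^+ 2.
have cg : continuous g.
  apply: continuousM_real.
    apply: (@continuous_comp_real R (fun t => x^-1 * t) (fun t => expR (- t))).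
      by move=> t; apply: cvgM; [exact: cvg_cst|exact: cvg_id].
    exact: continuous_expRN.
  exact: (continuous_comp_real cf (@exprn_continuous R 2)).
pose h (t : R) := g (x * t + 0).
have hE t : h t = expR (- t) * f (t * x) ^+ 2.
  by rewrite /h /g addr0 mulKf ?gt_eqF// [x * t]mulrC.
have ch : continuous h.
  apply: (@continuous_comp_real R (fun t => x * t + 0) g) => //.
  move=> t; apply: cvgD; last exact: cvg_cst.
  by apply: cvgM; [exact: cvg_cst|exact: cvg_id].
have mH : measurable half by exact: measurable_itv.
have ih : mu.-integrable half (EFin \o h).
  apply/integrableP; split.
    by apply/measurable_EFinP; apply: measurable_funTS; exact: continuous_measurable_fun.
  have h0 t : 0 <= h t by rewrite hE mulr_ge0 ?expR_ge0 ?sqr_ge0.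
  under eq_integral do rewrite /= ger0_norm//.
  rewrite integral_mkcond (_ : (_ \_ half)%E = fun t => ((EFin \o g) \_ half)%E (x * t + 0)); last first.
    apply/funext => t; rewrite /patch /= !mem_setE /= !in_itv/= !andbT addr0.
    by rewrite pmulr_rge0//; case: ifP => //; rewrite /h addr0.
  rewrite integral_affine ?gt_eqF//; last 2 first.
  - apply/(measurable_restrictT _ _).1 => //.
    by apply/measurable_EFinP; apply: measurable_funTS; exact: continuous_measurable_fun.
  - move=> t; rewrite /patch; case: ifP => // _.
    by rewrite lee_fin mulr_ge0 ?expR_ge0 ?sqr_ge0.
  rewrite -integral_mkcond lte_mul_pinfty ?lee_fin ?invr_ge0//.
  by apply: gf; rewrite invr_gt0.
apply: (@integrable_dominated R _ (fun t => ((x *: 'X) ^+ (2 * (n - k.+1))).[t] * expR (- (1 * t)) + h t)).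
- move=> t _; apply: continuousM_real.
    apply: continuousM_real; first exact: continuous_expRN.
    exact: (continuous_comp_real (@continuous_scale_real R x) (@exprn_continuous R (n - k.+1))).
  exact: (continuous_comp_real (@continuous_scale_real R x) cf).
- move=> t t0; rewrite hE horner_exp hornerZ hornerX mul1r /fk_integrand !normrM.
  rewrite (ger0_norm (expR_ge0 _)) [x * t]mulrC mulnC exprM.
  have p0 : 0 <= (t * x) ^+ (n - k.+1) by rewrite exprn_ge0// mulr_ge0// ltW.
  rewrite (ger0_norm p0) -(real_normK (num_real (f (t * x)))).
  rewrite [_ * expR _]mulrC -mulrDr -mulrA ler_wpM2l ?expR_ge0//.
  move: p0 (normr_ge0 (f (t * x))); move: (_ ^+ (n - k.+1)) `|f _| => a b a0 b0.
  by have := sqr_ge0 (a - b); nra.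
- rewrite (_ : EFin \o _ = ((fun t => (((x *: 'X) ^+ (2 * (n - k.+1))).[t] * expR (- (1 * t)))%:E) \+ (EFin \o h))%E).
    by apply: integrableD => //; exact: integrable_poly_expRM.
  by apply/funext => t /=; rewrite EFinD.
Qed.

Lemma cvg_sum_seq (I : Type) (r : seq I) (u : I -> nat -> R) (l : I -> R) :
  (forall i, u i @ \oo --> l i) -> (fun N => \sum_(i <- r) u i N) @ \oo --> \sum_(i <- r) l i.
Proof.
move=> ul; elim: r => [|i r IH].
  by under eq_fun do rewrite big_nil; rewrite big_nil; exact: cvg_cst.
by under eq_fun do rewrite big_cons; rewrite big_cons; apply: cvgD; [exact: ul|exact: IH].
Qed.

(** Along the cutoffs the left side converges monotonically, and so does each f_k(d_i). [psi] itself
    need not be monotone: it is a fixed linear combination of the latter, with coefficients of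
    either sign. *)
Lemma psi_integral_ge0 (f : R -> R) : continuous f -> (forall t : R, 0 <= t -> 0 <= f t) -> growth f ->
  (\int[gausspt s]_x (S f x)%:E = (psi f)%:E)%E.
Proof.
move=> cf f0 gf; pose g (N : nat) (t : R) := f t * cutoff N%:R t.
have bg N : bcont (g N) by exact: bcont_cutoff.
have g0 N t : 0 <= t -> 0 <= g N t by move=> t0; rewrite mulr_ge0 ?f0 ?cutoff_ge0.
have gle N M t : 0 <= t -> (N <= M)%N -> g N t <= g M t.
  by move=> t0 NM; rewrite ler_wpM2l ?f0// cutoff_le// ler_nat.
have gcvg t : (fun N => g N t) @ \oo --> f t.
  by rewrite -[f t]mulr1; apply: cvgM; [exact: cvg_cst|exact: cvg_cutoff].
have gpsi N : (\int[gausspt s]_x (S (g N) x)%:E = (psi (g N))%:E)%E.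
  have D : defect (g N) = 0.
    apply: defect_compact; first exact: (bg N).1.
    by exists N%:R => t Nt; rewrite /g cutoff0// mulr0.
  move/eqP: D; rewrite /defect subr_eq0 => /eqP <-.
  by rewrite fineK//; exact: (integrable_fin_num measurableT (integrable_spectral_sum pW mW s (bg N))).
have H1 : (fun N => \int[gausspt s]_x (S (g N) x)%:E)%E @ \oo --> (\int[gausspt s]_x (S f x)%:E)%E.
  have cS x : (fun N => (S (g N) x)%:E) @ \oo --> (S f x)%:E.
    apply: cvg_EFin; first exact: nearW.
    by apply: cvg_sum_seq => i; exact: gcvg.
  have -> : (\int[gausspt s]_x (S f x)%:E = \int[gausspt s]_x limn (fun N => (S (g N) x)%:E))%E.
    by apply: eq_integral => x _; apply/esym/cvg_lim => //; exact: cS.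
  apply: cvg_monotone_convergence => //.
  - move=> N; apply/measurable_EFinP; apply: (measurable_spectral_sum pW mW); exact: (bg N).1.
  - move=> N x _; rewrite lee_fin sumr_ge0// => i _; apply: g0; exact: (eig_ge0 pW).
  - move=> x _ N M NM; rewrite lee_fin ler_sum// => i _; apply: gle => //; exact: (eig_ge0 pW).
have If i := growth_fk_integrable (d0 i) cf gf.
have fkcvg k i : (fun N => fk n (g N) k (d i)) @ \oo --> fk n f k (d i).
  have mH : measurable half by exact: measurable_itv.
  apply: fine_cvg; rewrite fineK; last first.
    by have h := If i k; apply: (integrable_fin_num _ h); exact: measurable_itv.
  have w0 t : 0 <= t -> 0 <= expR (- t) * (t * d i) ^+ (n - k.+1).
    by move=> t0; rewrite mulr_ge0 ?expR_ge0// exprn_ge0// mulr_ge0// ltW.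
  have td t : 0 <= t -> 0 <= t * d i by move=> t0; rewrite mulr_ge0// ltW.
  have -> : (\int[mu]_(t in half) (fk_integrand n k f (d i) t)%:E =
      \int[mu]_(t in half) limn (fun N => (fk_integrand n k (g N) (d i) t)%:E))%E.
    apply: eq_integral => t _; apply/esym/cvg_lim => //.
    apply: cvg_EFin; first exact: nearW.
    by apply: cvgM; [exact: cvg_cst|exact: gcvg].
  apply: cvg_monotone_convergence => //.
  - by move=> N; have := bcont_fk_integrable n (d0 i) (bg N) k => /integrableP[].
  - move=> N t; rewrite /= in_itv/= andbT => t0.
    by rewrite lee_fin mulr_ge0 ?w0 ?g0 ?td.
  - move=> t; rewrite /= in_itv/= andbT => t0 N M NM.
    by rewrite lee_fin ler_wpM2l ?w0 ?gle ?td.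
have H2 : (fun N => (psi (g N))%:E) @ \oo --> (psi f)%:E.
  apply: cvg_EFin; first exact: nearW.
  apply: cvg_sum_seq => k; apply: cvg_sum_seq => i.
  apply: cvgM; last exact: cvg_cst.
  by apply: cvgM; [exact: cvg_cst|exact: fkcvg].
rewrite -(cvg_lim _ H1)// -(cvg_lim _ H2)//.
by congr (limn _); apply/funext => N; exact: gpsi.
Qed.

Lemma growth_le (f g : R -> R) : continuous f -> continuous g -> (forall t : R, f t ^+ 2 <= g t ^+ 2) ->
  growth g -> growth f.
Proof.
move=> cf cg fg gg a a0; apply: le_lt_trans (gg a a0).
have c (h : R -> R) : continuous h -> measurable_fun half (fun t : R => (expR (- (a * t)) * h t ^+ 2)%:E).
  move=> ch; apply/measurable_EFinP; apply: measurable_funTS; apply: continuous_measurable_fun.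
  apply: continuousM_real.
    apply: (@continuous_comp_real R (fun t => a * t) (fun t => expR (- t))).
      by move=> t; apply: cvgM; [exact: cvg_cst|exact: cvg_id].
    exact: continuous_expRN.
  exact: (continuous_comp_real ch (@exprn_continuous R 2)).
apply: ge0_le_integral => //.
- by move=> t _; rewrite lee_fin mulr_ge0 ?expR_ge0 ?sqr_ge0.
- exact: c.
- exact: c.
- by move=> t _; rewrite lee_fin ler_wpM2l ?expR_ge0.
Qed.

(** The positive and negative parts of [f] are continuous and inherit the growth condition.
    Integrability is recorded because the passage to the nested integral of the statement requires
    it. *)
Lemma psi_integral (f : R -> R) : continuous f -> growth f ->
  (gausspt s).-integrable setT (EFin \o S f) /\ (\int[gausspt s]_x S f x = psi f)%R.
Proof.
move=> cf gf.
have c0 t : {for t, continuous (cst 0 : R -> R^o)} by exact: cst_continuous.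
pose fp (t : R) := Num.max 0 (f t); pose fm (t : R) := Num.max 0 (- f t).
have cp : continuous fp by move=> t; exact: (continuous_max (c0 t) (cf t)).
have cm : continuous fm.
  by move=> t; apply: (continuous_max (c0 t)); apply: continuousN; exact: cf.
have gp : growth fp.
  apply: (growth_le cp cf) => // t; rewrite /fp; case: (leP 0 (f t)) => h //.
  by rewrite expr0n/= sqr_ge0.
have gm : growth fm.
  apply: (growth_le cm cf) => // t; rewrite /fm; case: (leP 0 (- f t)) => h; first by rewrite sqrrN.
  by rewrite expr0n/= sqr_ge0.
have fp0 t : 0 <= t -> 0 <= fp t by move=> _; rewrite le_max lexx.
have fm0 t : 0 <= t -> 0 <= fm t by move=> _; rewrite le_max lexx.
have fE : f = fun t => -1 * fm t + fp t.
  apply/funext => t; rewrite /fp /fm mulN1r; case: (lerP 0 (f t)) => h.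
    by rewrite (max_l (x := 0)) ?oppr_le0// oppr0 add0r.
  by rewrite max_r ?oppr_ge0 ?ltW// opprK addr0.
have I (h : R -> R) : continuous h -> (forall t, 0 <= t -> 0 <= h t) -> growth h ->
    (gausspt s).-integrable setT (EFin \o S h).
  move=> ch h0 gh; apply/integrableP; split.
    by apply/measurable_EFinP; exact: measurable_spectral_sum.
  rewrite (eq_integral (fun x => (S h x)%:E)); first by rewrite psi_integral_ge0// ltry.
  move=> x _ /=; rewrite ger0_norm// sumr_ge0// => i _; apply: h0; exact: (eig_ge0 pW).
have Ip := I fp cp fp0 gp; have Im := I fm cm fm0 gm.
have SE : S f = fun x => -1 * S fm x + S fp x.
  by apply/funext => x; rewrite {1}fE spectral_sum_lin.
have Im' : (gausspt s).-integrable setT (EFin \o (fun x => -1 * S fm x)).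
  rewrite (_ : _ \o _ = fun x => ((-1)%:E * (EFin \o S fm) x)%E); first exact: integrableZl.
  by apply/funext => x /=; rewrite EFinM.
split.
  have := integrableD measurableT Im' Ip; rewrite SE; congr (integrable _ _ _).
rewrite SE (RintegralD measurableT Im' Ip).
have -> : (\int[gausspt s]_x (-1 * S fm x) = -1 * \int[gausspt s]_x S fm x)%R by exact: RintegralZl.
have [Em Ep] : (\int[gausspt s]_x S fm x = psi fm)%R /\ (\int[gausspt s]_x S fp x = psi fp)%R.
  by rewrite /Rintegral !psi_integral_ge0.
rewrite Em Ep fE psi_lin//.
- by move=> i; exact: growth_fk_integrable.
- by move=> i; exact: growth_fk_integrable.
Qed.

End Assembly.

(** * The nested integral of the statement as a Gaussian expectation *)

Section Theorem2.

Lemma sumsq_perm (R : realType) s1 s2 (x : points R) : perm_eq s1 s2 -> sumsq s1 x = sumsq s2 x.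
Proof. exact: perm_big. Qed.

Lemma wprod_gauss_mx (R : realType) m (s : seq nat) (x : points R) (n := m.+1) :
  perm_eq (cblk (locs (@hidx m))) s -> pi ^- (n * n) *
    expR (- complex.Re (\tr (adjmx (mx_of_coords n x) *m mx_of_coords n x))) = wprod (@gauss R) s x.
Proof.
move=> sE; rewrite wprod_gauss -/(sumsq s x) -(sumsq_perm x sE) sumsq_cblk.
rewrite -(perm_size sE) size_cblk size_map -cardE card_prod !card_ord.
have pi0 : 0 <= pi :> R by rewrite pi_ge0.
have -> : (Num.sqrt (pi : R))^-1 ^+ (m.+1 * m.+1).*2 = pi ^- (n * n).
  by rewrite -mul2n exprVn exprM sqr_sqrtr.
congr (_ * expR (- _)).
have := nsq_tr (mx_of_coords n x) => /(congr1 (@complex.Re R)) /= <-.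
rewrite big_map big_enum/= -(pair_bigA _ (fun i j => nsq (cc x (hidx i j))))/=.
by apply: eq_bigr => i _; apply: eq_bigr => j _; rewrite mxE.
Qed.

Lemma Re_tr_mxfun (R : realType) n (f : R -> R) (B : 'M[R[i]]_n) :
  complex.Re (\tr (mxfun f B)) = \sum_i f (complex.Re (spectral_diag B 0 i)).
Proof.
have [P1 P2] := unitarymx_ctr (spectral_unitarymx B).
rewrite /mxfun -mulmxA mxtrace_mulC -mulmxA.
rewrite [X in _ *m X](_ : _ = 1%:M); last exact: P1.
rewrite mulmx1 mxtrace_diag.
rewrite (eq_bigr (fun i => ((f (complex.Re (spectral_diag B 0 i)))%:C)%C)) => [|i _]; last by rewrite mxE.
by rewrite -rmorph_sum.
Qed.

Lemma hidx_perm m (n := m.+1) : perm_eq (cblk (locs (@hidx m))) (rev (iota 0 (2 * (n * n)))).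
Proof.
apply: uniq_perm.
- by apply: uniq_cblk; rewrite map_inj_uniq ?enum_uniq//; exact: hidx_inj.
- by rewrite rev_uniq iota_uniq.
move=> l; rewrite mem_cblk mem_rev mem_iota add0n /=.
apply/mapP/idP => [[[i j] _ lE]|lt].
  by have := hidx_lt i j; rewrite -lE -/n; move: (n * n)%N => N; lia.
have h : (l./2 < n * n)%N by move: lt; move: (n * n)%N => N; lia.
have hi : (l./2 %/ n < n)%N by rewrite ltn_divLR.
have hj : (l./2 %% n < n)%N by rewrite ltn_mod.
by exists (Ordinal hi, Ordinal hj); rewrite ?mem_enum// /hidx /= -divn_eq.
Qed.

End Theorem2.

Theorem theorem2 (R : realType) (n : nat) (A : 'M[R[i]]_n) (d : 'I_n -> R)
  (f : R -> R) :
  (0 < n)%N ->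
  posdefmx A ->
  (forall i, eigenvalue A ((d i)%:C)%C) ->
  injective d ->
  {within `[0, +oo[, continuous f} ->
  (forall a : R, 0 < a ->
     (\int[lebesgue_measure]_(t in `[0%R, +oo[) (expR (- (a * t)) * f t ^+ 2)%:E
       < +oo)%E) ->
  gauss_mx_integral n (fun H => complex.Re (\tr (mxfun f (adjmx H *m A *m H))))
  = (\det (vandermonde_D d))^-1 * \sum_(k < n) \det (T_mx f d k).
Proof.
case: n A d => // m A d _ pA eA d_inj cf gf.
have [d0 [P uP AE]] := posdef_diagonalize pA eA d_inj.
(* Continuity of [f] is assumed on the closed half-line only. Extending it to the left by f(0)
   changes neither side, since the eigenvalues of H^*AH and the points t d_i are nonnegative. *)
pose f0 (t : R) := f (Num.max 0 t).
have f0E (t : R) : 0 <= t -> f0 t = f t by move=> t0; rewrite /f0 max_r.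
have cf0 : continuous f0.
  move=> t; have c0 : {for t, continuous (cst 0 : R -> R^o)} by exact: cst_continuous.
  have c1 : {for t, continuous (id : R -> R^o)} by exact: cvg_id.
  have cp : {for t, continuous (fun t : R => Num.max 0 t)} := continuous_max c0 c1.
  have pos (u : R) : (`[0, +oo[%classic : set R) (Num.max 0 u).
    by rewrite /= in_itv/= andbT le_max lexx.
  move/subspace_continuousP : cf => cf.
  apply: (@cvg_comp R R R (fun t : R => Num.max 0 t) f _ _ _ _ (cf _ (pos t))) => B HB.
  have h : \forall u \near t, `[0, +oo[%classic (Num.max 0 u) -> B (Num.max 0 u) := cp _ HB.
  have : \forall u \near t, B (Num.max 0 u) by apply: filterS h => u; apply; exact: pos.
  exact.
have gf0 : growth f0.
  move=> a a0; have := gf a a0; congr (_ < _)%E; apply: eq_integral.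
  by move=> t /set_mem/=; rewrite in_itv/= andbT => t0; rewrite f0E.
have sE := hidx_perm m.
have [If Ef] := psi_integral d0 d_inj uP AE sE cf0 gf0.
pose W := wishart A.
have pW (x : points R) : psd (W x) by exact: (psd_A d0 AE).
have SE x : spectral_sum W f0 x = complex.Re (\tr (mxfun f (adjmx (mx_of_coords m.+1 x) *m A *m mx_of_coords m.+1 x))).
  rewrite Re_tr_mxfun; apply: eq_bigr => i _; rewrite f0E//; exact: (eig_ge0 pW).
have mS : measurable_fun setT (spectral_sum W f0).
  exact: (measurable_spectral_sum pW (mxmeas_W A) cf0).
rewrite /gauss_mx_integral.
transitivity (iter_Rint (2 * (m.+1 * m.+1)) (fun x => wprod (@gauss R) (rev (iota 0 (2 * (m.+1 * m.+1)))) x * spectral_sum W f0 x) (fun=> 0)).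
  congr (iter_Rint _ _ _); apply/funext => x.
  by rewrite SE -(wprod_gauss_mx x sE).
rewrite iter_Rint_gauss// Ef mulr_sumr; apply: eq_bigr => k _.
have fkE i : fk m.+1 f0 k (d i) = fk m.+1 f k (d i).
  apply: eq_Rintegral => t /set_mem/=; rewrite in_itv/= andbT => t0.
  by rewrite f0E// mulr_ge0// ltW.
have := det_replace_row d_inj k (fun i => (m.+1 - k.+1)`!%:R^-1 * fk m.+1 f k (d i)).
rewrite /T_mx => ->; apply: eq_bigr => i _.
by rewrite fkE.
Qed.
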